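(* Let $0\le\gamma<1$, let $\Phi_S\in C^1(\mathbb{R}^3)$, and suppose that the following two assumptions hold. (Definiteness) The seminorm $v\mapsto\|v''\|_{L^2(0,L)}$ is a norm on the kernel of $L_{\rm bc}:H^2(0,L;\mathbb{R}^3)\to\mathbb{R}^\ell$. (Density) The subset $\mathcal{A}\cap H^3(0,L;\mathbb{R}^3)$ is dense in $\mathcal{A}$ with respect to strong convergence in $H^2$. Then $I_{\gamma,h}\to I_\gamma$ as $h\to0$ in the sense of $\Gamma$-convergence with respect to weak convergence in $H^2$, i.e., we have the following: (i) If $(u_h)_{h>0}\subset H^2(0,L;\mathbb{R}^3)$ is such that $u_h\in\mathcal{A}_h$ for every $h>0$ and $I_{\gamma,h}[u_h]\le c$ with a constant $c$, then there exists $u\in\mathcal{A}$ such that $u_h\rightharpoonup u$ in $H^2$ and $$I_\gamma[u]\le\liminf_{h\to0}I_{\gamma,h}[u_h].$$ (ii) For every $u\in\mathcal{A}$ there exists a sequence $(u_h)_{h>0}\subset H^2(0,L;\mathbb{R}^3)$ such that $u_h\to u$ in $H^2$ and $$I_\gamma[u]=\lim_{h\to0}I_{\gamma,h}[u_h].$$ (iii) Weak accumulation points in $H^2$ of sequences of quasiminimizers $(u_h)_{h>0}$ for the functionals $I_{\gamma,h}$ are minimizers for $I_\gamma$.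
   Context: Let $L>0$. $S\subset\mathbb{R}^3$ is a regular hypersurface given as the zero level set of the function $\Phi_S:\mathbb{R}^3\to\mathbb{R}$, $\Phi_S'$ denotes the gradient of $\Phi_S$, and $n_S=\Phi_S'/|\Phi_S'|$ is a unit normal field on $S$. (In the discrete functional below, $n_S$ is evaluated at $u_h$, whose values are required to lie on $S$ only at the nodes.) $L_{\rm bc}:H^2(0,L;\mathbb{R}^3)\to\mathbb{R}^\ell$ is a bounded linear operator such that $L_{\rm bc}[v]$ only depends on the boundary values of $v$ and $v'$, and $\ell_{\rm bc}\in\mathbb{R}^\ell$ is given. Continuous admissible set: $\mathcal{A}=\{v\in H^2(0,L;\mathbb{R}^3):|v'|^2=1,\ \Phi_S(v)=0,\ L_{\rm bc}[v]=\ell_{\rm bc}\}$, with the constraints holding on $[0,L]$; $\mathcal{A}$ is assumed to be nonempty. Finite elements: for partitions $0=z_0<z_1<\dots<z_J=L$ with maximal mesh size $h=\max_{j}|z_j-z_{j-1}|$, let $V_h$ be the space of all $v_h\in C^1([0,L];\mathbb{R}^3)$ such that $v_h|_{[z_{j-1},z_j]}$ is componentwise a polynomial of degree at most $3$ for $j=1,\dots,J$. The discrete admissible set is $$\mathcal{A}_h=\{v_h\in V_h:\ |v_h'(z_j)|=1,\ \Phi_S(v_h(z_j))=0\text{ for }j=0,\dots,J,\ L_{\rm bc}[v_h]=\ell_{\rm bc}\}.$$ Functionals on $H^2(0,L;\mathbb{R}^3)$: $$I_\gamma[u]=\frac12\int_0^L|u''|^2-\gamma|u''\cdot n_S(u)|^2\,dx\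 \text{ if }u\in\mathcal{A},\qquad I_\gamma[u]=+\infty\ \text{ if }u\in H^2(0,L;\mathbb{R}^3)\setminus\mathcal{A},$$ $$I_{\gamma,h}[u_h]=\frac12\int_0^L|u_h''|^2-\gamma|u_h''\cdot n_S(u_h)|^2\,dx\ \text{ if }u_h\in\mathcal{A}_h,\qquad I_{\gamma,h}[u_h]=+\infty\ \text{ if }u_h\in H^2(0,L;\mathbb{R}^3)\setminus\mathcal{A}_h.$$ Quasiminimizers for $I_{\gamma,h}$ are functions $u_h$ with $I_{\gamma,h}[u_h]\le\inf I_{\gamma,h}+\varepsilon_h$, where $\varepsilon_h\ge0$ and $\varepsilon_h\to0$ as $h\to0$.
   Formalization: In (i) the weak convergence of u_h to u is claimed only for a subsequence (the liminf is still over the whole sequence), since alternating between discretizations of two different admissible curves shows that the whole sequence need not converge. *)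

(* Defs.v *)
From HB Require Import structures.
From mathcomp Require Import all_boot all_order all_algebra.
From mathcomp Require Import all_classical all_reals all_analysis.

Set Implicit Arguments.
Unset Strict Implicit.
Unset Printing Implicit Defensive.

Import Order.TTheory GRing.Theory Num.Theory.
Import numFieldNormedType.Exports.

Local Open Scope classical_set_scope.
Local Open Scope ring_scope.

(* The library norm on 'rV[R]_n is the sup norm, hence the explicit Euclidean
   norm. *)
Section Euclidean.
Context {R : realType} {n : nat}.

Definition dot (a b : 'rV[R]_n) : R := \sum_(i < n) a 0 i * b 0 i.

Definition enorm (a : 'rV[R]_n) : R := Num.sqrt (dot a a).

End Euclidean.

Section Surface.
Context {R : realType} {n : nat}.

Definition grad (Phi : 'rV[R]_n -> R) (x : 'rV[R]_n) : 'rV[R]_n :=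
  \row_(i < n) 'D_(delta_mx 0 i) Phi x.

Definition C1_field (Phi : 'rV[R]_n -> R) : Prop :=
  (forall x, differentiable Phi x) /\ continuous (grad Phi).

Definition regular_level_set (Phi : 'rV[R]_n -> R) : Prop :=
  forall x, Phi x = 0 -> grad Phi x != 0.

(* Equal to 0 (as 0^-1 = 0) at the points where the gradient vanishes; by
   [regular_level_set] there are none on the surface. *)
Definition normal (Phi : 'rV[R]_n -> R) (x : 'rV[R]_n) : 'rV[R]_n :=
  (enorm (grad Phi x))^-1 *: grad Phi x.

End Surface.

Section Sobolev.
Context {R : realType} (L : R) {n : nat}.
Let mu := @lebesgue_measure R.
Implicit Types f g u v : R -> 'rV[R]_n.

(* Continuously differentiable test functions with compact support in the open
   interval ]0, L[. *)
Definition test_function (phi : R -> R) : Prop :=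
  [/\ forall x, derivable phi x 1,
      continuous (derive1 phi) &
      exists a b : R, [/\ 0 < a, b < L & forall x, phi x != 0 -> a <= x <= b]].

Definition L2 f : Prop :=
  forall i : 'I_n,
    measurable_fun `[0, L] (fun x => f x 0 i) /\
    (\int[mu]_(x in `[0%R, L]) ((f x 0 i) ^+ 2)%:E < +oo)%E.

Definition weak_deriv f g : Prop :=
  forall phi, test_function phi -> forall i : 'I_n,
    \int[mu]_(x in `[0, L]) (f x 0 i * derive1 phi x) =
    - \int[mu]_(x in `[0, L]) (g x 0 i * phi x).

Fixpoint Hm (m : nat) f : Prop :=
  if m is m'.+1 then L2 f /\ exists g, weak_deriv f g /\ Hm m' g else L2 f.

(* The elements of H^2 (0, L) are identified with their continuous
   representative on [0, L]; the values outside of [0, L] are irrelevant. *)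
Definition H2 u : Prop := {within `[0, L], continuous u} /\ Hm 2 u.

(* [d1 u] is the continuous representative on [0, L] of the weak derivative of
   u, so that its values at single points, including 0 and L, make sense;
   [d2 u] is determined by u up to a null set. *)
Definition d1 u : R -> 'rV[R]_n :=
  xget (fun=> 0) [set g | {within `[0, L], continuous g} /\ weak_deriv u g].

Definition d2 u : R -> 'rV[R]_n :=
  xget (fun=> 0) [set g | L2 g /\ weak_deriv (d1 u) g].

Definition H3 u : Prop := H2 u /\ Hm 3 u.

Definition L2norm f : R :=
  Num.sqrt (\int[mu]_(x in `[0, L]) (enorm (f x) ^+ 2)).

Definition H2norm u : R :=
  Num.sqrt (L2norm u ^+ 2 + L2norm (d1 u) ^+ 2 + L2norm (d2 u) ^+ 2).

(* Bounded linear maps from H^2 (0, L) into V, normed by nrm. *)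
Definition bounded_linear (V : lmodType R) (nrm : V -> R)
    (F : (R -> 'rV[R]_n) -> V) : Prop :=
  (forall (a : R) u v, H2 u -> H2 v ->
     F (fun x => a *: u x + v x) = a *: F u + F v) /\
  (exists C : R, forall u, H2 u -> nrm (F u) <= C * H2norm u).

Definition weak_cvg (u_ : nat -> R -> 'rV[R]_n) u : Prop :=
  forall F : (R -> 'rV[R]_n) -> R^o, bounded_linear (fun y : R^o => `|y|) F ->
    (fun k => F (u_ k)) @ \oo --> F u.

Definition strong_cvg (u_ : nat -> R -> 'rV[R]_n) u : Prop :=
  (fun k => H2norm (fun x => u_ k x - u x)) @ \oo --> (0 : R).

Definition depends_only_on_bdry (V : Type) (F : (R -> 'rV[R]_n) -> V) : Prop :=
  forall u v, H2 u -> H2 v ->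
    u 0 = v 0 -> u L = v L -> d1 u 0 = d1 v 0 -> d1 u L = d1 v L -> F u = F v.

End Sobolev.

(* As with [itv_partition], the sequence s lists the nodes z_1 < ... < z_J = L
   without z_0 = 0, so that J = size s. *)
Section FiniteElements.
Context {R : realType} (L : R) {n : nat}.
Implicit Types (s : seq R) (v : R -> 'rV[R]_n).

Definition node s (j : nat) : R := nth 0 (0 :: s) j.

Definition mesh s : R :=
  \big[Num.max/0]_(j < size s) `|node s j.+1 - node s j|.

Definition C1_itv v : Prop :=
  {within `[0, L], continuous v} /\
  exists g : R -> 'rV[R]_n, {within `[0, L], continuous g} /\
    forall x : R, 0 < x < L -> is_derive x (1 : R) v (g x).

Definition FE_space s v : Prop :=
  C1_itv v /\
  forall j : nat, (j < size s)%N -> forall i : 'I_n,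
    exists p : {poly R}, (size p <= 4)%N /\
      forall x, node s j <= x <= node s j.+1 -> v x 0 i = p.[x].

End FiniteElements.

Section Functionals.
Context {R : realType} (L gamma : R) (Phi : 'rV[R]_3 -> R).
Context (l : nat) (Lbc : (R -> 'rV[R]_3) -> 'rV[R]_l) (lbc : 'rV[R]_l).
Let mu := @lebesgue_measure R.
Implicit Types (s : seq R) (u v : R -> 'rV[R]_3).

Definition admissible v : Prop :=
  [/\ H2 L v,
      forall x : R, 0 <= x <= L -> enorm (d1 L v x) ^+ 2 = 1,
      forall x : R, 0 <= x <= L -> Phi (v x) = 0 &
      Lbc v = lbc].

Definition admissible_h s v : Prop :=
  [/\ FE_space L s v,
      forall j : nat, (j <= size s)%N -> enorm (d1 L v (node s j)) = 1,
      forall j : nat, (j <= size s)%N -> Phi (v (node s j)) = 0 &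
      Lbc v = lbc].

Definition energy u : R :=
  2^-1 * \int[mu]_(x in `[0, L])
    (enorm (d2 L u x) ^+ 2
     - gamma * `|dot (d2 L u x) (normal Phi (u x))| ^+ 2).

Definition I_ u : \bar R :=
  if `[< admissible u >] then (energy u)%:E else +oo%E.

Definition I_h s u : \bar R :=
  if `[< admissible_h s u >] then (energy u)%:E else +oo%E.

Definition minimizer u : Prop :=
  H2 L u /\ forall v, H2 L v -> (I_ u <= I_ v)%E.

Definition quasiminimizer s (eps : R) u : Prop :=
  H2 L u /\ (I_h s u <= ereal_inf [set I_h s v | v in H2 L] + eps%:E)%E.

End Functionals.

(* Main.v *)
(* [H2 L] with the inner product [ip L], which takes the values u(0), u'(0) and
   u'' into account, is a Hilbert space whose norm is equivalent to [H2norm L]; so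
   bounded sequences have weakly convergent subsequences.  Since
   |a|^2 - gamma (a.n)^2 >= (1 - gamma) |a|^2, the energy bounds u'' in L^2; at
   the nodes |u'| = 1, and definiteness controls the constant part of u by the
   boundary conditions, so (i) starts from an H^2-bounded sequence.  The
   constraints pass to the limit because the functions and their derivatives are
   Hoelder continuous uniformly in h.  With e_h = u_h'' - u'', the energy of u_h
   minus the nonnegative energy density of e_h, taken with the normal at u_h,
   converges to the energy of u: the cross terms are products of the weakly
   null e_h with functions that converge strongly by dominated convergence.
   This gives lower semicontinuity, and also continuity under strong convergence.
   For (ii), the cubic Hermite interpolant of u at the nodes is admissible, and
   its second derivative is the elementwise L^2 projection of u'' to the affine
   functions; so the error is controlled by the distance of u'' to the second
   derivatives of the functions in H^3, which vary little on each element, and by density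
   it tends to zero.  (iii) follows from (i) and (ii). *)

Require Import Defs.
From HB Require Import structures.
From mathcomp Require Import all_boot all_order all_algebra.
From mathcomp Require Import all_classical all_reals all_analysis.
From mathcomp Require Import measurable_realfun ring lra.

Set Implicit Arguments.
Unset Strict Implicit.
Unset Printing Implicit Defensive.

Import Order.TTheory GRing.Theory Num.Theory.
Import numFieldNormedType.Exports.

Local Open Scope classical_set_scope.
Local Open Scope ring_scope.

(** * Weak compactness in Hilbert spaces *)

(** Elements of H^2 are everywhere defined functions whose values off [[0, L]] are arbitrary, so
    [ip] is only semidefinite on them. Instead of passing to a quotient and representing
    functionals, the abstract weak limit is built as a strong limit of iterated midpoints and tested
    against functionals bounded by the form. Calculus is done with primitives: a weak derivative is
    traded once for [u x = u 0 + prim w x], after which evaluation, Hoelder bounds, completeness and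
    finite elements become statements about integrals over [[0, x]]. The delicate point of the
    energy is the normal: between the nodes [u_h] may leave the surface and even meet zeros of the
    gradient, where [normal] is 0. Along the sequence only [|normal| <= 1] and measurability are
    therefore used, and convergence of the normals is only pointwise, towards points of the surface,
    where the gradient does not vanish. *)

Lemma discriminant_le (R : realType) (a b c : R) :
  (forall t, 0 <= a * t ^+ 2 + 2 * b * t + c) -> b ^+ 2 <= a * c.
Proof.
move=> H.
have c0 : 0 <= c by have := H 0; rewrite expr0n /= !mulr0 !add0r.
have [a0|a0|a0] := ltgtP a 0.
(* At [T >= 1] one has [a T + 2 b <= a - c - 1], so the quadratic is at most [a - 1 < 0] there. *)
- pose T := (2 * `|b| + c + 1) / (- a) + 1.
  have aT : a * T = a - (2 * `|b| + c + 1) by rewrite /T; field; rewrite lt_eqF.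
  have T1 : 1 <= T.
    rewrite /T lerDr divr_ge0 ?oppr_ge0 ?(ltW a0)//.
    by have := normr_ge0 b; lra.
  have := H T; have := ler_norm b.
  have -> : a * T ^+ 2 + 2 * b * T + c = (a * T + 2 * b) * T + c by ring.
  rewrite aT => bB; nra.
- have := H (- b / a); have a0' : a != 0 by rewrite gt_eqF.
  have -> : a * (- b / a) ^+ 2 + 2 * b * (- b / a) + c = (a * c - b ^+ 2) / a.
    by field.
  by rewrite pmulr_lge0 ?invr_gt0// subr_ge0.
- rewrite a0 mul0r; suff -> : b = 0 by rewrite expr0n.
  apply/eqP; apply: contraT => b0.
  have := H (- (c + 1) / (2 * b)); rewrite a0 mul0r add0r.
  have -> : 2 * b * (- (c + 1) / (2 * b)) = - (c + 1).
    by field; exact: b0.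
  lra.
Qed.

Lemma invS_lt (R : realType) (e : R) k :
  0 < e -> (Num.bound e^-1 <= k)%N -> k.+1%:R^-1 < e.
Proof.
move=> e0 bk; rewrite -(invrK e) ltf_pV2 ?posrE ?invr_gt0//.
have einv : 0 <= e^-1 by rewrite invr_ge0 ltW.
by apply: lt_le_trans (archi_boundP einv) _; rewrite ler_nat (leq_trans bk).
Qed.

Lemma extraction (P : nat -> nat -> Prop) :
  (forall k n, exists m, (n <= m)%N /\ P k m) ->
  exists sigma : nat -> nat,
    {homo sigma : i j / (i < j)%N} /\ forall k, P k (sigma k).
Proof.
move=> H.
have [f Hf] : {f : nat -> nat -> nat &
    forall k n, (n <= f k n)%N /\ P k (f k n)}.
  have g k n : {m | (n <= m)%N /\ P k m} by exact: cid.
  by exists (fun k n => projT1 (g k n)) => k n; exact: projT2 (g k n).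
pose fix sigma k := if k is k'.+1 then f k (sigma k').+1 else f 0%N 0%N.
exists sigma; split; last by case=> [|k]; [case: (Hf 0%N 0%N)|case: (Hf k.+1 (sigma k).+1)].
have step k : (sigma k < sigma k.+1)%N by case: (Hf k.+1 (sigma k).+1).
move=> i j; elim: j => // j IH; rewrite ltnS leq_eqVlt => /predU1P[->//|/IH].
by move=> h; apply: ltn_trans h (step j).
Qed.

(* The limits [l j] are the limits along a nonprincipal ultrafilter, which
   replaces the usual diagonal argument. *)
Lemma diagonal_extraction (R : realType) (a : nat -> nat -> R) (M : nat -> R) :
  (forall j k, `|a j k| <= M j) ->
  exists (sigma : nat -> nat) (l : nat -> R),
    {homo sigma : i j / (i < j)%N} /\
    forall j, (fun k => a j (sigma k)) @ \oo --> l j.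
Proof.
move=> aM.
have [G [UG ooG]] := @ultraFilterLemma nat \oo _.
have lim j : exists l, forall e : R, 0 < e -> G [set k | `|a j k - l| < e].
  have := @segment_compact R (- M j) (M j) (a j @ G) _.
  case => /=.
    apply: (@filterS _ G _ setT); last exact: filterT.
    by move=> k _ /=; rewrite in_itv /= -ler_norml.
  move=> l [_ cl]; exists l => e e0.
  have [//|Gn] := in_ultra_setVsetC [set k | `|a j k - l| < e] UG.
  have [] := cl (a j @` ~` [set k | `|a j k - l| < e]) (ball l e).
  - by apply: (@filterS _ G _ _ _ _ Gn) => k nk; exists k.
  - exact: nbhsx_ballx.
  - by move=> _ [[k nk <-]]; rewrite /ball /= distrC => /nk.
have [l Hl] := choice lim.
(* At stage [k] only the rows [j <= k] are controlled: these finitely many sets and the tail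
   [n <= m] all belong to the ultrafilter, so they have a common point. *)
have [|sigma [s1 s2]] := @extraction
    (fun k m => forall j, (j <= k)%N -> `|a j m - l j| < k.+1%:R^-1).
  move=> k n.
  have : G [set m | forall j : 'I_k.+1, `|a j m - l j| < k.+1%:R^-1].
    by apply: filter_forall => j; apply: Hl; rewrite invr_gt0.
  have : G [set m | (n <= m)%N] by apply: ooG; exists n.
  move=> G1 G2; have [m [nm Hm]] := filter_ex (@filterI _ G _ _ _ G1 G2).
  by exists m; split => // j jk; have := Hm (Ordinal (jk : (j < k.+1)%N)).
exists sigma, l; split => // j.
apply/cvgrPdist_lt => e e0; near=> k.
rewrite distrC (lt_trans (s2 k j _))//; first by near: k; exists j.
by apply: invS_lt => //; near: k; exists (Num.bound e^-1).
Unshelve. all: by end_near. Qed.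

Section Hilbert.
Context {R : realType} (V : lmodType R) (H : V -> Prop) (B : V -> V -> R).
Hypothesis H_lin : forall a u v, H u -> H v -> H (a *: u + v).
Hypothesis B_lin : forall a u v w, H u -> H v -> H w ->
  B (a *: u + v) w = a * B u w + B v w.
Hypothesis B_sym : forall u v, H u -> H v -> B u v = B v u.
Hypothesis B_ge0 : forall u, H u -> 0 <= B u u.
Hypothesis B_complete : forall x : nat -> V, (forall m, H (x m)) ->
  (forall e : R, 0 < e -> exists N, forall m n, (N <= m)%N -> (N <= n)%N ->
     B (x m - x n) (x m - x n) <= e) ->
  exists y, H y /\
    forall e : R, 0 < e -> exists N, forall m, (N <= m)%N ->
      B (x m - y) (x m - y) <= e.

Lemma subr_scale (u v : V) : u - v = -1 *: v + u.
Proof. by rewrite scaleN1r addrC. Qed.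

Lemma H_sub u v : H u -> H v -> H (u - v).
Proof. by move=> Hu Hv; rewrite subr_scale; exact: H_lin. Qed.

Lemma B_linr a u v w : H u -> H v -> H w ->
  B w (a *: u + v) = a * B w u + B w v.
Proof.
move=> Hu Hv Hw.
by rewrite B_sym ?B_lin ?(B_sym Hu Hw) ?(B_sym Hv Hw)//; exact: H_lin.
Qed.

Lemma B_subl u v w : H u -> H v -> H w -> B (u - v) w = B u w - B v w.
Proof. by move=> *; rewrite subr_scale B_lin// mulN1r addrC. Qed.

Lemma B_sub2 u v : H u -> H v ->
  B (u - v) (u - v) = B u u - 2 * B u v + B v v.
Proof.
move=> Hu Hv; rewrite B_subl//; last exact: H_sub.
rewrite subr_scale !B_linr// (B_sym Hv Hu); ring.
Qed.

Lemma B_cauchy_schwarz u v : H u -> H v -> B u v ^+ 2 <= B u u * B v v.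
Proof.
move=> Hu Hv; apply: discriminant_le => t.
have := B_ge0 (H_lin t Hu Hv).
by rewrite B_lin ?B_linr//; [rewrite (B_sym Hv Hu); lra|exact: H_lin].
Qed.

(** Iterated midpoints of the tail replace its convex hull: the parallelogram law asks for midpoints
    only, and bounds and orthogonality pass to them by induction, without weights. *)
Inductive midpoints (u : nat -> V) (m : nat) : V -> Prop :=
| midpoints_base k : (m <= k)%N -> midpoints u m (u k)
| midpoints_step x y : midpoints u m x -> midpoints u m y ->
    midpoints u m (2^-1 *: x + 2^-1 *: y).

Lemma midpoints_le u m n x : (m <= n)%N -> midpoints u n x -> midpoints u m x.
Proof.
move=> mn; elim=> [k nk|y z _ ? _ ?]; last exact: midpoints_step.
by apply: midpoints_base; exact: leq_trans nk.
Qed.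

Lemma H_half x y : H x -> H y -> H (2^-1 *: x + 2^-1 *: y).
Proof.
move=> Hx Hy; apply: H_lin => //.
rewrite -[2^-1 *: y]addr0; apply: H_lin => //.
by rewrite -(subrr y); exact: H_sub.
Qed.

Lemma H0 x : H x -> H 0.
Proof. by move=> Hx; rewrite -(subrr x); exact: H_sub. Qed.

Lemma B0 x w : H x -> H w -> B 0 w = 0.
Proof. by move=> Hx Hw; rewrite -(subrr x) B_subl// subrr. Qed.

Lemma B_scale a x w : H x -> H w -> B (a *: x) w = a * B x w.
Proof.
by move=> Hx Hw; rewrite -[a *: x]addr0 B_lin ?(B0 Hx Hw) ?addr0//; exact: H0 Hx.
Qed.

Lemma B_half x y w : H x -> H y -> H w ->
  B (2^-1 *: x + 2^-1 *: y) w = 2^-1 * (B x w + B y w).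
Proof.
move=> Hx Hy Hw; rewrite B_lin ?B_scale ?mulrDr//.
by rewrite -[2^-1 *: y]addr0; apply: H_lin => //; exact: H0 Hy.
Qed.

Lemma parallelogram x y : H x -> H y ->
  B (x - y) (x - y) = 2 * B x x + 2 * B y y
    - 4 * B (2^-1 *: x + 2^-1 *: y) (2^-1 *: x + 2^-1 *: y).
Proof.
move=> Hx Hy; have Hh := H_half Hx Hy.
rewrite B_sub2// B_half// (B_sym Hx Hh) (B_sym Hy Hh) !B_half//.
rewrite (B_sym Hy Hx); lra.
Qed.

Lemma midpoints_H u m x : (forall k, H (u k)) -> midpoints u m x -> H x.
Proof. by move=> Hu; elim=> // y z _ ? _ ?; exact: H_half. Qed.

(* The squared distance of 0 to the sets [midpoints u m] increases with m to a
   finite limit, so almost minimizers are a Cauchy sequence by the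
   parallelogram law. *)
Lemma mazur u M : (forall k, H (u k)) -> (forall k, B (u k) (u k) <= M) ->
  exists (g : V) (x : nat -> V), [/\ H g, forall m, midpoints u m (x m) &
    forall e : R, 0 < e -> exists N, forall m, (N <= m)%N ->
      B (x m - g) (x m - g) <= e].
Proof.
move=> Hu uM.
pose A m := [set B y y | y in midpoints u m].
have lbA m : lbound (A m) 0.
  by move=> _ [y my <-]; apply: B_ge0; exact: midpoints_H my.
have infA m : has_inf (A m).
  split; last by exists 0.
  by exists (B (u m) (u m)), (u m) => //; exact: midpoints_base.
have d_le m y : midpoints u m y -> inf (A m) <= B y y.
  by move=> my; apply: ge_inf; [exists 0|exists y].
have d_mono m n : (m <= n)%N -> inf (A m) <= inf (A n).
  move=> mn; apply: lb_le_inf; first by case: (infA n).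
  by move=> _ [y ny <-]; apply: d_le; exact: midpoints_le ny.
have dM m : inf (A m) <= M.
  by apply: le_trans (uM m); apply: d_le; exact: midpoints_base.
have ex m : exists y, midpoints u m y /\ B y y < inf (A m) + m.+1%:R^-1.
  have [|_ [y my <-] h] := @inf_adherent _ (A m) m.+1%:R^-1 _ (infA m).
    by rewrite invr_gt0.
  by exists y.
have [x Hx] := choice ex.
have xH m : H (x m) by have [+ _] := Hx m; exact: midpoints_H.
have [|g [Hg xg]] := B_complete xH; last first.
  by exists g, x; split => // m; case: (Hx m).
move=> e e0.
have hs : has_sup (range (fun m => inf (A m))).
  by split; [exists (inf (A 0%N)), 0%N|exists M => _ [m _ <-]].
(* In the parallelogram law the two almost-minimality errors enter with factor 2 each and the gap
   between the supremum and [inf (A N0)] with factor 4, hence [e / 8]. *)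
have [|_ [N0 _ <-] hN0] := @sup_adherent _ (range (fun m => inf (A m))) (e / 8) _ hs.
  by lra.
pose N1 := Num.bound (e / 8)^-1.
have small m : (N1 <= m)%N -> m.+1%:R^-1 <= e / 8.
  by move=> Nm; apply/ltW/invS_lt => //; lra.
exists (maxn N0 N1) => m n; rewrite !geq_max => /andP[m0 m1] /andP[n0 n1].
have [_ xm] := Hx m; have [_ xn] := Hx n.
have dS k : inf (A k) <= sup (range (fun m => inf (A m))).
  by apply: ub_le_sup; [case: hs|exists k].
rewrite parallelogram//.
have : inf (A N0) <= B (2^-1 *: x m + 2^-1 *: x n) (2^-1 *: x m + 2^-1 *: x n).
  apply: d_le; apply: midpoints_step.
  - by apply: midpoints_le m0 _; case: (Hx m).
  - by apply: midpoints_le n0 _; case: (Hx n).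
have := dS m; have := dS n; have := small m m1; have := small n n1.
move: hN0 xm xn => /=; move: (m.+1%:R^-1) (n.+1%:R^-1) (sup _) (inf _) (inf _) (inf _) => *; lra.
Qed.

Lemma B_cvgl x g w : (forall m, H (x m)) -> H g -> H w ->
  (forall e : R, 0 < e -> exists N, forall m, (N <= m)%N ->
      B (x m - g) (x m - g) <= e) ->
  (fun m => B (x m) w) @ \oo --> B g w.
Proof.
move=> Hx Hg Hw xg; apply/cvgrPdist_le => e e0.
have W1 : 0 < B w w + 1 by have := B_ge0 Hw; lra.
have [|N HN] := xg (e ^+ 2 / (B w w + 1)); first by rewrite divr_gt0 ?exprn_gt0.
exists N => // m /= /HN h; rewrite distrC -B_subl//.
have := B_cauchy_schwarz (H_sub (Hx m) Hg) Hw.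
move: h; rewrite ler_pdivlMr// => h.
have := B_ge0 (H_sub (Hx m) Hg); have := B_ge0 Hw.
move=> w0 d0 cs; rewrite -ler_sqr ?nnegrE ?(ltW e0)// real_normK ?num_real//.
nra.
Qed.

Lemma midpoints_approx u m x (f : V -> R) (l e : R) :
  (forall k, H (u k)) ->
  (forall x y, H x -> H y -> f (2^-1 *: x + 2^-1 *: y) = 2^-1 * (f x + f y)) ->
  (forall k, (m <= k)%N -> `|f (u k) - l| <= e) -> midpoints u m x ->
  `|f x - l| <= e.
Proof.
move=> Hu f_half fl; elim=> [k|y z my IHy mz IHz]; first exact: fl.
rewrite f_half; [|exact: midpoints_H my|exact: midpoints_H mz].
by move: IHy IHz; rewrite !ler_norml => /andP[? ?] /andP[? ?]; apply/andP; lra.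
Qed.

Lemma midpoints_cvg u x (f : V -> R) (l : R) :
  (forall k, H (u k)) ->
  (forall x y, H x -> H y -> f (2^-1 *: x + 2^-1 *: y) = 2^-1 * (f x + f y)) ->
  (fun k => f (u k)) @ \oo --> l -> (forall m, midpoints u m (x m)) ->
  (fun m => f (x m)) @ \oo --> l.
Proof.
move=> Hu f_half fl mx; apply/cvgrPdist_le => e e0.
move/cvgrPdist_le : fl => /(_ _ e0)[N _ HN].
exists N => // m /= Nm; rewrite distrC; apply: midpoints_approx (mx m) => // k mk.
by rewrite distrC; apply: HN; exact: leq_trans mk.
Qed.

Lemma midpoints_sub u (tau : nat -> nat) m x : (forall k, (k <= tau k)%N) ->
  midpoints (u \o tau) m x -> midpoints u m x.
Proof.
move=> ht; elim=> [k mk|y z _ ? _ ?]; last exact: midpoints_step.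
by apply: midpoints_base; apply: leq_trans mk (ht k).
Qed.

Lemma homo_ge (sigma : nat -> nat) :
  {homo sigma : i j / (i < j)%N} -> forall k, (k <= sigma k)%N.
Proof.
move=> s; elim=> // k IH; apply: leq_ltn_trans IH _; exact: s.
Qed.

Lemma homo_cvg (sigma : nat -> nat) :
  {homo sigma : i j / (i < j)%N} -> sigma @ \oo --> \oo.
Proof.
move=> s A [N _ HN]; exists N => // k /= Nk; apply: HN => /=.
exact: leq_trans Nk (homo_ge s k).
Qed.

Lemma H_half_lin (F : V -> R) :
  (forall a u v, H u -> H v -> F (a *: u + v) = a * F u + F v) ->
  forall x y, H x -> H y -> F (2^-1 *: x + 2^-1 *: y) = 2^-1 * (F x + F y).
Proof.
move=> Flin x y Hx Hy.
have F0 : F 0 = 0 by rewrite -(subrr x) subr_scale Flin// mulN1r addrC subrr.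
have FZ : F (2^-1 *: y) = 2^-1 * F y.
  by rewrite -[2^-1 *: y]addr0 Flin ?F0 ?addr0//; exact: H0 Hy.
rewrite Flin// ?FZ ?mulrDr//.
by rewrite -[2^-1 *: y]addr0; apply: H_lin => //; exact: H0 Hy.
Qed.

(** The strong limit [g] of midpoints is identified by its products with the sequence. If [F] did
    not tend to [F g], some subsequence would have [F] tending to another value [l'], and a midpoint
    limit [g'] with the same products. Then [g - g'] is orthogonal to every [u j], hence to [g] and
    [g'], so it is null for [B]; the bound on [F] gives [F g = F g' = l'], a contradiction. *)
Theorem weak_compactness u M :
  (forall k, H (u k)) -> (forall k, B (u k) (u k) <= M) ->
  exists (g : V) (sigma : nat -> nat), [/\ H g,
    {homo sigma : i j / (i < j)%N} &
    forall (F : V -> R) (C : R),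
      (forall a u v, H u -> H v -> F (a *: u + v) = a * F u + F v) ->
      (forall u, H u -> F u ^+ 2 <= C * B u u) ->
      (fun k => F (u (sigma k))) @ \oo --> F g].
Proof.
move=> Hu uM.
have M0 : 0 <= M by apply: le_trans (uM 0%N); exact: B_ge0.
have [|sigma [l [s_mono s_cvg]]] := @diagonal_extraction R
    (fun j k => B (u k) (u j)) (fun=> M).
  move=> j k; rewrite -ler_sqr ?nnegrE// real_normK ?num_real//.
  apply: le_trans (B_cauchy_schwarz (Hu k) (Hu j)) _.
  by rewrite expr2; apply: ler_pM; rewrite ?B_ge0.
pose v := u \o sigma; have Hv k : H (v k) by exact: Hu.
have vM k : B (v k) (v k) <= M by exact: uM.
have Bhalf w : H w -> forall x y, H x -> H y ->
    B (2^-1 *: x + 2^-1 *: y) w = 2^-1 * (B x w + B y w).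
  by move=> Hw x y Hx Hy; exact: B_half.
(* The limits [l j] survive the passage to subsequences and to midpoints, so all strong limits
   obtained in this way have the same products with the [u j]. *)
have char (tau : nat -> nat) g x : {homo tau : i j / (i < j)%N} -> H g ->
    (forall m, midpoints (v \o tau) m (x m)) ->
    (forall e : R, 0 < e -> exists N, forall m, (N <= m)%N ->
      B (x m - g) (x m - g) <= e) -> forall j, B g (u j) = l j.
  move=> ht Hg mx xg j.
  have Hx m : H (x m) by apply: midpoints_H (mx m) => k; exact: Hv.
  have c1 := B_cvgl Hx Hg (Hu j) xg.
  have c2 : (fun m => B (x m) (u j)) @ \oo --> l j.
    apply: (@midpoints_cvg (v \o tau) x (fun w => B w (u j))) => //.
    - by move=> k; exact: Hv.
    - exact: Bhalf.
    - exact: (cvg_comp _ _ (homo_cvg ht) (s_cvg j)).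
  by apply: cvg_unique c1 c2; exact: Rhausdorff.
have [g [x [Hg mx xg]]] := mazur Hv vM.
have gl := char id g x (fun _ _ h => h) Hg mx xg.
exists g, sigma; split => // F C Flin FC.
have C0 : (forall w, H w -> B w w = 0 -> F w = 0).
  move=> w Hw w0; have := FC w Hw; rewrite w0 mulr0 => h.
  by apply/eqP; rewrite -sqrf_eq0 eq_le h sqr_ge0.
apply/cvgrPdist_lt => e e0; apply: contrapT => ncvg.
have [|tau [t_mono t_far]] := @extraction (fun _ m => e <= `|F g - F (v m)|).
  move=> _ n; apply: contrapT => hn; apply: ncvg.
  exists n => // m /= nm; rewrite ltNge; apply/negP => h; apply: hn.
  by exists m.
have [l' [rho [r_mono r_cvg]]] : exists (l' : R) (rho : nat -> nat),
   {homo rho : i j / (i < j)%N} /\ (fun k => F (v (tau (rho k)))) @ \oo --> l'.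
  have [|rho [l' [r1 r2]]] := @diagonal_extraction R
      (fun j k => F (v (tau k))) (fun=> `|C| * M + 1).
    move=> _ k; have := FC _ (Hv (tau k)).
    have : C * B (v (tau k)) (v (tau k)) <= `|C| * M.
      apply: le_trans (ler_wpM2r (B_ge0 (Hv _)) (ler_norm C)) _.
      by apply: ler_wpM2l.
    move=> h1 h2; have h3 : F (v (tau k)) ^+ 2 <= `|C| * M by exact: le_trans h2 h1.
    rewrite ler_norml; apply/andP; nra.
  by exists (l' 0%N), rho; split => //; exact: (r2 0%N).
pose w := v \o (tau \o rho).
have tr_mono : {homo tau \o rho : i j / (i < j)%N}.
  by move=> i j ij; apply: t_mono; exact: r_mono.
have [g' [x' [Hg' mx' xg']]] :=
  @mazur w M (fun k => Hv (tau (rho k))) (fun k => vM (tau (rho k))).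
have gl' := char (tau \o rho) g' x' tr_mono Hg' mx' xg'.
have Hx m : H (x m) by apply: midpoints_H (mx m) => k; exact: Hv.
have Hx' m : H (x' m) by apply: midpoints_H (mx' m) => k; exact: Hv.
have orth j : B (u j) (g - g') = 0.
  by rewrite B_sym ?B_subl ?gl ?gl' ?subrr//; exact: H_sub.
have orth_mid m y : midpoints v m y -> B y (g - g') = 0.
  elim=> [k _|y1 y2 m1 IH1 m2 IH2]; first exact: orth.
  rewrite B_half ?IH1 ?IH2 ?addr0 ?mulr0//; [exact: midpoints_H m1|
    exact: midpoints_H m2|exact: H_sub].
have lim0 z y : H z -> (forall m, H (y m)) -> (forall m, midpoints v m (y m)) ->
    (forall e : R, 0 < e -> exists N, forall m, (N <= m)%N ->
      B (y m - z) (y m - z) <= e) -> B z (g - g') = 0.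
  move=> Hz Hy my yz.
  have c1 := B_cvgl Hy Hz (H_sub Hg Hg') yz.
  have c2 : (fun m => B (y m) (g - g')) @ \oo --> (0 : R).
    rewrite (_ : (fun m => _) = cst 0); first exact: cvg_cst.
    by apply/funext => m; exact: orth_mid (my m).
  by apply: cvg_unique c1 c2; exact: Rhausdorff.
have Fgg : F g = F g'.
  suff : F (g - g') = 0.
    by rewrite subr_scale Flin// mulN1r => /eqP; rewrite addrC subr_eq0 => /eqP.
  apply: C0; first exact: H_sub.
  rewrite B_subl//; last exact: H_sub.
  rewrite (lim0 g x)// (lim0 g' x') ?subrr// => m.
  by apply: (@midpoints_sub v (tau \o rho)) (mx' m); exact: homo_ge.
(* The values at the midpoints have two limits: [F g'] by strong convergence and the bound on [F],
   and [l'] because midpoints of a convergent sequence share its limit. *)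
have cF' : (fun m => F (x' m)) @ \oo --> F g'.
  apply/cvgrPdist_le => d d0.
  have [|N HN] := xg' (d ^+ 2 / (`|C| + 1)).
    by rewrite divr_gt0 ?exprn_gt0// ltr_wpDl.
  exists N => // m /= /HN h; rewrite distrC.
  have := FC _ (H_sub (Hx' m) Hg').
  rewrite {1}subr_scale Flin// mulN1r addrC => h2.
  rewrite -ler_sqr ?nnegrE ?(ltW d0)// real_normK ?num_real//.
  apply: le_trans h2 _.
  move: h; rewrite ler_pdivlMr; last by rewrite ltr_wpDl.
  apply: le_trans; rewrite mulrC ler_wpM2l ?B_ge0//; first exact: H_sub.
  by rewrite (le_trans (ler_norm C))// lerDl.
have cF : (fun m => F (x' m)) @ \oo --> l'.
  apply: (@midpoints_cvg w x' F) => //; last exact: H_half_lin.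
  by move=> k; exact: Hv.
have ll : l' = F g by rewrite Fgg; apply: cvg_unique cF cF'; exact: Rhausdorff.
move/cvgrPdist_lt : r_cvg => /(_ _ e0)[N _ /(_ N (leqnn N))] /=.
by rewrite ll ltNge (t_far (rho N)).
Qed.

End Hilbert.

(** * Square-integrable functions on an interval *)

Section IntervalIntegral.
Context {R : realType}.
Local Notation mu := (@lebesgue_measure R).
Implicit Types (L a b c x : R) (f g h : R -> R).

Definition int1 L f := mu.-integrable `[0, L] (EFin \o f).

Definition sqint L f :=
  measurable_fun `[0, L] f /\ int1 L (fun x => f x ^+ 2).

Definition aeq L f g := {ae mu, forall x, `[0, L]%classic x -> f x = g x}.

(** For negative [x] the interval is empty and the value is 0, so the primitive of a function that
    vanishes left of some [a > 0] vanishes there too and can serve as a test function on the whole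
    line. *)
Definition prim f x : R := \int[mu]_(t in `[0, x]) f t.

Lemma int1_meas L f : int1 L f -> measurable_fun `[0, L] f.
Proof. by move=> /integrableP[/measurable_EFinP]. Qed.

Lemma int1_le L f g : measurable_fun `[0, L] f -> int1 L g ->
  (forall x, `[0, L]%classic x -> `|f x| <= g x) -> int1 L f.
Proof.
move=> mf ig fg; apply: le_integrable ig => //; first exact/measurable_EFinP.
by move=> x Dx /=; rewrite lee_fin (le_trans (fg x Dx))// ler_norm.
Qed.

Lemma int1_cst L c : int1 L (fun=> c).
Proof.
apply: measurable_bounded_integrable => //.
  by rewrite /= lebesgue_measure_itv /=; case: ifP => // _; rewrite ltry.
by exists `|c|; split; [exact: num_real|move=> x cx y _; exact: ltW].
Qed.

Lemma int1D L f g : int1 L f -> int1 L g -> int1 L (fun x => f x + g x).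
Proof. by move=> fi gi; apply: (integrableD _ fi gi). Qed.

Lemma int1B L f g : int1 L f -> int1 L g -> int1 L (fun x => f x - g x).
Proof. by move=> fi gi; apply: (integrableB _ fi gi). Qed.

Lemma int1Z L c f : int1 L f -> int1 L (fun x => c * f x).
Proof. by move=> fi; apply: (integrableZl _ c fi). Qed.

Lemma int1_norm L f : int1 L f -> int1 L (fun x => `|f x|).
Proof. exact: integrable_norm. Qed.

Lemma int1_sum L n (f : 'I_n -> R -> R) :
  (forall i, int1 L (f i)) -> int1 L (fun x => \sum_i f i x).
Proof.
move=> fi; rewrite /int1 (_ : _ \o _ = fun x => (\sum_i (f i x)%:E)%E).
  by apply: integrable_sum => // i _; exact: fi.
by apply/funext => x /=; rewrite sumEFin.
Qed.

Lemma int1_sub L a f : a <= L -> int1 L f -> int1 a f.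
Proof.
move=> aL; apply: integrableS => // x /=; rewrite !in_itv /= => /andP[-> xa].
exact: le_trans aL.
Qed.

Lemma eq_int1 L f g : (forall x, `[0, L]%classic x -> f x = g x) ->
  int1 L f -> int1 L g.
Proof.
by move=> fg; apply: eq_integrable => // x; rewrite inE => Dx /=; rewrite fg.
Qed.

Lemma cts_int1 L f : {within `[0, L], continuous f} -> int1 L f.
Proof. by move=> cf; apply: continuous_compact_integrable => //; exact: segment_compact. Qed.

Lemma cts_meas L f : {within `[0, L], continuous f} -> measurable_fun `[0, L] f.
Proof. by move=> /cts_int1/int1_meas. Qed.

Lemma cts_bounded L f : {within `[0, L], continuous f} ->
  exists M, forall x, 0 <= x <= L -> `|f x| <= M.
Proof.
move=> cf; have [M [_ H]] := compact_bounded
  (continuous_compact cf (@segment_compact _ 0 L)).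
exists (M + 1) => x x0L; apply: (H (M + 1)); first by rewrite ltrDl.
by exists x => //=; rewrite in_itv.
Qed.

Lemma int1_mul_bounded L M f g : measurable_fun `[0, L] f ->
  (forall x, `[0, L]%classic x -> `|f x| <= M) -> int1 L g ->
  int1 L (fun x => f x * g x).
Proof.
move=> mf fM ig; apply: (@int1_le _ _ (fun x => M * `|g x|)).
- by apply: measurable_funM => //; exact: int1_meas.
- by apply: int1Z; exact: int1_norm.
- by move=> x Dx; rewrite normrM ler_wpM2r// fM.
Qed.

Lemma sqint_int1M L f g : sqint L f -> sqint L g -> int1 L (fun x => f x * g x).
Proof.
move=> [mf f2] [mg g2].
apply: (@int1_le _ _ (fun x => f x ^+ 2 + g x ^+ 2)).
- exact: measurable_funM.
- exact: int1D.
- by move=> x _; rewrite ler_norml; apply/andP; split; nra.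
Qed.

Lemma sqint_cst L c : sqint L (fun=> c).
Proof. by split; [exact: measurable_cst|exact: int1_cst]. Qed.

Lemma sqint_int1 L f : sqint L f -> int1 L f.
Proof.
move=> /(sqint_int1M (sqint_cst L 1)).
by apply: eq_int1 => x _; rewrite mul1r.
Qed.

Lemma sqintD L f g : sqint L f -> sqint L g -> sqint L (fun x => f x + g x).
Proof.
move=> sf sg; split; first by apply: measurable_funD; [case: sf|case: sg].
have := int1D (int1D sf.2 sg.2) (int1Z 2 (sqint_int1M sf sg)).
by apply: eq_int1 => x _; ring.
Qed.

Lemma sqintZ L c f : sqint L f -> sqint L (fun x => c * f x).
Proof.
move=> sf; split; first by apply: measurable_funM => //; case: sf.
by have := int1Z (c ^+ 2) sf.2; apply: eq_int1 => x _; ring.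
Qed.

Lemma eq_sqint L f g : (forall x, `[0, L]%classic x -> f x = g x) ->
  sqint L f -> sqint L g.
Proof.
move=> fg [mf f2]; split.
  by apply: eq_measurable_fun mf => x; rewrite inE => /fg.
by apply: eq_int1 f2 => x /fg ->.
Qed.

Lemma sqintB L f g : sqint L f -> sqint L g -> sqint L (fun x => f x - g x).
Proof.
move=> sf sg; have := sqintD sf (sqintZ (-1) sg).
by apply: eq_sqint => x _; rewrite mulN1r.
Qed.

Lemma sqint_bounded L M f : measurable_fun `[0, L] f ->
  (forall x, `[0, L]%classic x -> `|f x| <= M) -> sqint L f.
Proof.
move=> mf fM; split => //; apply: (@int1_le _ _ (fun=> M ^+ 2)).
- exact: measurable_funX.
- exact: int1_cst.
- move=> x Dx; rewrite normrX lerXn2r ?nnegrE ?fM//.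
  by rewrite (le_trans _ (fM x Dx)).
Qed.

Lemma cts_sqint L f : {within `[0, L], continuous f} -> sqint L f.
Proof.
move=> cf; have [M HM] := cts_bounded cf.
by apply: (@sqint_bounded _ M) => //; exact: cts_meas.
Qed.

Lemma prim_ge0 f x : (forall t, 0 <= t <= x -> 0 <= f t) -> 0 <= prim f x.
Proof. by move=> f0; apply: Rintegral_ge0 => t /=; rewrite in_itv; exact: f0. Qed.

Lemma eq_prim x f g : (forall t, 0 <= t <= x -> f t = g t) -> prim f x = prim g x.
Proof.
by move=> fg; apply: eq_Rintegral => t; rewrite inE /= in_itv; exact: fg.
Qed.

Lemma ae_prim x f g : int1 x f -> int1 x g -> aeq x f g -> prim f x = prim g x.
Proof.
move=> fi gi fg; congr fine; apply: ae_eq_integral => //.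
- exact: measurable_int fi.
- exact: measurable_int gi.
- apply: filterS fg; first exact: (ae_filter_ringOfSetsType mu).
  by move=> y h Dy /=; rewrite h.
Qed.

Lemma primD x f g : int1 x f -> int1 x g ->
  prim (fun t => f t + g t) x = prim f x + prim g x.
Proof. by move=> *; exact: RintegralD. Qed.

Lemma primB x f g : int1 x f -> int1 x g ->
  prim (fun t => f t - g t) x = prim f x - prim g x.
Proof. by move=> *; exact: RintegralB. Qed.

Lemma primZ x c f : int1 x f -> prim (fun t => c * f t) x = c * prim f x.
Proof. by move=> *; exact: RintegralZl. Qed.

Lemma prim_sum x n (f : 'I_n -> R -> R) : (forall i, int1 x (f i)) ->
  prim (fun t => \sum_i f i t) x = \sum_i prim (f i) x.
Proof.
elim: n f => [|n IH] f fi.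
  under eq_prim => t _ do rewrite big_ord0.
  by rewrite big_ord0 /prim Rintegral_cst ?mul0r.
under eq_prim => t _ do rewrite big_ord_recl.
rewrite primD// ?IH ?big_ord_recl//; exact: int1_sum.
Qed.

Lemma le_prim x f g : int1 x f -> int1 x g ->
  (forall t, 0 <= t <= x -> f t <= g t) -> prim f x <= prim g x.
Proof.
move=> fi gi fg; apply: le_Rintegral => // t /=; rewrite in_itv /=; exact: fg.
Qed.

Lemma prim_cst x c : 0 <= x -> prim (fun=> c) x = c * x.
Proof.
move=> x0; rewrite /prim Rintegral_cst//= lebesgue_measure_itv /= lte_fin.
by move: x0; rewrite le_eqVlt => /predU1P[<-|->]; rewrite ?ltxx/= ?subr0.
Qed.

Lemma prim0 f : prim f 0 = 0.
Proof. by rewrite /prim set_itv1 Rintegral_set1. Qed.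

Lemma prim_sub L f a b : int1 L f -> 0 <= a -> a <= b -> b <= L ->
  prim f b - prim f a = \int[mu]_(x in `]a, b]) f x.
Proof.
move=> fi a0 ab bL; rewrite /prim Rintegral_itvB ?bnd_simp//.
exact: (int1_sub bL fi).
Qed.

Lemma prim_cts L f : int1 L f -> {within `[0, L], continuous (prim f)}.
Proof.
have [L0|L0] := leP 0 L; first exact: parameterized_integral_continuous.
move=> _; rewrite set_itv_ge -?ltNge ?bnd_simp -?ltNge//.
exact: continuous_subspace0.
Qed.

Lemma cauchy_schwarz_prim x f g : sqint x f -> sqint x g ->
  prim (fun t => f t * g t) x ^+ 2 <=
  prim (fun t => f t ^+ 2) x * prim (fun t => g t ^+ 2) x.
Proof.
move=> sf sg; apply: discriminant_le => t.
have fg := sqint_int1M sf sg; have [_ f2] := sf; have [_ g2] := sg.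
rewrite (_ : _ + _ = prim (fun y => (f y * t + g y) ^+ 2) x).
  by apply: prim_ge0 => y _; exact: sqr_ge0.
rewrite (@eq_prim _ (fun y => (f y * t + g y) ^+ 2) (fun y => t ^+ 2 * f y ^+ 2 + (2 * t) * (f y * g y) + g y ^+ 2)).
  have i1 := int1Z (t ^+ 2) f2; have i2 := int1Z (2 * t) fg.
  rewrite (primD (int1D i1 i2) g2) (primD i1 i2) (primZ _ f2) (primZ _ fg).
  by ring.
by move=> y _; ring.
Qed.

Lemma dct L (f_ : nat -> R -> R) f g :
  (forall k, measurable_fun `[0, L] (f_ k)) ->
  (forall x, 0 <= x <= L -> f_ ^~ x @ \oo --> f x) ->
  int1 L g -> (forall k x, 0 <= x <= L -> `|f_ k x| <= g x) ->
  int1 L f /\ (fun k => prim (f_ k) L) @ \oo --> prim f L.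
Proof.
move=> mf_ ff gi fg.
have mf : measurable_fun `[0, L] f.
  by apply: (@measurable_fun_cvg _ _ _ _ f_) => // x /=; rewrite in_itv; exact: ff.
have [||||||i1 _ i3] := @dominated_convergence _ _ _ mu `[0, L] _
    (fun k => EFin \o f_ k) (EFin \o f) (EFin \o g).
- by [].
- by move=> k; apply/measurable_EFinP; exact: mf_.
- exact/measurable_EFinP.
- apply/aeW => x /=; rewrite in_itv /= => Dx.
  by apply: cvg_EFin; [exact: nearW|exact: ff].
- exact: gi.
- by apply/aeW => x k /=; rewrite in_itv /= lee_fin; exact: fg.
split => //; move: i3; rewrite /prim => i3.
have fin : (\int[mu]_(x in `[0%R, L]) (f x)%:E)%E \is a fin_num.
  exact: integrable_fin_num.
by apply: fine_cvg; rewrite fineK.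
Qed.

(** Fatou's lemma also yields the integrability of the limit, which is how the limit in
    [riesz_fischer] is seen to be square integrable. *)
Lemma fatou_prim L (f_ : nat -> R -> R) f c :
  (forall k, int1 L (f_ k)) -> (forall k x, 0 <= x <= L -> 0 <= f_ k x) ->
  (forall x, 0 <= x <= L -> f_ ^~ x @ \oo --> f x) ->
  (forall k, prim (f_ k) L <= c) -> int1 L f /\ prim f L <= c.
Proof.
move=> fi f0 ff fc.
have mf : measurable_fun `[0, L] f.
  apply: (@measurable_fun_cvg _ _ _ _ f_) => [m|x /=]; first exact: int1_meas.
  by rewrite in_itv; exact: ff.
have f_ge0 x : 0 <= x <= L -> 0 <= f x.
  move=> Dx; have h := ff x Dx; rewrite -(cvg_lim _ h)//.
  by apply: limr_ge; [exact: cvgP h|apply: nearW => k; exact: f0].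
have le_c : (\int[mu]_(x in `[0%R, L]) (f x)%:E <= c%:E)%E.
  rewrite (@eq_integral _ _ _ mu _ (fun x => limn_einf (fun k => (f_ k x)%:E))).
    apply: (le_trans (@fatou _ _ _ mu `[0%R, L] _ (fun k => EFin \o f_ k) _ _)) => //.
    - by move=> k; exact: measurable_int (fi k).
    - rewrite limn_einf_lim; apply: lime_le; first exact: is_cvg_einfs.
      apply: nearW => k; apply: (@le_trans _ _ (\int[mu]_(x in `[0%R, L]) (f_ k x)%:E)%E).
        by apply: ereal_inf_lbound; exists k => /=.
      rewrite -[leLHS]fineK ?lee_fin; first exact: fc.
      exact: (integrable_fin_num _ (fi k)).
  move=> x; rewrite inE /= in_itv /= => Dx.
  have h : (EFin \o f_ ^~ x) @ \oo --> (f x)%:E.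
    by apply: cvg_EFin; [exact: nearW|exact: ff].
  by rewrite (is_cvg_limn_einfE (cvgP _ h)); apply/esym/cvg_lim.
have fint : int1 L f.
  apply/integrableP; split; first exact/measurable_EFinP.
  rewrite (le_lt_trans _ (ltry c))// (le_trans _ le_c)//.
  rewrite (@eq_integral _ _ _ mu _ (EFin \o f))// => x; rewrite inE /= in_itv /= => Dx.
  by rewrite ger0_norm// f_ge0.
split => //; rewrite /prim -lee_fin fineK//; exact: integrable_fin_num.
Qed.

End IntervalIntegral.

(** * Absolute continuity of primitives, integration by parts and Lebesgue differentiation *)

Section SobolevLine.
Context {R : realType}.
Local Notation mu := (@lebesgue_measure R).
Implicit Types (L a b c x e : R) (f g h : R -> R).

Lemma int1_unif L f e : int1 L f -> 0 < e -> exists d : R, 0 < d /\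
  forall a b, 0 <= a -> a <= b -> b <= L -> b - a < d ->
    prim (fun t => `|f t|) b - prim (fun t => `|f t|) a < e.
Proof.
move=> fi e0; have : mu.-integrable setT (EFin \o f \_ `[0, L]).
  by rewrite -restrict_EFin; apply/integrable_restrict => //=; rewrite setTI.
move=> /integral_normr_continuous /(_ _ e0)[d [d0 H]].
exists d; split => // a b a0 ab bL bad.
rewrite (prim_sub (int1_norm fi))//.
have : \int[mu]_(x in `]a, b]) `|(f \_ `[0, L]) x| < e.
  apply: H => //; rewrite /= lebesgue_measure_itv /= lte_fin.
  by case: ifP => // _; rewrite lte_fin.
congr (_ < _); apply: eq_Rintegral => x.
rewrite inE /= in_itv /= => /andP[ax xb]; rewrite patchE ifT// inE /= in_itv /=.
by rewrite (le_trans a0 (ltW ax)) (le_trans xb).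
Qed.

Lemma prim_mono L f a b : int1 L f -> (forall x, 0 <= x <= L -> 0 <= f x) ->
  0 <= a -> a <= b -> b <= L -> prim f a <= prim f b.
Proof.
move=> fi f0 a0 ab bL; rewrite -subr_ge0 (prim_sub fi)//.
apply: Rintegral_ge0 => x /=; rewrite in_itv /= => /andP[ax xb].
by apply: f0; rewrite (le_trans a0 (ltW ax)) (le_trans xb).
Qed.

Lemma norm_prim_sub_le L f a b : int1 L f -> 0 <= a -> a <= b -> b <= L ->
  `|prim f b - prim f a| <= prim (fun t => `|f t|) b - prim (fun t => `|f t|) a.
Proof.
move=> fi a0 ab bL; rewrite !(prim_sub (L := L))//; last exact: int1_norm.
apply: le_normr_Rintegral => //; apply: integrableS fi => //.
move=> x /=; rewrite !in_itv /= => /andP[ax xb].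
by rewrite (le_trans a0 (ltW ax)) (le_trans xb).
Qed.

Lemma int1M_prim L f g : int1 L f -> int1 L g -> int1 L (fun x => f x * prim g x).
Proof.
move=> fi gi; have cg := prim_cts gi; have [M HM] := cts_bounded cg.
have := @int1_mul_bounded _ L M (prim g) f (cts_meas cg).
move=> /(_ _ fi) h; apply: eq_int1 (h _).
  by move=> x _; rewrite mulrC.
by move=> x /=; rewrite in_itv; exact: HM.
Qed.

Lemma le_prim_sub L f g a b : int1 L f -> int1 L g ->
  0 <= a -> a <= b -> b <= L ->
  (forall t, a <= t <= b -> f t <= g t) ->
  prim f b - prim f a <= prim g b - prim g a.
Proof.
move=> fi gi a0 ab bL fg; rewrite (prim_sub fi)// (prim_sub gi)//.
have s : `]a, b] `<=` `[0, L].
  move=> x /=; rewrite !in_itv /= => /andP[ax xb].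
  by rewrite (le_trans a0 (ltW ax)) (le_trans xb).
apply: le_Rintegral => //; [exact: integrableS fi|exact: integrableS gi|].
by move=> x /=; rewrite in_itv /= => /andP[ax xb]; apply: fg; rewrite (ltW ax).
Qed.

(* [F^2 - 2 \int f F] has increments quadratic in those of [\int |f|]. *)
Lemma prim_sqr L f : 0 <= L -> int1 L f ->
  2 * prim (fun x => f x * prim f x) L = prim f L ^+ 2.
Proof.
move=> L0 fi; pose A := prim (fun t => `|f t|).
pose E x := prim f x ^+ 2 - 2 * prim (fun x => f x * prim f x) x.
have fFi := int1M_prim fi fi.
(* With [F = prim f], [F b ^ 2 - F a ^ 2 - 2 F a (F b - F a)] is the square of [F b - F a], and
   replacing [F] by [F a] under the integral costs at most [(A b - A a) ^ 2], counted twice. *)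
have E_inc a b : 0 <= a -> a <= b -> b <= L ->
    `|E b - E a| <= 4 * (A b - A a) ^+ 2.
  move=> a0 ab bL; pose Fa := prim f a.
  have osc t : a <= t <= b -> `|prim f t - Fa| <= A b - A a.
    move=> /andP[at_ tb]; apply: (le_trans (norm_prim_sub_le fi a0 at_ _)).
      exact: le_trans tb bL.
    rewrite lerB// (prim_mono (int1_norm fi))// (le_trans a0 at_)//.
  have nfi := int1_norm fi.
  have i1 := int1B fFi (int1Z Fa fi).
  have i2 := int1Z (A b - A a) nfi.
  have up : prim (fun x => f x * prim f x) b - prim (fun x => f x * prim f x) a
            - Fa * (prim f b - prim f a) <= (A b - A a) ^+ 2.
    have := le_prim_sub i1 i2 a0 ab bL.
    rewrite !(primB (int1_sub _ fFi) (int1_sub _ (int1Z Fa fi))) ?(le_trans ab)//.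
    rewrite !(primZ _ (int1_sub _ fi)) ?(le_trans ab)//.
    rewrite !(primZ _ (int1_sub _ nfi)) ?(le_trans ab)// -/A.
    move=> h; have : forall t, a <= t <= b ->
        f t * prim f t - Fa * f t <= (A b - A a) * `|f t|.
      move=> t /osc o; rewrite (_ : f t * prim f t - Fa * f t = (prim f t - Fa) * f t); last by ring.
      by rewrite (le_trans (ler_norm _))// normrM ler_wpM2r.
    by move=> /h; rewrite /Fa; lra.
  have lo : - (A b - A a) ^+ 2 <=
      prim (fun x => f x * prim f x) b - prim (fun x => f x * prim f x) a
            - Fa * (prim f b - prim f a).
    have i3 := int1Z (- (A b - A a)) nfi.
    have := le_prim_sub i3 i1 a0 ab bL.
    rewrite !(primB (int1_sub _ fFi) (int1_sub _ (int1Z Fa fi))) ?(le_trans ab)//.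
    rewrite !(primZ _ (int1_sub _ fi)) ?(le_trans ab)//.
    rewrite !(primZ _ (int1_sub _ nfi)) ?(le_trans ab)// -/A.
    move=> h; have : forall t, a <= t <= b ->
        - (A b - A a) * `|f t| <= f t * prim f t - Fa * f t.
      move=> t /osc o; rewrite (_ : f t * prim f t - Fa * f t = (prim f t - Fa) * f t); last by ring.
      by rewrite mulNr lerNl (le_trans (ler_norm _))// normrN normrM ler_wpM2r.
    by move=> /h; rewrite /Fa; lra.
  have fb : `|prim f b - Fa| <= A b - A a by apply: osc; rewrite ab lexx.
  have sq : (prim f b - Fa) ^+ 2 <= (A b - A a) ^+ 2.
    by rewrite -real_normK ?num_real// lerXn2r ?nnegrE// (le_trans _ fb).
  have sq0 := sqr_ge0 (prim f b - Fa).
  move: up lo sq sq0; rewrite /E -/Fa ler_norml.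
  clear osc fb i1; move: (prim f b) Fa (A b - A a) (prim _ b) (prim _ a) => p q w X Y *.
  by apply/andP; split; nra.
have A0 : A 0 = 0 by exact: prim0.
have AL : 0 <= A L by apply: prim_ge0.
suff : E L = E 0.
  rewrite /E !prim0 expr0n /= mulr0 subrr => /eqP.
  by rewrite subr_eq0 => /eqP ->.
apply/eqP; rewrite -subr_eq0 -normr_eq0 eq_le normr_ge0 andbT.
apply/ler_addgt0Pl => e e0; rewrite addr0.
(* On pieces where [A] grows by less than [e'], the squares of the increments of [A] are at most
   [e'] times the increments, so the errors telescope to [4 e' A L <= e]. The added 1 keeps the
   divisor positive. *)
pose e' := e / (4 * (A L + 1)).
have e'0 : 0 < e' by rewrite divr_gt0// mulr_gt0// ltr_wpDl.
have [d [d0 Hd]] := int1_unif fi e'0.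
pose n := (Num.bound (L / d)).+1.
have nd : L / n%:R < d.
  rewrite ltr_pdivrMr ?ltr0n// mulrC -ltr_pdivrMr//.
  apply: lt_trans (archi_boundP _) _; first by rewrite divr_ge0 ?(ltW d0).
  by rewrite ltr_nat.
pose z k : R := L * k%:R / n%:R.
have zn : z n = L by rewrite /z mulfK// pnatr_eq0.
have z0 : z 0%N = 0 by rewrite /z mulr0 mul0r.
have zS k : z k.+1 - z k = L / n%:R by rewrite /z -natr1; ring.
have zge k : 0 <= z k by rewrite /z divr_ge0// mulr_ge0.
have zle k : z k <= z k.+1 by rewrite -subr_ge0 zS divr_ge0.
have zL k : (k <= n)%N -> z k <= L.
  by move=> kn; rewrite /z -mulrA ler_piMr// ler_pdivrMr ?ltr0n// mul1r ler_nat.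
have ind k : (k <= n)%N -> `|E (z k) - E 0| <= 4 * e' * A (z k).
  elim: k => [|k IH] kn; first by rewrite z0 subrr normr0 A0 mulr0.
  rewrite -(subrK (E (z k)) (E (z k.+1))) -addrA (le_trans (ler_normD _ _))//.
  have h1 := E_inc _ _ (zge k) (zle k) (zL _ kn).
  have h2 := IH (ltnW kn).
  have h3 : A (z k.+1) - A (z k) < e'.
    by apply: Hd; rewrite ?zge ?zle ?zL// zS.
  have h4 : 0 <= A (z k.+1) - A (z k).
    by rewrite subr_ge0 (prim_mono (int1_norm fi))// zL.
  by nra.
have := ind n (leqnn n); rewrite zn => /le_trans; apply.
have -> : 4 * e' * A L = e * (A L / (A L + 1)).
  rewrite /e'; move: (A L) AL => w w0; field.
  by rewrite gt_eqF// ltr_wpDl.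
by rewrite ler_piMr ?(ltW e0)// ler_pdivrMr ?ltr_wpDl// mul1r lerDl.
Qed.

(** Polarization of [prim_sqr], applied to [f], [g] and [f + g]. *)
Lemma integration_by_parts_prim L f g : 0 <= L -> int1 L f -> int1 L g ->
  prim (fun x => f x * prim g x) L =
  prim f L * prim g L - prim (fun x => g x * prim f x) L.
Proof.
move=> L0 fi gi; have := prim_sqr L0 (int1D fi gi).
have := prim_sqr L0 fi; have := prim_sqr L0 gi.
have ff := int1M_prim fi fi; have fg := int1M_prim fi gi.
have gf := int1M_prim gi fi; have gg := int1M_prim gi gi.
rewrite (@eq_prim _ _ (fun x => (f x + g x) * prim (fun t => f t + g t) x)
  (fun x => (f x * prim f x + f x * prim g x) + (g x * prim f x + g x * prim g x))).
  rewrite (primD (int1D ff fg) (int1D gf gg)) (primD ff fg) (primD gf gg) primD//.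
  by lra.
move=> t /andP[_ tL]; rewrite (primD (int1_sub tL fi) (int1_sub tL gi)); ring.
Qed.

Lemma ae_neq a : {ae mu, forall x, x != a}.
Proof.
exists [set a]; split => //; first exact: lebesgue_measure_set1.
by move=> x /= /negP; rewrite negbK => /eqP.
Qed.

(** Lebesgue differentiation: almost everywhere the extension of [g] by 0 is the derivative of its
    primitive, which vanishes near every interior point. The two endpoints are discarded as a null
    set. *)
Lemma prim_eq0_ae L g : int1 L g -> (forall x, 0 <= x <= L -> prim g x = 0) ->
  aeq L g (fun=> 0).
Proof.
move=> gi g0; pose g' := g \_ `[0, L].
have g'i : mu.-integrable setT (EFin \o g').
  by rewrite -restrict_EFin; apply/integrable_restrict => //=; rewrite setTI.
have locg : locally_integrable [set: R] g'.
  by apply: open_integrable_locally => //; exact: openT.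
have g'i_le (y : R) : mu.-integrable `]-oo, y] (EFin \o g').
  by apply: integrableS g'i.
have ae := FTC1Ny g'i_le locg.
apply: (@filterS3 _ _ (ae_filter_ringOfSetsType mu) _ _ _ _ _ ae (ae_neq 0) (ae_neq L)).
move=> x [_ H] x0 xL; rewrite /= in_itv /= => /andP[x0' xL'].
have {}x0 : 0 < x by rewrite lt_neqAle eq_sym x0.
have {}xL : x < L by rewrite lt_neqAle xL.
move: H; rewrite derive1E (@near_eq_derive _ _ _ _ (fun=> 0)) ?derive_cst.
  by rewrite /g' patchE ifT ?inE /= ?in_itv /= ?x0' ?xL'.
near=> y; have y01 : 0 <= y <= L.
  by apply/andP; split; apply: ltW; near: y; [exact: lt_nbhsr|exact: lt_nbhsl].
rewrite -[RHS](g0 y y01) /g' -Rintegral_mkcondr /prim.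
congr (Rintegral _ _ _); apply/seteqP; split => t /=; rewrite !in_itv /=.
  by move=> [-> /andP[-> _]].
by move=> /andP[-> ty]; rewrite ty (le_trans ty)//; case/andP: y01.
Unshelve. all: by end_near. Qed.

End SobolevLine.

(** * Completeness of L^2 *)

Section RieszFischer.
Context {R : realType}.
Local Notation mu := (@lebesgue_measure R).
Implicit Types (L a b c x e : R) (f g h : R -> R).

Lemma ae_imp (P Q : R -> Prop) : (forall x, P x -> Q x) ->
  {ae mu, forall x, P x} -> {ae mu, forall x, Q x}.
Proof. exact: (@filterS _ _ (ae_filter_ringOfSetsType mu)). Qed.

Lemma ae_imp2 (P Q T : R -> Prop) : (forall x, P x -> Q x -> T x) ->
  {ae mu, forall x, P x} -> {ae mu, forall x, Q x} -> {ae mu, forall x, T x}.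
Proof. exact: (@filterS2 _ _ (ae_filter_ringOfSetsType mu)). Qed.

Lemma ae_int1 L f g : int1 L f -> measurable_fun `[0, L] g -> aeq L f g ->
  int1 L g.
Proof.
move=> /integrableP[mf fi] mg fg; apply/integrableP.
have {}mg : measurable_fun `[0, L] (EFin \o g) by exact/measurable_EFinP.
split => //; rewrite (@ae_eq_integral _ _ _ mu `[0, L]
  (fun t => `|(EFin \o f) t|)%E) //.
- exact: measurableT_comp.
- exact: measurableT_comp.
- apply: ae_imp fg.
  by move=> t h Dt /=; rewrite h.
Qed.

(** The sum of the [|x_ k|] has integral at most [C] by monotone convergence, so it is finite almost
    everywhere, and there the series converges absolutely. *)
Lemma summable_ae_cvg L (x_ : nat -> R -> R) C :
  (forall k, int1 L (x_ k)) ->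
  (forall n, \sum_(k < n) prim (fun t => `|x_ k t|) L <= C) ->
  {ae mu, forall t, `[0, L]%classic t -> cvgn (series (x_ ^~ t))}.
Proof.
move=> xi xC; pose d k (t : R) := (`|x_ k t|)%:E.
have md k : measurable_fun `[0, L] (d k) by exact: measurable_int (int1_norm (xi k)).
have d0 k (t : R) : `[0, L]%classic t -> (0 <= d k t)%E by rewrite lee_fin.
pose S (t : R) := (\sum_(0 <= k <oo) d k t)%E.
have mS : measurable_fun `[0, L] S.
  by apply: ge0_emeasurable_sum => [k t Dt _|k _]; [exact: d0|exact: md].
have S0 t : (0 <= S t)%E by apply: nneseries_ge0 => k _ _; rewrite lee_fin.
have intS : (\int[mu]_(t in `[0%R, L]) S t <= C%:E)%E.
  rewrite integral_nneseries//; apply: lime_le.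
    by apply: is_cvg_nneseries => k _ _; apply: integral_ge0 => t Dt; exact: d0.
  apply: nearW => n; rewrite big_mkord (le_trans _ (_ : (\sum_(k < n) prim (fun t => `|x_ k t|) L)%:E <= _)%E) ?lee_fin//.
  rewrite -sumEFin; apply: lee_sum => k _.
  by rewrite /prim fineK//; exact: (integrable_fin_num _ (int1_norm (xi k))).
have Si : mu.-integrable `[0, L] S.
  apply/integrableP; split => //.
  under eq_integral do rewrite gee0_abs//.
  exact: le_lt_trans intS (ltry _).
have [//|N [mN N0 HN]] := @integrable_ae _ _ _ mu `[0, L] _ _ Si.
exists N; split => //; apply: subset_trans HN; apply: subsetC.
move=> t fin Dt; have {fin} := fin Dt.
rewrite ge0_fin_numE// => Sfin; apply: normed_cvg.
apply: nondecreasing_is_cvgn.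
  apply/nondecreasing_seqP => n /=.
  by rewrite seriesEnat /= big_nat_recr//= lerDl.
exists (fine (S t)) => _ [n _ <-]; rewrite -lee_fin fineK ?ge0_fin_numE//.
rewrite /= seriesEnat /= -sumEFin; apply: nneseries_lim_ge => k _ _; exact: d0.
Qed.

(** A subsequence whose increments have L^2 norm at most [2^-k] converges almost everywhere, and
    Fatou's lemma carries the Cauchy estimate over to the limit. *)
Lemma riesz_fischer L (x_ : nat -> R -> R) : 0 <= L ->
  (forall k, sqint L (x_ k)) ->
  (forall e : R, 0 < e -> exists N, forall m n, (N <= m)%N -> (N <= n)%N ->
     prim (fun t => (x_ m t - x_ n t) ^+ 2) L <= e) ->
  exists y, sqint L y /\
    forall e : R, 0 < e -> exists N, forall m, (N <= m)%N ->
      prim (fun t => (x_ m t - y t) ^+ 2) L <= e.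
Proof.
move=> L0 xs xcau.
have [|tau [tau_mono tau_small]] := @extraction (fun k m =>
    forall n, (m <= n)%N -> prim (fun t => (x_ m t - x_ n t) ^+ 2) L <= 4^-1 ^+ k).
  move=> k n; have [|N HN] := xcau (4^-1 ^+ k); first by rewrite exprn_gt0// invr_gt0.
  exists (maxn n N); split; first exact: leq_maxl.
  by move=> p; rewrite geq_max => /andP[np Np]; apply: HN => //; exact: leq_maxr.
pose d k t := x_ (tau k.+1) t - x_ (tau k) t.
have ds k : sqint L (d k) by apply: sqintB.
have di k : int1 L (d k) by exact: sqint_int1.
have d2 k : prim (fun t => d k t ^+ 2) L <= 4^-1 ^+ k.
  have := tau_small k (tau k.+1) (ltnW (tau_mono k k.+1 (ltnSn k))).
  by congr (_ <= _); apply: eq_prim => t _; rewrite /d; ring.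
(* From L^2 to L^1 by the pointwise inequality [z <= p z^2 + p^-1] with [p = 2^k], which balances
   [2^k 4^-k] against [L 2^-k]. *)
have d1 k : prim (fun t => `|d k t|) L <= (1 + L) * 2^-1 ^+ k.
  pose p : R := 2 ^+ k; have p0 : 0 < p by rewrite exprn_gt0.
  apply: (@le_trans _ _ (prim (fun t => p * d k t ^+ 2 + p^-1) L)).
    apply: le_prim.
    - exact: int1_norm.
    - by apply: int1D; [apply: int1Z; case: (ds k)|exact: int1_cst].
    - move=> t _; have pp : p * p^-1 = 1 by rewrite divff// gt_eqF.
      have p'0 : 0 < p^-1 by rewrite invr_gt0.
      rewrite -(real_normK (num_real (d k t))).
      have := sqr_ge0 (p * `|d k t| - 1); have := normr_ge0 (d k t).
      move: (`|d k t|) (p^-1) pp p'0 => z q pp q0 z0 sq.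
      have : 0 <= q * (p * z - 1) ^+ 2 by rewrite mulr_ge0// ltW.
      have -> : q * (p * z - 1) ^+ 2 = (p * q) * (p * z ^+ 2) - 2 * (p * q) * z + q.
        by ring.
      by rewrite pp; lra.
  rewrite primD; [|by apply: int1Z; case: (ds k)|exact: int1_cst].
  rewrite primZ; last by case: (ds k).
  rewrite prim_cst// exprVn -/p mulrDl mul1r [L * _]mulrC lerD2r.
  apply: le_trans (ler_wpM2l (ltW p0) (d2 k)) _.
  rewrite exprVn (_ : 4 ^+ k = p * p); last by rewrite /p -exprMn -natrM.
  by rewrite invfM mulrA divff ?mul1r// gt_eqF.
have sumC n : \sum_(k < n) prim (fun t => `|d k t|) L <= (1 + L) * 2.
  apply: (@le_trans _ _ (\sum_(k < n) (1 + L) * 2^-1 ^+ k)).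
    by apply: ler_sum => k _; exact: d1.
  rewrite -mulr_sumr ler_wpM2l//; first by rewrite addr_ge0.
  suff -> : \sum_(k < n) 2^-1 ^+ k = 2 - 2 * 2^-1 ^+ n :> R.
    by rewrite gerBl mulr_ge0// exprn_ge0// invr_ge0.
  elim: n => [|n IH]; first by rewrite big_ord0 expr0 mulr1 subrr.
  by rewrite big_ord_recr /= IH exprS; field.
have [N [mN N0 HN]] := summable_ae_cvg di sumC.
(* The subsequence is set to 0 on the null set [N], so that it converges at every point, as
   measurability of the limit and [fatou_prim] require. *)
pose f k := x_ (tau k) \_ (~` N).
have fE k : aeq L (f k) (x_ (tau k)).
  exists N; split => // t /= /not_implyP[Dt]; apply: contra_notP => Nt.
  by rewrite /f patchE ifT// inE.
have mf k : measurable_fun `[0, L] (f k).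
  apply/measurable_restrict => //; first exact: measurableC.
  by apply: measurable_funS (xs (tau k)).1 => //; exact: subIsetl.
have fcvg t : 0 <= t <= L -> cvgn (f ^~ t).
  move=> Dt; have [tN|tN] := pselect (N t).
    rewrite (_ : f ^~ t = cst 0); first exact: is_cvg_cst.
    by apply/funext => k; rewrite /f patchE ifF//; apply/negP; rewrite inE.
  rewrite (_ : f ^~ t = (fun k => x_ (tau 0%N) t + series (d ^~ t) k)).
    apply: is_cvgD; first exact: is_cvg_cst.
    apply: contrapT => nc; apply: tN; apply: HN => /= h; apply: nc; apply: h.
    by rewrite in_itv.
  apply/funext => k; rewrite /f patchE ifT ?inE// seriesEnat /=.
  by rewrite telescope_sumr// subrKC.
pose y t := lim (f ^~ t @ \oo).
have fy t : 0 <= t <= L -> f ^~ t @ \oo --> y t by move=> /fcvg.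
have my : measurable_fun `[0, L] y.
  by apply: (@measurable_fun_cvg _ _ _ _ f) => // t /=; rewrite in_itv; exact: fy.
have fs k : sqint L (f k).
  split => //; apply: (@ae_int1 _ (fun t => x_ (tau k) t ^+ 2)).
  - by case: (xs (tau k)).
  - by apply: measurable_funX; exact: mf.
  - apply: ae_imp (fE k).
    by move=> t h Dt; rewrite h.
have main e : 0 < e -> exists N, forall m, (N <= m)%N ->
    int1 L (fun t => (x_ m t - y t) ^+ 2) /\
    prim (fun t => (x_ m t - y t) ^+ 2) L <= e.
  move=> e0; have [n Hn] := xcau e e0; exists n => m nm.
  have := @fatou_prim _ L (fun k t => (x_ m t - f (k + n)%N t) ^+ 2)
     (fun t => (x_ m t - y t) ^+ 2) e.
  apply.
  - by move=> k; case: (sqintB (xs m) (fs (k + n)%N)).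
  - by move=> k t _; exact: sqr_ge0.
  - move=> t Dt; have fyn : (fun k => f (k + n)%N t) @ \oo --> y t.
      by have := fy t Dt; rewrite -(cvg_shiftn n).
    have xc : (fun=> x_ m t) @ \oo --> x_ m t by exact: cvg_cst.
    under eq_fun do rewrite expr2.
    rewrite expr2; exact: cvgM (cvgB xc fyn) (cvgB xc fyn).
  - move=> k; rewrite (@ae_prim _ _ _ (fun t => (x_ m t - x_ (tau (k + n)%N) t) ^+ 2)).
    + apply: Hn => //; apply: leq_trans (homo_ge tau_mono _); exact: leq_addl.
    + by case: (sqintB (xs m) (fs (k + n)%N)).
    + by case: (sqintB (xs m) (xs (tau (k + n)%N))).
    + apply: ae_imp (fE (k + n)%N).
      by move=> t h Dt; rewrite h.
exists y; split; last by move=> e /main[n Hn]; exists n => m /Hn[].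
have [|n Hn] := main 1; first by [].
have [xyi _] := Hn n (leqnn n).
have : sqint L (fun t => x_ n t - (x_ n t - y t)).
  apply: sqintB => //; split => //; apply: measurable_funB => //; by case: (xs n).
by apply: eq_sqint => t _; rewrite subKr.
Qed.

End RieszFischer.

(** * Weak derivatives *)

Section WeakDerivative.
Context {R : realType}.
Local Notation mu := (@lebesgue_measure R).
Implicit Types (L a b c x e t : R) (f g h phi : R -> R).

Definition sweak L f g := forall phi, test_function L phi ->
  prim (fun x => f x * (derive1 phi) x) L = - prim (fun x => g x * phi x) L.

Lemma derivable_cts f x : derivable f x 1 -> {for x, continuous f}.
Proof. by move=> /derivable1_diffP/differentiable_continuous. Qed.

Lemma cts_within L f : continuous f -> {within `[0, L], continuous f}.
Proof. exact: continuous_subspaceT. Qed.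

Lemma ftc2_prim f x : 0 <= x -> (forall y, derivable f y 1) ->
  continuous ((derive1 f)) -> prim (derive1 f) x = f x - f 0.
Proof.
rewrite le_eqVlt => /predU1P[<- _ _|x0 df cf]; first by rewrite prim0 subrr.
rewrite /prim /Rintegral (@continuous_FTC2 _ _ f)//.
- exact: cts_within.
- split; first by move=> y _; exact: df.
  + by apply: cvg_at_right_filter; exact: derivable_cts.
  + by apply: cvg_at_left_filter; exact: derivable_cts.
Qed.

Lemma test_function_prim L phi x : test_function L phi -> 0 <= x ->
  phi x = prim (derive1 phi) x.
Proof.
move=> [dphi cphi [a [b [a0 bL supp]]]] x0; rewrite ftc2_prim//.
suff -> : phi 0 = 0 by rewrite subr0.
apply/eqP; apply: contraT => /supp /andP[a0' _].
by move: a0; rewrite ltNge a0'.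
Qed.

Lemma test_functionL L phi : test_function L phi -> phi L = 0.
Proof.
move=> [_ _ [a [b [a0 bL supp]]]]; apply/eqP; apply: contraT => /supp /andP[_ Lb].
by move: bL; rewrite ltNge Lb.
Qed.

(** A test function is the primitive of its own derivative, so integration by parts for primitives
    applies; the boundary term vanishes since [phi L = 0]. *)
Lemma sweak_prim L c g : 0 <= L -> int1 L g -> sweak L (fun x => c + prim g x) g.
Proof.
move=> L0 gi phi tphi; have [_ cphi _] := tphi.
have phi'i : int1 L (derive1 phi) by apply: cts_int1; exact: cts_within.
have PL : prim (derive1 phi) L = 0 by rewrite -(test_function_prim tphi) ?test_functionL.
rewrite (@eq_prim _ _ _ (fun x => c * (derive1 phi) x + (derive1 phi) x * prim g x)); last first.
  by move=> t _; ring.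
rewrite primD; [|exact: int1Z|exact: int1M_prim].
rewrite primZ// PL mulr0 add0r integration_by_parts_prim// PL mul0r sub0r.
congr (- _); apply: eq_prim => t /andP[t0 _].
by rewrite -(test_function_prim tphi).
Qed.

Lemma eq_sweak L f f' g g' : (forall x, 0 <= x <= L -> f x = f' x) ->
  (forall x, 0 <= x <= L -> g x = g' x) -> sweak L f g -> sweak L f' g'.
Proof.
move=> ff gg w phi /w; congr (_ = - _); apply: eq_prim => t Dt.
  by rewrite ff.
by rewrite gg.
Qed.

Lemma prim_restrict L x h : 0 <= x -> x <= L -> int1 L h ->
  prim (fun t => if 0 < t < x then h t else 0) L = prim h x.
Proof.
move=> x0 xL hi; have hix := int1_sub xL hi.
rewrite /prim (_ : (fun t => _) = h \_ `]0, x[); last first.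
  by apply/funext => t; rewrite patchE mem_setE in_itv.
rewrite -Rintegral_mkcondr (_ : _ `&` _ = `]0, x[%classic); last first.
  apply/seteqP; split => t /=; rewrite !in_itv /=; first by case.
  by move=> /andP[t0 tx]; rewrite t0 tx (ltW t0) (ltW (lt_le_trans tx xL)).
have i1 : mu.-integrable `]0, x] (EFin \o h).
  by apply: integrableS hix => //; exact: subset_itv_oc_cc.
rewrite Rintegral_itv_bndo_bndc; last first.
  by apply: integrableS i1 => //; exact: subset_itv_oo_oc.
by rewrite Rintegral_itv_obnd_cbnd.
Qed.

(** A trapezoid with sides of slope [s], supported in [[s^-1, x - s^-1]]. It tends to the indicator
    of []0, x[] as [s] grows, and its distance from the endpoints lets balanced combinations have
    test functions as primitives. *)
Definition hat s x t : R :=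
  Num.min 1 (s * Num.max 0 (Num.min (t - s^-1) (x - s^-1 - t))).

Lemma hat_cts s x : continuous (hat s x).
Proof.
have c1 : continuous (fun t : R => t - s^-1 : R^o).
  by move=> t; apply: cvgB; [exact: cvg_id|exact: cvg_cst].
have c2 : continuous (fun t : R => x - s^-1 - t : R^o).
  by move=> t; apply: cvgB; [exact: cvg_cst|exact: cvg_id].
have c0 (k : R) : continuous ((fun=> k) : R -> R^o) by move=> t; exact: cvg_cst.
move=> t; have c3 := continuous_max (c0 0 t) (continuous_min (c1 t) (c2 t)).
have c4 : {for t, continuous (fun y : R => s *
    Num.max 0 (Num.min (y - s^-1) (x - s^-1 - y)) : R^o)}.
  by apply: cvgM; [exact: cvg_cst|exact: c3].
exact: (continuous_min (c0 1 t) c4).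
Qed.

Lemma hat_bound s x t : 0 <= s -> 0 <= hat s x t <= 1.
Proof.
move=> s0; rewrite /hat ge_min lexx /= andbT le_min ler01 /=.
by rewrite mulr_ge0// le_max lexx.
Qed.

Lemma hat_supp s x t : hat s x t != 0 -> s^-1 < t < x - s^-1.
Proof.
move=> h; rewrite -subr_gt0 -[t < _]subr_gt0 -lt_min ltNge.
apply/negP => m0; case/negP: h; apply/eqP.
by rewrite /hat max_l// mulr0 min_r.
Qed.

Lemma hat_eq1 s x t : 0 < t < x -> 2 / Num.min t (x - t) <= s -> hat s x t = 1.
Proof.
move=> /andP[t0 tx] hs; set m := Num.min t (x - t) in hs.
have m0 : 0 < m by rewrite lt_min t0 subr_gt0.
have s0 : 0 < s by apply: lt_le_trans hs; rewrite divr_gt0.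
rewrite /hat (_ : Num.min (t - s^-1) (x - s^-1 - t) = m - s^-1); last first.
  by rewrite /m addrAC -addr_minl.
rewrite min_l//; move: hs; rewrite ler_pdivrMr// => hs.
apply: le_trans (_ : s * (m - s^-1) <= _); last first.
  by rewrite ler_wpM2l ?(ltW s0)// le_max lexx orbT.
rewrite mulrBr divff ?gt_eqF//; lra.
Qed.

Lemma hat_cvg (h : R -> R) x t :
  (fun n => h t * hat n.+1%:R x t) @ \oo --> (if 0 < t < x then h t else 0 : R).
Proof.
case: ifPn => tx; last first.
  rewrite (_ : (fun n => _) = cst 0); first exact: cvg_cst.
  apply/funext => n; have [->|/hat_supp /andP[t1 t2]] := eqVneq (hat n.+1%:R x t) 0.
    by rewrite mulr0.
  case/negP: tx; rewrite (lt_trans _ t1) ?invr_gt0//= (lt_trans t2)//.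
  by rewrite ltrBlDr ltrDl invr_gt0.
apply: cvg_near_cst; near=> n; rewrite hat_eq1 ?mulr1//.
case/andP: tx => t0 tx.
have m0 : 0 <= 2 / Num.min t (x - t) by rewrite divr_ge0// le_min !ltW// subr_gt0.
apply: (le_trans (ltW (archi_boundP m0))); rewrite ler_nat; apply: leqW.
by near: n; exists (Num.bound (2 / Num.min t (x - t))).
Unshelve. all: by end_near. Qed.

Lemma hat_prim_cvg L h x : 0 <= x -> x <= L -> int1 L h ->
  (fun n => prim (fun t => h t * hat n.+1%:R x t) L) @ \oo --> prim h x.
Proof.
move=> x0 xL hi; rewrite -(prim_restrict x0 xL hi).
have [] := @dct _ L (fun n t => h t * hat n.+1%:R x t)
  (fun t => if 0 < t < x then h t else 0) (fun t => `|h t|) => //.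
- move=> k; apply: measurable_funM; first exact: int1_meas.
  by apply: cts_meas; apply: cts_within; exact: hat_cts.
- by move=> t _; exact: hat_cvg.
- exact: int1_norm.
- move=> k t _; rewrite normrM ler_piMr//.
  by have /andP[? ?] := @hat_bound k.+1%:R x t (ler0n _ _); rewrite ger0_norm.
Qed.

Lemma Rintegral_eq0 (A : set R) f : (forall t, A t -> f t = 0) ->
  \int[mu]_(t in A) f t = 0.
Proof.
move=> f0; rewrite (@eq_Rintegral _ _ _ mu _ (fun=> 0)); last first.
  by move=> t; rewrite inE; exact: f0.
by rewrite /Rintegral integral0.
Qed.

Lemma test_function_of_prim L a b h : 0 < a -> b < L -> 0 <= L -> continuous h ->
  (forall t, h t != 0 -> a <= t <= b) -> prim h L = 0 ->
  test_function L (prim h) /\ derive1 (prim h) = h.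
Proof.
move=> a0 bL L0 ch supp hL.
have hi x : int1 x h by apply: cts_int1; exact: cts_within.
have h0 t : t < a -> h t = 0.
  by move=> ta; apply/eqP; apply: contraT => /supp /andP[]; rewrite leNgt ta.
have h1 t : b < t -> h t = 0.
  by move=> ta; apply/eqP; apply: contraT => /supp /andP[_]; rewrite leNgt ta.
have p0 x : x < a -> prim h x = 0.
  move=> xa; apply: Rintegral_eq0 => t /=; rewrite in_itv /= => /andP[_ tx].
  by apply: h0; exact: le_lt_trans xa.
have p1 x : b < x -> prim h x = 0.
  move=> bx; have [x0|x0] := ltP x a; first exact: p0.
  have x0' : 0 <= x by rewrite (le_trans (ltW a0)).
  have [xL|/ltW Lx] := leP x L.
    suff : prim h L - prim h x = 0 by rewrite hL sub0r => /eqP; rewrite oppr_eq0 => /eqP.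
    rewrite (prim_sub (hi L))// Rintegral_eq0//.
    by move=> t /=; rewrite in_itv /= => /andP[xt _]; apply: h1; exact: lt_trans xt.
  rewrite -[LHS]subr0 -hL (prim_sub (hi x))// Rintegral_eq0//.
  by move=> t /=; rewrite in_itv /= => /andP[xt _]; apply: h1; exact: lt_trans xt.
have der x : is_derive x (1 : R) (prim h) (h x).
  (* Up to 0 included, differentiability comes from [prim h] being identically 0 left of [a]; beyond
     0 it is the fundamental theorem. *)
  have [x0|x0] := leP x 0.
    rewrite h0; last exact: le_lt_trans a0.
    have nc : is_derive x (1 : R) (cst 0 : R -> R) 0 by exact: is_derive_cst.
    apply: near_eq_is_derive nc.
    by near=> y; rewrite p0//; near: y; apply: lt_nbhsl; exact: le_lt_trans a0.
  have [] := @continuous_FTC1_closed _ h 0 x (x + 1) _ (hi _) x0 (ch x).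
    by rewrite ltrDl.
  by rewrite derive1E => d1 d2; apply: DeriveDef.
have derE : derive1 (prim h) = h.
  by apply/funext => x; rewrite derive1E; case: (der x).
split => //; split.
- by move=> x; case: (der x).
- by rewrite derE.
- exists a, b; split => // x hx; apply/andP; split.
    by rewrite leNgt; apply/negP => /p0 /eqP; rewrite (negbTE hx).
  by rewrite leNgt; apply/negP => /p1 /eqP; rewrite (negbTE hx).
Unshelve. all: by end_near. Qed.

(* Testing against the primitive of a combination of two bumps of total integral
   0, which approximate the indicators of ]0, x[ and ]0, L[. *)
Lemma du_bois_reymond L h : 0 < L -> int1 L h ->
  (forall phi, test_function L phi -> prim (fun x => h x * (derive1 phi) x) L = 0) ->
  exists c, aeq L h (fun=> c).
Proof.
move=> L0 hi hphi; exists (prim h L / L).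
(* In the limit the test relation says that the primitive of [h] is linear, that is, [h] and its
   mean value have the same primitive. *)
have prop x : 0 <= x <= L -> L * prim h x = x * prim h L.
  move=> /andP[x0 xL].
  pose al y n := prim (hat n.+1%:R y) L.
  have hat_i n y : int1 L (hat n.+1%:R y).
    by apply: cts_int1; apply: cts_within; exact: hat_cts.
  have hhat_i n y : int1 L (fun t => h t * hat n.+1%:R y t).
    apply: (@int1_le _ _ _ (fun t => `|h t|)) (int1_norm hi) _.
      by apply: measurable_funM; [exact: int1_meas hi|exact: int1_meas (hat_i _ _)].
    move=> t _; rewrite normrM ler_piMr//.
    by have /andP[? ?] := @hat_bound n.+1%:R y t (ler0n _ _); rewrite ger0_norm.
  have cal y : 0 <= y <= L -> al y @ \oo --> y.
    move=> /andP[y0 yL]; have := hat_prim_cvg y0 yL (int1_cst L 1).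
    rewrite prim_cst// mul1r.
    suff -> : al y = (fun n => prim (fun t => 1 * hat n.+1%:R y t) L) by [].
    by apply/funext => n; apply: eq_prim => t _; rewrite mul1r.
  have eqn n : al L n * prim (fun t => h t * hat n.+1%:R x t) L =
               al x n * prim (fun t => h t * hat n.+1%:R L t) L.
    pose psi t := al L n * hat n.+1%:R x t - al x n * hat n.+1%:R L t.
    have [||||||tpsi psiE] := @test_function_of_prim L n.+1%:R^-1 (L - n.+1%:R^-1) psi.
    - by rewrite invr_gt0.
    - by rewrite ltrBlDr ltrDl invr_gt0.
    - exact: ltW.
    - move=> t; apply: cvgB; apply: cvgM; [exact: cvg_cst|exact: hat_cts|
        exact: cvg_cst|exact: hat_cts].
    - move=> t; have [h0|/hat_supp/andP[h1 h2] _] := eqVneq (hat n.+1%:R L t) 0.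
        rewrite /psi h0 mulr0 subr0 mulf_eq0 negb_or => /andP[_ /hat_supp/andP[h1 h2]].
        by rewrite ltW//= (le_trans (ltW h2))// lerB.
      by rewrite !ltW.
    - rewrite /psi primB; [|exact: int1Z|exact: int1Z].
      by rewrite !primZ// -/(al L n) -/(al x n) mulrC subrr.
    have := hphi _ tpsi; rewrite psiE.
    rewrite (@eq_prim _ _ _ (fun t => al L n * (h t * hat n.+1%:R x t) -
      al x n * (h t * hat n.+1%:R L t))); last by move=> t _; rewrite /psi; ring.
    rewrite primB; [|exact: int1Z|exact: int1Z].
    by rewrite !primZ// => /eqP; rewrite subr_eq0 => /eqP.
  have LL : 0 <= L <= L by rewrite ltW/=.
  have xx : 0 <= x <= L by rewrite x0.
  have c1 : (fun n => al L n * prim (fun t => h t * hat n.+1%:R x t) L) @ \oo -->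
      L * prim h x by exact: cvgM (cal L LL) (hat_prim_cvg x0 xL hi).
  have c2 := cvgM (cal x xx) (hat_prim_cvg (ltW L0) (lexx L) hi).
  have c3 : (fun n => al L n * prim (fun t => h t * hat n.+1%:R x t) L) @ \oo -->
      x * prim h L.
    by under eq_fun do rewrite eqn; exact: c2.
  by apply: cvg_unique c1 c3; exact: Rhausdorff.
have : aeq L (fun t => h t - prim h L / L) (fun=> 0).
  apply: prim_eq0_ae; first by apply: int1B => //; exact: int1_cst.
  move=> x /[dup] xx /andP[x0 xL]; rewrite primB; [|exact: int1_sub hi|exact: int1_cst].
  rewrite prim_cst//; apply/eqP; rewrite subr_eq0 -(inj_eq (mulfI (lt0r_neq0 L0))).
  by rewrite prop//; apply/eqP; field; rewrite gt_eqF.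
by apply: ae_imp => t h0 Dt; apply/eqP; rewrite -subr_eq0 h0.
Qed.

Lemma aeq_refl L f : aeq L f f.
Proof. exact/aeW. Qed.

Lemma aeq_sym L f g : aeq L f g -> aeq L g f.
Proof. by apply: ae_imp => t h Dt; rewrite h. Qed.

Lemma aeq_trans L f g h : aeq L f g -> aeq L g h -> aeq L f h.
Proof. by apply: ae_imp2 => t h1 h2 Dt; rewrite h1// h2. Qed.

Lemma aeq_eq L f g : (forall t, 0 <= t <= L -> f t = g t) -> aeq L f g.
Proof. by move=> fg; apply/aeW => t /=; rewrite in_itv; exact: fg. Qed.

Lemma cts_epsP (V : normedModType R) L (u : R -> V) :
  {within `[0, L], continuous u} <->
  forall t, 0 <= t <= L -> forall e, 0 < e -> exists d : R, 0 < d /\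
    forall y, 0 <= y <= L -> `|y - t| < d -> `|u y - u t| < e.
Proof.
split=> [/subspace_continuousP cu t Dt e e0|H].
  have DDt : `[0, L]%classic t by rewrite /= in_itv.
  have /cvgrPdist_lt /(_ e e0) := cu t DDt.
  rewrite near_withinE => -[d /= d0 Hd].
  exists d; split => // y Dy yt; rewrite distrC; apply: Hd; last by rewrite /= in_itv.
  by rewrite /= distrC.
apply/subspace_continuousP => t /=; rewrite in_itv /= => Dt.
apply/cvgrPdist_lt => e e0; have [d [d0 Hd]] := H t Dt e e0.
rewrite near_withinE; exists d => // y /= yt; rewrite in_itv /= => Dy.
by rewrite distrC; apply: Hd => //; rewrite distrC.
Qed.

(** If the difference [h] were nonzero at [t], then [|h| >= |h t| / 2] on an interval of positive
    length around [t], whereas the integral of [|h|] is 0. *)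
Lemma aeq_cts L f g : 0 < L -> {within `[0, L], continuous f} ->
  {within `[0, L], continuous g} -> aeq L f g ->
  forall t, 0 <= t <= L -> f t = g t.
Proof.
move=> L0 cf cg fg t Dt; apply/eqP; rewrite -subr_eq0; apply: contraT => ft.
pose h y := f y - g y.
have ch : {within `[0, L], continuous h}.
  by move=> x; apply: cvgB; [exact: cf|exact: cg].
have hi := int1_norm (cts_int1 ch).
have h0 x : x <= L -> prim (fun y => `|h y|) x = 0.
  move=> xL; rewrite (@ae_prim _ _ _ (fun=> 0)); [|exact: int1_sub hi|exact: int1_cst|].
    by apply: Rintegral_eq0.
  apply: ae_imp fg => y fgy Dy; rewrite /h fgy ?subrr ?normr0//.
  by move: Dy; rewrite /= !in_itv /= => /andP[-> /le_trans]; apply.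
have eta0 : 0 < `|h t| / 2 by rewrite divr_gt0// normr_gt0.
have [d [d0 Hd]] := (cts_epsP L h).1 ch t Dt _ eta0.
case/andP: Dt => t0 tL.
(* Clipped to [[0, L]], since [t] may be an endpoint; [a < b] holds nevertheless because [L > 0]. *)
pose a := Num.max 0 (t - d / 2); pose b := Num.min L (t + d / 2).
have a0 : 0 <= a by rewrite le_max lexx.
have bL : b <= L by rewrite ge_min lexx.
have at_ : a <= t by rewrite ge_max t0 /= gerBl divr_ge0// ltW.
have tb : t <= b by rewrite le_min tL /= lerDl divr_ge0// ltW.
have ab : a < b.
  by rewrite lt_min !gt_max L0 /=; apply/and3P; split; lra.
have := le_prim_sub (int1_cst L (`|h t| / 2)) hi a0 (ltW ab) bL.
rewrite !h0 ?(le_trans (ltW ab))// !prim_cst ?(le_trans a0 (ltW ab))// subrr.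
rewrite -mulrBr => H; exfalso.
have : `|h t| / 2 * (b - a) <= 0.
  apply: H => y /andP[ay yb].
  have y01 : 0 <= y <= L by rewrite (le_trans a0)//= (le_trans yb).
  have : `|y - t| < d.
    have h1 : t - d / 2 <= y by rewrite (le_trans _ ay)// le_max lexx orbT.
    have h2 : y <= t + d / 2 by rewrite (le_trans yb)// ge_min lexx orbT.
    by rewrite ltr_norml; apply/andP; split; lra.
  move=> /(Hd y y01); have := ler_distD (h y) 0 (h t).
  rewrite !sub0r !normrN; lra.
by rewrite leNgt mulr_gt0// subr_gt0.
Qed.

(** [f - prim g] has weak derivative 0, so it is constant by [du_bois_reymond]. *)
Lemma sweak_rep L f g : 0 < L -> int1 L f -> int1 L g -> sweak L f g ->
  exists c, aeq L f (fun x => c + prim g x).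
Proof.
move=> L0 fi gi w.
have pi : int1 L (prim g) by apply: cts_int1; exact: prim_cts.
have [||c hc] := @du_bois_reymond L (fun x => f x - prim g x) L0.
- exact: int1B.
- move=> phi tphi; have [dphi cphi _] := tphi.
  have c1 := @cts_within L _ cphi.
  have [M HM] := cts_bounded c1.
  have bm h : int1 L h -> int1 L (fun x => h x * (derive1 phi) x).
    move=> hi; have := @int1_mul_bounded _ L M (derive1 phi) h (cts_meas c1).
    move=> /(_ _ hi) k; apply: eq_int1 (k _); first by move=> x _; rewrite mulrC.
    by move=> x /=; rewrite in_itv; exact: HM.
  rewrite (@eq_prim _ _ _ (fun x => f x * (derive1 phi) x - prim g x * (derive1 phi) x)); last first.
    by move=> t _; ring.
  rewrite primB ?(w _ tphi); [|exact: bm|exact: bm].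
  have := sweak_prim 0 (ltW L0) gi tphi.
  rewrite (@eq_prim _ _ _ (fun x => prim g x * (derive1 phi) x)) => [|t _]; last by rewrite add0r.
  by move=> ->; rewrite subrr.
- by exists c; apply: ae_imp hc => t h Dt; rewrite -h// subrK.
Qed.

Lemma sweak_unique L f f' g g' : 0 < L -> aeq L f f' -> int1 L f -> int1 L f' ->
  int1 L g -> int1 L g' -> sweak L f g -> sweak L f' g' -> aeq L g g'.
Proof.
move=> L0 ff fi f'i gi g'i w w'.
have [c hc] := sweak_rep L0 fi gi w.
have [c' hc'] := sweak_rep L0 f'i g'i w'.
have e1 : aeq L (fun x => c + prim g x) (fun x => c' + prim g' x).
  exact: aeq_trans (aeq_sym hc) (aeq_trans ff hc').
have cts k h : int1 L h -> {within `[0, L], continuous (fun x => k + prim h x : R)}.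
  by move=> hi x; apply: cvgD; [exact: cvg_cst|exact: prim_cts].
have e2 := aeq_cts L0 (cts c g gi) (cts c' g' g'i) e1.
have cc : c = c'.
  by have := e2 0; rewrite !prim0 !addr0 lexx ltW// => ->.
have : aeq L (fun t => g t - g' t) (fun=> 0).
  apply: prim_eq0_ae; first exact: int1B.
  move=> x /[dup] xx /andP[x0 xL]; rewrite primB; [|exact: int1_sub gi|exact: int1_sub g'i].
  by have := e2 x xx; rewrite cc => /addrI ->; rewrite subrr.
by apply: ae_imp => t h0 Dt; apply/eqP; rewrite -subr_eq0 h0.
Qed.

End WeakDerivative.

(** The Hoelder estimate of exponent 1/2 for primitives of L^2 functions: the discriminant of
    [t]-quadratic integrals of [(t w + 1) ^ 2] over []x, y]], written with differences of [prim]. *)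
Lemma prim_incr_sq {R : realType} (L : R) (w : R -> R) x y : sqint L w ->
  0 <= x -> x <= y -> y <= L ->
  (prim w y - prim w x) ^+ 2 <= (y - x) * prim (fun t => w t ^+ 2) L.
Proof.
move=> ws x0 xy yL; have wi := sqint_int1 ws.
set W := prim w.
have le1 : prim (fun t => w t ^+ 2) y - prim (fun t => w t ^+ 2) x <=
    prim (fun t => w t ^+ 2) L.
  rewrite lerBlDr ler_wpDr//; first by apply: prim_ge0 => t _; exact: sqr_ge0.
  apply: (prim_mono ws.2) => //; last exact: le_trans xy.
  by move=> t _; exact: sqr_ge0.
apply: le_trans (_ : (y - x) *
  (prim (fun t => w t ^+ 2) y - prim (fun t => w t ^+ 2) x) <= _); last first.
  by rewrite ler_wpM2l ?subr_ge0.
rewrite mulrC; apply: discriminant_le => t.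
have xL := le_trans xy yL; have y0 := le_trans x0 xy.
have h1 := int1Z (t ^+ 2) ws.2; have h2 := int1Z (2 * t) wi.
have h := int1D (int1D h1 h2) (int1_cst L 1).
have E z : 0 <= z -> z <= L ->
    prim (fun z => t ^+ 2 * w z ^+ 2 + 2 * t * w z + 1) z =
    t ^+ 2 * prim (fun z => w z ^+ 2) z + 2 * t * W z + z.
  move=> z0 zL; rewrite (primD (int1_sub zL (int1D h1 h2)) (int1_cst z 1)).
  rewrite (primD (int1_sub zL h1) (int1_sub zL h2)).
  rewrite (primZ _ (int1_sub zL ws.2)) (primZ _ (int1_sub zL wi)).
  by rewrite prim_cst// mul1r.
have := le_prim_sub (int1_cst L 0) h x0 xy yL.
rewrite !prim_cst// !mul0r subrr !E// => H.
have : 0 <= t ^+ 2 * prim (fun z => w z ^+ 2) y + 2 * t * W y + y -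
    (t ^+ 2 * prim (fun z => w z ^+ 2) x + 2 * t * W x + x).
  apply: H => z _; rewrite (_ : _ + 1 = (t * w z + 1) ^+ 2) ?sqr_ge0//; ring.
by move=> {}H; lra.
Qed.

Lemma sweak_aer {R : realType} (L : R) (f g g' : R -> R) : int1 L g -> int1 L g' ->
  aeq L g g' -> sweak L f g -> sweak L f g'.
Proof.
move=> gi g'i gg w phi tphi; rewrite (w phi tphi).
have [dphi cphi _] := tphi.
have cphi0 : {within `[0, L], continuous phi}.
  by apply: cts_within => x; apply: derivable_cts; exact: dphi.
have [M HM] := cts_bounded cphi0.
have bm (h : R -> R) : int1 L h -> int1 L (fun x => h x * phi x).
  move=> hi; have := @int1_mul_bounded _ L M phi h (cts_meas cphi0).
  move=> /(_ _ hi) k; apply: eq_int1 (k _); first by move=> x _; rewrite mulrC.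
  by move=> x /=; rewrite in_itv; exact: HM.
congr (- _); apply: ae_prim; [exact: bm|exact: bm|].
by apply: ae_imp gg => t h Dt; rewrite h.
Qed.

(** * Vector-valued functions and the continuous representatives of H^2 *)

Section RowFunctions.
Context {R : realType} (n : nat).
Local Notation mu := (@lebesgue_measure R).
Implicit Types (L x t : R) (f g u v w : R -> 'rV[R]_n).

Lemma cvg_row (T : Type) (F : set_system T) (FF : Filter F)
    (f : T -> 'rV[R]_n) (y : 'rV[R]_n) :
  (forall i, (fun z => f z 0 i) @ F --> y 0 i) -> f @ F --> y.
Proof.
move=> fy; apply/cvg_ballP => e e0.
have : \forall z \near F, forall i : 'I_n, `|y 0 i - f z 0 i| < e.
  by apply: filter_forall => i; move/cvgrPdist_lt : (fy i); exact.
by apply: filterS => z H; split => // i j; rewrite ord1; exact: H.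
Qed.

Lemma cvg_coord (T : Type) (F : set_system T) (FF : Filter F)
    (f : T -> 'rV[R]_n) (y : 'rV[R]_n) i :
  f @ F --> y -> (fun z => f z 0 i) @ F --> y 0 i.
Proof.
move=> fy.
have c : {for y, continuous (fun M : 'rV[R]_n => M 0 i)} by exact: coord_continuous.
exact: (cvg_comp _ _ fy c).
Qed.

Lemma cts_rowP L f : {within `[0, L], continuous f} <->
  forall i, {within `[0, L], continuous (fun x => f x 0 i)}.
Proof.
split=> [/subspace_continuousP cf i|cf].
  by apply/subspace_continuousP => x Dx; apply: cvg_coord; exact: cf.
apply/subspace_continuousP => x Dx; apply: cvg_row => i.
by have /subspace_continuousP := cf i; exact.
Qed.

Lemma eq_cts (V : normedModType R) L (f g : R -> V) :
  (forall x, 0 <= x <= L -> f x = g x) ->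
  {within `[0, L], continuous f} -> {within `[0, L], continuous g}.
Proof.
move=> fg /cts_epsP cf; apply/cts_epsP => t Dt e e0.
have [d [d0 Hd]] := cf t Dt e e0; exists d; split => // y Dy yt.
by rewrite -!fg//; exact: Hd.
Qed.

Lemma L2P L f : L2 L f <-> forall i, sqint L (fun x => f x 0 i).
Proof.
split=> H i; have [mf f2] := H i; split => //.
  apply/integrableP; split.
    by apply/measurable_EFinP; exact: measurable_funX.
  apply: le_lt_trans f2; rewrite le_eqVlt; apply/orP; left; apply/eqP.
  by apply: eq_integral => x _ /=; rewrite ger0_norm// sqr_ge0.
have /integrableP[_] := f2; apply: le_lt_trans.
rewrite le_eqVlt; apply/orP; left; apply/eqP.
by apply: eq_integral => x _ /=; rewrite ger0_norm// sqr_ge0.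
Qed.

Lemma weak_derivP L f g : weak_deriv L f g <->
  forall i, sweak L (fun x => f x 0 i) (fun x => g x 0 i).
Proof. by split=> [H i phi tphi|H phi tphi i]; exact: H. Qed.

(** Absolute continuity with derivative [w], stated pointwise. For continuous [u] and integrable [w]
    it is equivalent to the weak derivative by [primitive_sweak] and [sweak_primitive], and it
    replaces the latter from here on. *)
Definition primitive_of L u w := forall i x, 0 <= x <= L ->
  u x 0 i = u 0 0 i + prim (fun t => w t 0 i) x.

Lemma primitive_sweak L u w : 0 <= L -> (forall i, int1 L (fun t => w t 0 i)) ->
  primitive_of L u w -> weak_deriv L u w.
Proof.
move=> L0 wi uw; apply/weak_derivP => i.
apply: (eq_sweak _ _ (sweak_prim (u 0 0 i) L0 (wi i))) => // x Dx.
by rewrite -uw.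
Qed.

Lemma primitive_cts L u w : (forall i, int1 L (fun t => w t 0 i)) ->
  primitive_of L u w -> {within `[0, L], continuous u}.
Proof.
move=> wi uw; apply/cts_rowP => i.
apply: (@eq_cts _ _ (fun x => u 0 0 i + prim (fun t => w t 0 i) x)).
  by move=> x Dx; rewrite -uw.
by move=> x; apply: cvgD; [exact: cvg_cst|exact: prim_cts].
Qed.

Lemma sweak_primitive L u w : 0 < L -> {within `[0, L], continuous u} ->
  (forall i, int1 L (fun t => w t 0 i)) -> weak_deriv L u w -> primitive_of L u w.
Proof.
move=> L0 /cts_rowP cu wi /weak_derivP uw i.
have [c hc] := sweak_rep L0 (cts_int1 (cu i)) (wi i) (uw i).
have cc : {within `[0, L], continuous (fun x => c + prim (fun t => w t 0 i) x : R)}.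
  by move=> x; apply: cvgD; [exact: cvg_cst|exact: prim_cts].
have e := aeq_cts L0 (cu i) cc hc.
move=> x Dx; rewrite (e x Dx) (e 0) ?prim0 ?addr0// lexx.
exact: ltW.
Qed.

Lemma cts_L2 L f : {within `[0, L], continuous f} -> L2 L f.
Proof. by move=> /cts_rowP cf; apply/L2P => i; exact: cts_sqint. Qed.

Section H2.
Variable L : R.
Hypothesis L0 : 0 < L.
Let L0' := ltW L0.

Lemma L2_int1 f i : L2 L f -> int1 L (fun x => f x 0 i).
Proof. by move=> /L2P/(_ i)/sqint_int1. Qed.

Lemma weak_deriv_L2_cts f g : L2 L f -> L2 L g -> weak_deriv L f g ->
  exists w, [/\ {within `[0, L], continuous w}, primitive_of L w g &
    forall i, aeq L (fun x => f x 0 i) (fun x => w x 0 i)].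
Proof.
move=> f2 g2 /weak_derivP fg.
have gi i : int1 L (fun x => g x 0 i) by exact: L2_int1.
have [c hc] := choice (fun i => sweak_rep L0 (L2_int1 i f2) (gi i) (fg i)).
pose w x : 'rV[R]_n := \row_i (c i + prim (fun t => g t 0 i) x).
have wg : primitive_of L w g by move=> i x Dx; rewrite !mxE prim0 addr0.
exists w; split => //; first exact: primitive_cts wg.
by move=> i; apply: ae_imp (hc i) => t h Dt; rewrite mxE h.
Qed.

(** The point is that the choices in [d1] and [d2] do not fall back on the default 0. The first
    derivative in [Hm] is only in L^2; its continuous representative is a witness for [d1], and
    uniqueness then makes [g2] a witness for [d2]. *)
Lemma H2_rep u : H2 L u -> [/\ {within `[0, L], continuous (d1 L u)},
  L2 L (d2 L u), primitive_of L u (d1 L u) & primitive_of L (d1 L u) (d2 L u)].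
Proof.
move=> [cu [_ [g1 [ug1 [g12 [g2 [g1g2 g22]]]]]]].
have [w [cw wg wae]] := weak_deriv_L2_cts g12 g22 g1g2.
have uw : weak_deriv L u w.
  apply/weak_derivP => i; move/weak_derivP : ug1 => /(_ i); apply: sweak_aer (wae i).
    exact: L2_int1.
  by apply: cts_int1; have /cts_rowP := cw; exact.
have [cd ud] : {within `[0, L], continuous (d1 L u)} /\ weak_deriv L u (d1 L u).
  exact: (@xgetPex _ (fun=> 0) [set g | {within `[0, L], continuous g} /\ weak_deriv L u g]
    (ex_intro _ w (conj cw uw))).
have di i : int1 L (fun x => d1 L u x 0 i) by apply: L2_int1; exact: cts_L2.
have wi i : int1 L (fun x => w x 0 i) by apply: L2_int1; exact: cts_L2.
have ui i : int1 L (fun x => u x 0 i) by apply: L2_int1; exact: cts_L2.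
have dw x : 0 <= x <= L -> d1 L u x = w x.
  move=> Dx; apply/rowP => i.
  have a : aeq L (fun x => d1 L u x 0 i) (fun x => w x 0 i).
    move/weak_derivP : ud => /(_ i) ud; move/weak_derivP : uw => /(_ i) uw.
    exact: (sweak_unique L0 (@aeq_refl _ _ _) (ui i) (ui i) (di i) (wi i) ud uw).
  by apply: (aeq_cts L0 _ _ a) => //; [move/cts_rowP : cd|move/cts_rowP : cw]; exact.
have dg2 : weak_deriv L (d1 L u) g2.
  apply/weak_derivP => i.
  have := primitive_sweak L0' (fun i => L2_int1 i g22) wg.
  by move=> /weak_derivP /(_ i); apply: eq_sweak => // x Dx; rewrite dw.
have [d22 dd] : L2 L (d2 L u) /\ weak_deriv L (d1 L u) (d2 L u).
  exact: (@xgetPex _ (fun=> 0) [set g | L2 L g /\ weak_deriv L (d1 L u) g]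
    (ex_intro _ g2 (conj g22 dg2))).
split => //; first exact: sweak_primitive.
by apply: sweak_primitive => // i; exact: L2_int1.
Qed.

(** The tool for recognizing constructed functions as elements of H^2: exhibit two successive
    primitives, and uniqueness identifies the chosen derivatives with them, pointwise for the first
    and almost everywhere for the second. *)
Lemma rep_H2 u w g : L2 L g -> primitive_of L u w -> primitive_of L w g ->
  [/\ H2 L u, forall x, 0 <= x <= L -> d1 L u x = w x &
      forall i, aeq L (fun x => d2 L u x 0 i) (fun x => g x 0 i)].
Proof.
move=> g2 uw wg.
have gi i : int1 L (fun x => g x 0 i) by exact: L2_int1.
have cw := primitive_cts gi wg.
have wi i : int1 L (fun x => w x 0 i) by apply: L2_int1; exact: cts_L2.
have cu := primitive_cts wi uw.
have Hu : H2 L u.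
  split => //; split; first exact: cts_L2.
  exists w; split; first exact: primitive_sweak.
  split; first exact: cts_L2.
  by exists g; split => //; exact: primitive_sweak.
have [cd d22 ud dd] := H2_rep Hu.
have di i : int1 L (fun x => d1 L u x 0 i) by apply: L2_int1; exact: cts_L2.
have ddi i : int1 L (fun x => d2 L u x 0 i) by exact: L2_int1.
have ui i : int1 L (fun x => u x 0 i) by apply: L2_int1; exact: cts_L2.
have dw x : 0 <= x <= L -> d1 L u x = w x.
  move=> Dx; apply/rowP => i.
  have a : aeq L (fun x => d1 L u x 0 i) (fun x => w x 0 i).
    have /weak_derivP/(_ i) s1 := primitive_sweak L0' di ud.
    have /weak_derivP/(_ i) s2 := primitive_sweak L0' wi uw.
    exact: (sweak_unique L0 (@aeq_refl _ _ _) (ui i) (ui i) (di i) (wi i) s1 s2).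
  by apply: (aeq_cts L0 _ _ a) => //; [move/cts_rowP : cd|move/cts_rowP : cw]; exact.
split => // i.
have /weak_derivP/(_ i) s1 := primitive_sweak L0' ddi dd.
have /weak_derivP/(_ i) s2 := primitive_sweak L0' gi wg.
apply: (sweak_unique L0 _ (di i) (wi i) (ddi i) (gi i) s1 s2).
by apply: aeq_eq => t Dt; rewrite dw.
Qed.

Lemma H2_lin (a : R) u v : H2 L u -> H2 L v ->
  [/\ H2 L (a *: u + v),
      forall x, 0 <= x <= L -> d1 L (a *: u + v) x = a *: d1 L u x + d1 L v x &
      forall i, aeq L (fun x => d2 L (a *: u + v) x 0 i)
        (fun x => a * d2 L u x 0 i + d2 L v x 0 i)].
Proof.
move=> Hu Hv; have [cu u2 uu uuu] := H2_rep Hu; have [cv v2 vv vvv] := H2_rep Hv.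
have ui i : int1 L (fun x => d1 L u x 0 i) by apply: L2_int1; exact: cts_L2.
have vi i : int1 L (fun x => d1 L v x 0 i) by apply: L2_int1; exact: cts_L2.
have u2i i : int1 L (fun x => d2 L u x 0 i) by exact: L2_int1.
have v2i i : int1 L (fun x => d2 L v x 0 i) by exact: L2_int1.
have lin (p q p' q' : R -> 'rV[R]_n) : primitive_of L p q -> primitive_of L p' q' ->
    (forall i, int1 L (fun x => q x 0 i)) -> (forall i, int1 L (fun x => q' x 0 i)) ->
    primitive_of L (fun x => a *: p x + p' x) (fun x => a *: q x + q' x).
  move=> pq pq' qi qi' i x /[dup] Dx /andP[x0 xL].
  have q1 := int1_sub xL (qi i); have q1' := int1_sub xL (qi' i).
  rewrite (@eq_prim _ _ _ (fun t => a * q t 0 i + q' t 0 i)); last first.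
    by move=> t _; rewrite !mxE.
  rewrite primD ?primZ//; last exact: int1Z.
  rewrite !mxE (pq _ _ Dx) (pq' _ _ Dx); ring.
have [|||H1 H2 H3] := @rep_H2 (fun x => a *: u x + v x)
    (fun x => a *: d1 L u x + d1 L v x) (fun x => a *: d2 L u x + d2 L v x).
- apply/L2P => i; move/L2P : u2 => /(_ i) u2; move/L2P : v2 => /(_ i) v2.
  have := sqintD (sqintZ a u2) v2.
  by apply: eq_sqint => x _; rewrite !mxE.
- exact: lin.
- exact: lin.
- rewrite (_ : a *: u + v = fun x => a *: u x + v x); last exact/funext.
  split; [exact: H1|exact: H2|move=> i].
  have e (p q : 'rV[R]_n) : (a *: p + q) 0 i = a * p 0 i + q 0 i by rewrite !mxE.
  by apply: ae_imp (H3 i) => t h Dt; exact: etrans (h Dt) (e _ _).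
Qed.

Lemma primitive_evalB u w i x y : L2 L w -> primitive_of L u w ->
  0 <= x -> x <= y -> y <= L ->
  (u y 0 i - u x 0 i) ^+ 2 <= (y - x) * prim (fun t => w t 0 i ^+ 2) L.
Proof.
move=> w2 uw x0 xy yL; have /L2P/(_ i) ws := w2.
rewrite (uw i y) ?(le_trans x0)// (uw i x) ?x0 ?(le_trans xy)//.
rewrite [X in X ^+ 2](_ : _ = prim (fun t => w t 0 i) y - prim (fun t => w t 0 i) x).
  exact: prim_incr_sq.
ring.
Qed.

End H2.
End RowFunctions.

(** * The Hilbert space H^2 *)

(* Sealed copies of [d1] and [d2]: otherwise, comparing two values of them makes
   the unifier unfold [xget] down to the definition of the integral. *)
Definition wd1 {R : realType} {n : nat} (L : R) := locked (@d1 R L n).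
Definition wd2 {R : realType} {n : nat} (L : R) := locked (@d2 R L n).

Section Sealed.
Context {R : realType} (n : nat) (L : R).
Implicit Types (u v w g : R -> 'rV[R]_n).

Lemma wd1E u : d1 L u = wd1 L u. Proof. by rewrite /wd1 -lock. Qed.
Lemma wd2E u : d2 L u = wd2 L u. Proof. by rewrite /wd2 -lock. Qed.

Hypothesis L0 : 0 < L.

Lemma H2_wd u : H2 L u -> [/\ {within `[0, L], continuous (wd1 L u)},
  L2 L (wd2 L u), primitive_of L u (wd1 L u) & primitive_of L (wd1 L u) (wd2 L u)].
Proof. by rewrite -wd1E -wd2E; exact: H2_rep. Qed.

Lemma wd_H2 u w g : L2 L g -> primitive_of L u w -> primitive_of L w g ->
  [/\ H2 L u, forall x, 0 <= x <= L -> wd1 L u x = w x &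
      forall i, aeq L (fun x => wd2 L u x 0 i) (fun x => g x 0 i)].
Proof. by rewrite -wd1E -wd2E; exact: rep_H2. Qed.

Lemma H2_wd_lin (a : R) u v : H2 L u -> H2 L v ->
  [/\ H2 L (a *: u + v),
      forall x, 0 <= x <= L -> wd1 L (a *: u + v) x = a *: wd1 L u x + wd1 L v x &
      forall i, aeq L (fun x => wd2 L (a *: u + v) x 0 i)
        (fun x => a * wd2 L u x 0 i + wd2 L v x 0 i)].
Proof. by rewrite -!wd1E -!wd2E; exact: H2_lin. Qed.

End Sealed.

Section H2Space.
Context {R : realType} (n : nat).
Local Notation mu := (@lebesgue_measure R).
Implicit Types (x t : R) (f g u v w : R -> 'rV[R]_n).

Lemma sq_cauchy_cvg (a : nat -> R) :
  (forall e : R, 0 < e -> exists N, forall m k, (N <= m)%N -> (N <= k)%N ->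
    (a m - a k) ^+ 2 <= e) ->
  exists l, forall e : R, 0 < e -> exists N, forall m, (N <= m)%N ->
    (a m - l) ^+ 2 <= e.
Proof.
move=> ca; have /cauchy_cvgP : cauchy (a @ \oo).
  apply/cauchy_ballP => e e0; have [|N HN] := ca ((e / 2) ^+ 2).
    by rewrite exprn_gt0// divr_gt0.
  exists (a @` [set k | (N <= k)%N], a @` [set k | (N <= k)%N]).
    by split; exists N => // k Nk; exists k.
  move=> [_ _] /= [[m Nm <-] [k Nk <-]]; have := HN m k Nm Nk.
  rewrite -[X in X <= _]real_normK ?num_real// ler_sqr ?nnegrE ?divr_ge0 ?(ltW e0)//.
  by move=> /le_lt_trans; apply; rewrite ltr_pdivrMr// ltr_pMr// ltr1n.
move=> /cvg_ex[l /cvgrPdist_le al]; exists l => e e0.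
have [|N _ HN] := al (Num.sqrt e); first by rewrite sqrtr_gt0.
exists N => m Nm; have /= := HN m Nm; rewrite distrC => h.
by rewrite -[leLHS]real_normK ?num_real// -[leRHS]sqr_sqrtr ?(ltW e0)// ler_sqr ?nnegrE// sqrtr_ge0.
Qed.

Lemma finite_bound (P : 'I_n -> nat -> Prop) :
  (forall i, exists N, forall m, (N <= m)%N -> P i m) ->
  exists N, forall m, (N <= m)%N -> forall i, P i m.
Proof.
move=> H; have [N HN] := choice H; exists (\max_i N i) => m Nm i.
by apply: HN; apply: leq_trans Nm; exact: leq_bigmax.
Qed.

Variable L : R.
Hypothesis L0 : 0 < L.
Let L0' := ltW L0.

Definition ip u v := \sum_i (u 0 0 i * v 0 0 i + wd1 L u 0 0 i * wd1 L v 0 0 i +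
  prim (fun t => wd2 L u t 0 i * wd2 L v t 0 i) L).

Lemma d2_sqint u i : H2 L u -> sqint L (fun t => wd2 L u t 0 i).
Proof. by move=> /(H2_wd L0)[_ /L2P]. Qed.

Lemma zero_in_itv : (0 : R) <= 0 <= L. Proof. by rewrite lexx. Qed.

Lemma ip_sym u v : ip u v = ip v u.
Proof.
apply: eq_bigr => i _; rewrite (mulrC (u 0 0 i)) (mulrC (wd1 L u 0 0 i)).
congr (_ + _); apply: eq_prim => t _; exact: mulrC.
Qed.

Lemma ip_ge0 u : 0 <= ip u u.
Proof.
apply: sumr_ge0 => i _; rewrite -!expr2 !addr_ge0 ?sqr_ge0//.
by apply: prim_ge0 => t _; rewrite -expr2 sqr_ge0.
Qed.

Lemma ip_lin (a : R) u v w : H2 L u -> H2 L v -> H2 L w ->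
  ip (a *: u + v) w = a * ip u w + ip v w.
Proof.
move=> Hu Hv Hw; have [Huv e1 e2] := H2_wd_lin L0 a Hu Hv.
rewrite mulr_sumr -big_split; apply: eq_bigr => i _ /=.
rewrite (e1 0 zero_in_itv) !mxE.
rewrite (@ae_prim _ _ _ (fun t => a * (wd2 L u t 0 i * wd2 L w t 0 i) +
  wd2 L v t 0 i * wd2 L w t 0 i)).
- have uw := sqint_int1M (d2_sqint i Hu) (d2_sqint i Hw).
  have vw := sqint_int1M (d2_sqint i Hv) (d2_sqint i Hw).
  rewrite (primD (int1Z a uw) vw) (primZ a uw); ring.
- by apply: sqint_int1M; exact: d2_sqint.
- by apply: int1D; [apply: int1Z|]; apply: sqint_int1M; exact: d2_sqint.
- by apply: ae_imp (e2 i) => t h Dt; rewrite h//; ring.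
Qed.

Lemma H2_sub u v : H2 L u -> H2 L v -> [/\ H2 L (u - v),
  forall x, 0 <= x <= L -> wd1 L (u - v) x = wd1 L u x - wd1 L v x &
  forall i, aeq L (fun x => wd2 L (u - v) x 0 i)
        (fun x => wd2 L u x 0 i - wd2 L v x 0 i)].
Proof.
move=> Hu Hv; have [H e1 e2] := H2_wd_lin L0 (-1) Hv Hu.
rewrite subr_scale; split => // [x Dx|i].
  by rewrite e1// scaleN1r addrC.
by apply: ae_imp (e2 i) => t h Dt; rewrite h// mulN1r addrC.
Qed.

Lemma ip_sub u v : H2 L u -> H2 L v -> ip (u - v) (u - v) =
  \sum_i ((u 0 0 i - v 0 0 i) ^+ 2 + (wd1 L u 0 0 i - wd1 L v 0 0 i) ^+ 2 +
    prim (fun t => (wd2 L u t 0 i - wd2 L v t 0 i) ^+ 2) L).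
Proof.
move=> Hu Hv; have [H e1 e2] := H2_sub Hu Hv.
apply: eq_bigr => i _; rewrite (e1 0 zero_in_itv) !mxE -!expr2; congr (_ + _).
under eq_prim => t _ do rewrite -expr2.
apply: ae_prim.
- by case: (d2_sqint i H).
- by have [] := sqintB (d2_sqint i Hu) (d2_sqint i Hv).
- by apply: ae_imp (e2 i) => t h Dt; rewrite h.
Qed.

(** The data u(0), u'(0), u'' seen by [ip] can be prescribed freely, so completeness reduces to that
    of the reals and of L^2: the limit is obtained by integrating the limit of the second
    derivatives twice. *)
Lemma ip_complete (x_ : nat -> R -> 'rV[R]_n) : (forall m, H2 L (x_ m)) ->
  (forall e : R, 0 < e -> exists N, forall m k, (N <= m)%N -> (N <= k)%N ->
     ip (x_ m - x_ k) (x_ m - x_ k) <= e) ->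
  exists y, H2 L y /\
    forall e : R, 0 < e -> exists N, forall m, (N <= m)%N ->
      ip (x_ m - y) (x_ m - y) <= e.
Proof.
move=> Hx cx.
have part (A B C : 'I_n -> R) i : (forall i, 0 <= A i) -> (forall i, 0 <= B i) ->
    (forall i, 0 <= C i) -> let S := \sum_i (A i + B i + C i) in
    [/\ A i <= S, B i <= S & C i <= S].
  move=> A0 B0 C0 S; have : A i + B i + C i <= S.
    by rewrite /S (bigD1 i)//= lerDl sumr_ge0// => j _; rewrite !addr_ge0.
  by move: (A0 i) (B0 i) (C0 i) => *; split; lra.
have cau e : 0 < e -> exists N, forall m k, (N <= m)%N -> (N <= k)%N -> forall i,
    [/\ (x_ m 0 0 i - x_ k 0 0 i) ^+ 2 <= e,
     (wd1 L (x_ m) 0 0 i - wd1 L (x_ k) 0 0 i) ^+ 2 <= e &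
     prim (fun t => (wd2 L (x_ m) t 0 i - wd2 L (x_ k) t 0 i) ^+ 2) L <= e].
  move=> /cx[N HN]; exists N => m k Nm Nk i; have := HN m k Nm Nk.
  rewrite ip_sub// => h.
  have [||| h1 h2 h3] := part (fun i => (x_ m 0 0 i - x_ k 0 0 i) ^+ 2)
     (fun i => (wd1 L (x_ m) 0 0 i - wd1 L (x_ k) 0 0 i) ^+ 2)
     (fun i => prim (fun t => (wd2 L (x_ m) t 0 i - wd2 L (x_ k) t 0 i) ^+ 2) L) i.
  - by move=> j; exact: sqr_ge0.
  - by move=> j; exact: sqr_ge0.
  - by move=> j; apply: prim_ge0 => t _; exact: sqr_ge0.
  by split; apply: le_trans h.
have ca i := sq_cauchy_cvg (fun e e0 => let: ex_intro N HN := cau e e0 in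
  ex_intro _ N (fun m k Nm Nk => let: And3 h _ _ := HN m k Nm Nk i in h)).
have cb i := sq_cauchy_cvg (fun e e0 => let: ex_intro N HN := cau e e0 in
  ex_intro _ N (fun m k Nm Nk => let: And3 _ h _ := HN m k Nm Nk i in h)).
have cg i := riesz_fischer L0' (fun m => d2_sqint i (Hx m))
  (fun e e0 => let: ex_intro N HN := cau e e0 in
  ex_intro _ N (fun m k Nm Nk => let: And3 _ _ h := HN m k Nm Nk i in h)).
have {ca}[a Ha] := choice ca; have {cb}[b Hb] := choice cb.
have {cg}[g Hg] := choice cg.
pose G t : 'rV[R]_n := \row_i g i t.
have G2 : L2 L G.
  apply/L2P => i; have [sg _] := Hg i; apply: eq_sqint sg => t _; by rewrite mxE.
pose w t : 'rV[R]_n := \row_i (b i + prim (fun s => G s 0 i) t).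
pose y t : 'rV[R]_n := \row_i (a i + prim (fun s => w s 0 i) t).
have wG : primitive_of L w G by move=> i t Dt; rewrite !mxE prim0 addr0.
have yw : primitive_of L y w by move=> i t Dt; rewrite !mxE prim0 addr0.
have [Hy dy ddy] := wd_H2 L0 G2 yw wG.
exists y; split => // e e0.
(* Three contributions for each of the [n] coordinates; [n.+1] instead of [n] covers the case
   [n = 0]. *)
have n0 : 0 < 3 * n.+1%:R :> R by rewrite mulr_gt0.
pose e' := e / (3 * n.+1%:R).
have e'0 : 0 < e' by rewrite divr_gt0.
have [N1 HN1] := finite_bound (fun i => Ha i e' e'0).
have [N2 HN2] := finite_bound (fun i => Hb i e' e'0).
have [N3 HN3] := finite_bound (fun i => (Hg i).2 e' e'0).
exists (maxn N1 (maxn N2 N3)) => m; rewrite !geq_max => /and3P[m1 m2 m3].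
rewrite ip_sub//; apply: (@le_trans _ _ (\sum_(i < n) (3 * e'))).
  apply: ler_sum => i _; have w00 : w 0 0 i = b i by rewrite mxE prim0 addr0.
  have y00 : y 0 0 i = a i by rewrite mxE prim0 addr0.
  rewrite (dy 0 zero_in_itv) w00 y00.
  have p3 : prim (fun t => (wd2 L (x_ m) t 0 i - wd2 L y t 0 i) ^+ 2) L =
      prim (fun t => (wd2 L (x_ m) t 0 i - g i t) ^+ 2) L.
    apply: ae_prim.
    - by have [] := sqintB (d2_sqint i (Hx m)) (d2_sqint i Hy).
    - by have [] := sqintB (d2_sqint i (Hx m)) (Hg i).1.
    - by apply: ae_imp (ddy i) => t h Dt; rewrite h// mxE.
  rewrite p3; have := HN1 m m1 i; have := HN2 m m2 i; have := HN3 m m3 i; lra.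
rewrite sumr_const card_ord -(mulr_natl _ n) /e'.
rewrite (_ : n%:R * (3 * (e / (3 * n.+1%:R))) = e * (n%:R / n.+1%:R)); last first.
  by field; rewrite nat1r pnatr_eq0.
by rewrite ler_piMr ?(ltW e0)// ler_pdivrMr// mul1r ler_nat.
Qed.

Lemma sq_add_le (a b : R) : (a + b) ^+ 2 <= 2 * a ^+ 2 + 2 * b ^+ 2.
Proof. by have := sqr_ge0 (a - b); rewrite sqrrB sqrrD; lra. Qed.

Lemma primitive_sq_bound u w i x : L2 L w -> primitive_of L u w -> 0 <= x <= L ->
  u x 0 i ^+ 2 <= 2 * u 0 0 i ^+ 2 + 2 * (L * prim (fun t => w t 0 i ^+ 2) L).
Proof.
move=> w2 uw /andP[x0 xL].
rewrite -{1}(subrKC (u 0 0 i) (u x 0 i)) (le_trans (sq_add_le _ _))// lerD2l.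
rewrite ler_pM2l// (le_trans (primitive_evalB i w2 uw (lexx 0) x0 xL))//.
rewrite subr0 ler_wpM2r//; apply: prim_ge0 => t _; exact: sqr_ge0.
Qed.

(** For every [t], [u 0] is [u t] minus an increment controlled by [w]; integrating over [t] bounds
    the value at 0 by L^2 norms. *)
Lemma primitive_sq_bound0 u w i : {within `[0, L], continuous u} ->
  L2 L w -> primitive_of L u w ->
  L * u 0 0 i ^+ 2 <= 2 * prim (fun t => u t 0 i ^+ 2) L +
    2 * L ^+ 2 * prim (fun t => w t 0 i ^+ 2) L.
Proof.
move=> /cts_rowP/(_ i)/cts_sqint[_ ui] w2 uw.
set W := prim (fun t => w t 0 i ^+ 2) L.
have := @le_prim _ L (fun=> u 0 0 i ^+ 2) (fun t => 2 * u t 0 i ^+ 2 + 2 * (L * W))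
  (int1_cst _ _) (int1D (int1Z 2 ui) (int1_cst _ _)).
rewrite (primD (int1Z 2 ui) (int1_cst L _)) (primZ 2 ui) !prim_cst//.
move=> h; suff : u 0 0 i ^+ 2 * L <= 2 * prim (fun t => u t 0 i ^+ 2) L + 2 * (L * W) * L.
  by lra.
apply: h => t /andP[t0 tL].
rewrite -{1}(subKr (u t 0 i) (u 0 0 i)) (le_trans (sq_add_le _ _))// lerD2l.
rewrite sqrrN ler_pM2l// (le_trans (primitive_evalB i w2 uw (lexx 0) t0 tL))//.
rewrite subr0 ler_wpM2r//; apply: prim_ge0 => s _; exact: sqr_ge0.
Qed.

(** [primitive_sq_bound] applied to u' gives [K1]; applied to u, with u'^2 bounded by [K1 * ip u u]
    under the integral, it gives [K2]. *)
Let K1 := 2 + 2 * L.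
Let K2 := 2 + 2 * L ^+ 2 * K1.

Lemma ip_part u i : u 0 0 i ^+ 2 + wd1 L u 0 0 i ^+ 2 +
  prim (fun t => wd2 L u t 0 i ^+ 2) L <= ip u u.
Proof.
rewrite /ip (bigD1 i)//= -!expr2; under [in leRHS]eq_prim => t _ do rewrite -expr2.
rewrite lerDl sumr_ge0// => j _; rewrite -!expr2 !addr_ge0 ?sqr_ge0//.
by apply: prim_ge0 => t _; rewrite -expr2 sqr_ge0.
Qed.

Lemma ip_eval_d1 u i x : H2 L u -> 0 <= x <= L -> wd1 L u x 0 i ^+ 2 <= K1 * ip u u.
Proof.
move=> Hu Dx; have [_ u2 _ uu] := H2_wd L0 Hu.
apply: le_trans (primitive_sq_bound i u2 uu Dx) _.
have := ip_part u i; have := sqr_ge0 (u 0 0 i); have := sqr_ge0 (wd1 L u 0 0 i).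
have : 0 <= prim (fun t => wd2 L u t 0 i ^+ 2) L.
  by apply: prim_ge0 => t _; exact: sqr_ge0.
rewrite /K1; move: (prim _ L) (ip u u) (u 0 0 i ^+ 2) (wd1 L u 0 0 i ^+ 2) => p q r s *.
nra.
Qed.

Lemma ip_eval u i x : H2 L u -> 0 <= x <= L -> u x 0 i ^+ 2 <= K2 * ip u u.
Proof.
move=> Hu Dx; have [cd _ uu _] := H2_wd L0 Hu.
have d12 := cts_L2 cd; have /L2P/(_ i)[_ di] := d12.
apply: le_trans (primitive_sq_bound i d12 uu Dx) _.
have : prim (fun t => wd1 L u t 0 i ^+ 2) L <= K1 * ip u u * L.
  rewrite -prim_cst//; apply: le_prim => //; first exact: int1_cst.
  by move=> t Dt; exact: ip_eval_d1.
have := ip_part u i; have := sqr_ge0 (u 0 0 i); have := sqr_ge0 (wd1 L u 0 0 i).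
have : 0 <= prim (fun t => wd2 L u t 0 i ^+ 2) L.
  by apply: prim_ge0 => t _; exact: sqr_ge0.
rewrite /K2; move: K1 (prim _ L) (prim _ L) => k p q q0 s0 r0 h h2.
have := ler_wpM2l L0' h2; lra.
Qed.

Lemma L2norm_sq f : L2 L f -> L2norm L f ^+ 2 = \sum_i prim (fun t => f t 0 i ^+ 2) L.
Proof.
move=> f2; rewrite /L2norm sqr_sqrtr; last first.
  by apply: Rintegral_ge0 => x _; exact: sqr_ge0.
rewrite -prim_sum => [|i]; last by move/L2P : f2 => /(_ i)[].
apply: eq_prim => t _; rewrite /enorm sqr_sqrtr; last first.
  by apply: sumr_ge0 => i _; rewrite -expr2 sqr_ge0.
by apply: eq_bigr => i _; rewrite expr2.
Qed.

Lemma H2norm_sq u : H2 L u -> H2norm L u ^+ 2 =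
  \sum_i prim (fun t => u t 0 i ^+ 2) L + \sum_i prim (fun t => wd1 L u t 0 i ^+ 2) L +
  \sum_i prim (fun t => wd2 L u t 0 i ^+ 2) L.
Proof.
move=> Hu; have [cu _] := Hu; have [cd d22 _ _] := H2_wd L0 Hu.
rewrite /H2norm wd1E wd2E sqr_sqrtr ?addr_ge0 ?sqr_ge0//.
exact: (congr2 +%R (congr2 +%R (L2norm_sq (cts_L2 cu)) (L2norm_sq (cts_L2 cd)))
  (L2norm_sq d22)).
Qed.

Lemma H2norm_le_ip : exists C, 0 < C /\ forall u, H2 L u ->
  H2norm L u ^+ 2 <= C * ip u u.
Proof.
have K10 : 0 <= K1 by rewrite addr_ge0// mulr_ge0.
have K20 : 0 <= K2 by rewrite addr_ge0// mulr_ge0// mulr_ge0// sqr_ge0.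
have arith (A B C a b q : R) : A <= K2 * q * L -> B <= K1 * q * L ->
    a + b + C <= q -> 0 <= a -> 0 <= b -> A + B + C <= (K2 * L + K1 * L + 1) * q.
  by move: K1 K2 => k1 k2 *; lra.
(* The last 1 keeps the constant positive for [n = 0]. *)
exists (n%:R * (K2 * L + K1 * L + 1) + 1); split.
  by rewrite ltr_wpDl// mulr_ge0// !addr_ge0// mulr_ge0.
move=> u Hu; rewrite H2norm_sq// -!big_split /=.
apply: (@le_trans _ _ (\sum_(i < n) (K2 * L + K1 * L + 1) * ip u u)).
  apply: ler_sum => i _; have [cu _] := Hu; have [cd d22 _ _] := H2_wd L0 Hu.
  have /L2P/(_ i)[_ ui] := cts_L2 cu; have /L2P/(_ i)[_ di] := cts_L2 cd.
  have h1 : prim (fun t => u t 0 i ^+ 2) L <= K2 * ip u u * L.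
    rewrite -prim_cst//; apply: le_prim => //; first exact: int1_cst.
    by move=> t Dt; exact: ip_eval.
  have h2 : prim (fun t => wd1 L u t 0 i ^+ 2) L <= K1 * ip u u * L.
    rewrite -prim_cst//; apply: le_prim => //; first exact: int1_cst.
    by move=> t Dt; exact: ip_eval_d1.
  exact: arith h1 h2 (ip_part u i) (sqr_ge0 _) (sqr_ge0 _).
rewrite sumr_const card_ord -[leLHS]mulr_natl.
by rewrite [leRHS]mulrDl mul1r [leLHS]mulrA lerDl ip_ge0.
Qed.

Lemma ip_le_H2norm : exists C, 0 < C /\ forall u, H2 L u ->
  ip u u <= C * H2norm L u ^+ 2.
Proof.
have arith (a b q r p : R) : L * a <= 2 * q + 2 * L ^+ 2 * r ->
    L * b <= 2 * r + 2 * L ^+ 2 * p -> 0 <= q -> 0 <= r -> 0 <= p ->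
    a + b + p <= (2 / L + 2 * L + 2 / L + 2 * L + 1) * (q + r + p).
  move=> h1 h2 q0 r0 p0'.
  have LV0 : 0 < L^-1 by rewrite invr_gt0.
  have {}h1 : a <= L^-1 * (2 * q) + 2 * L * r.
    rewrite -(ler_pM2l L0) (_ : L * (_ + _) = 2 * q + 2 * L ^+ 2 * r)//.
    by field; rewrite gt_eqF.
  have {}h2 : b <= L^-1 * (2 * r) + 2 * L * p.
    rewrite -(ler_pM2l L0) (_ : L * (_ + _) = 2 * r + 2 * L ^+ 2 * p)//.
    by field; rewrite gt_eqF.
  have := mulr_ge0 (ltW LV0) q0; have := mulr_ge0 (ltW LV0) r0.
  have := mulr_ge0 (ltW LV0) p0'.
  have := mulr_ge0 L0' q0; have := mulr_ge0 L0' r0; have := mulr_ge0 L0' p0'.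
  by lra.
exists (2 / L + 2 * L + 2 / L + 2 * L + 1); split.
  by rewrite ltr_wpDl// !addr_ge0// ?divr_ge0// mulr_ge0.
move=> u Hu; rewrite H2norm_sq// -!big_split /= mulr_sumr.
apply: ler_sum => i _; have [cu _] := Hu; have [cd d22 ud du] := H2_wd L0 Hu.
have h1 := primitive_sq_bound0 i cu (cts_L2 cd) ud.
have h2 := primitive_sq_bound0 i cd d22 du.
have p0 f : 0 <= prim (fun t => f t 0 i ^+ 2) L.
  by apply: prim_ge0 => t _; exact: sqr_ge0.
rewrite -!expr2; under [in leLHS]eq_prim => t _ do rewrite -expr2.
exact: arith h1 h2 (p0 u) (p0 (wd1 L u)) (p0 (wd2 L u)).
Qed.

Lemma bounded_linear_of_ip (F : (R -> 'rV[R]_n) -> R) C :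
  (forall (a : R) u v, H2 L u -> H2 L v -> F (a *: u + v) = a * F u + F v) ->
  (forall u, H2 L u -> F u ^+ 2 <= C * ip u u) ->
  bounded_linear L (fun y : R^o => `|y|) F.
Proof.
move=> Flin FC; split; first exact: Flin.
have [C' [C'0 HC']] := ip_le_H2norm.
exists (Num.sqrt (`|C| * C')) => u Hu.
rewrite -ler_sqr ?nnegrE ?mulr_ge0 ?sqrtr_ge0// real_normK ?num_real//.
rewrite exprMn sqr_sqrtr ?mulr_ge0 ?(ltW C'0)//.
apply: le_trans (FC u Hu) _.
apply: (@le_trans _ _ (`|C| * ip u u)); first by rewrite ler_wpM2r ?ip_ge0// ler_norm.
by rewrite -mulrA ler_wpM2l// HC'.
Qed.

Theorem H2_weak_compactness (u_ : nat -> R -> 'rV[R]_n) M :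
  (forall k, H2 L (u_ k)) -> (forall k, ip (u_ k) (u_ k) <= M) ->
  exists u (sigma : nat -> nat), [/\ H2 L u, {homo sigma : i j / (i < j)%N} &
    weak_cvg L (fun k => u_ (sigma k)) u].
Proof.
move=> Hu uM.
have [||||u [sigma [H1 H2' H3]]] := @weak_compactness R _ (H2 L) ip _ _ _ _ ip_complete u_ M Hu uM.
- by move=> a u v Hu' Hv; case: (H2_wd_lin L0 a Hu' Hv).
- exact: ip_lin.
- by move=> u v _ _; exact: ip_sym.
- by move=> u _; exact: ip_ge0.
exists u, sigma; split => // F [Flin [C HC]].
have [C' [C'0 HC']] := H2norm_le_ip.
apply: (H3 F (C ^+ 2 * C')); first exact: Flin.
move=> v Hv; have := HC v Hv => h.
rewrite -[leLHS]real_normK ?num_real//.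
apply: (@le_trans _ _ ((C * H2norm L v) ^+ 2)).
  by rewrite ler_sqr ?nnegrE// (le_trans _ h).
by rewrite exprMn -mulrA ler_wpM2l ?sqr_ge0// HC'.
Qed.

End H2Space.

(** * Cubic Hermite elements *)

Section Partition.
Context {R : realType}.
Local Notation mu := (@lebesgue_measure R).
Implicit Types (x y z t : R) (p q : {poly R}).

Lemma horner_cts (p : {poly R}) : continuous (fun x => p.[x]).
Proof. exact: continuous_horner. Qed.

Lemma prim_horner p x : 0 <= x -> prim (fun t => p^`().[t]) x = p.[x] - p.[0].
Proof.
move=> x0; have E : (fun t => p^`().[t]) = derive1 (horner p) by exact: derivE.
have c : continuous (derive1 (horner p)) by rewrite -E; exact: horner_cts.
have d y : derivable (horner p) y 1 by exact: derivable_horner.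
apply: etrans (ftc2_prim x0 d c); exact: (congr1 (fun f => prim f x) E).
Qed.

Lemma horner_int1 x p : int1 x (fun t => p.[t]).
Proof. by apply: cts_int1; apply: cts_within; exact: horner_cts. Qed.

Lemma prim_sub_oo L f a b : int1 L f -> 0 <= a -> a <= b -> b <= L ->
  prim f b - prim f a = \int[mu]_(x in `]a, b[) f x.
Proof.
move=> fi a0 ab bL; rewrite (prim_sub fi)// Rintegral_itv_bndo_bndc//.
apply: integrableS fi => // x /=; rewrite !in_itv /= => /andP[ax xb].
by rewrite (le_trans a0 (ltW ax)) (le_trans (ltW xb)).
Qed.

Lemma le_prim_sub_oo L (f g : R -> R) a b : int1 L f -> int1 L g ->
  0 <= a -> a <= b -> b <= L -> (forall t, a < t < b -> f t <= g t) ->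
  prim f b - prim f a <= prim g b - prim g a.
Proof.
move=> fi gi a0 ab bL fg; rewrite (prim_sub_oo fi)// (prim_sub_oo gi)//.
have s : `]a, b[ `<=` `[0, L].
  move=> x /=; rewrite !in_itv /= => /andP[ax xb].
  by rewrite (le_trans a0 (ltW ax)) (le_trans (ltW xb)).
have fi' : mu.-integrable `]a, b[ (EFin \o f) by exact: integrableS fi.
have gi' : mu.-integrable `]a, b[ (EFin \o g) by exact: integrableS gi.
by apply: le_Rintegral => // x /=; rewrite in_itv; exact: fg.
Qed.

Lemma prim_sub_horner L f p a b : int1 L f -> 0 <= a -> a <= b -> b <= L ->
  (forall x, a < x < b -> f x = p^`().[x]) -> prim f b - prim f a = p.[b] - p.[a].
Proof.
move=> fi a0 ab bL fp; have b0 := le_trans a0 ab.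
have E := congr2 (fun x y => x - y) (prim_horner p b0) (prim_horner p a0).
transitivity (prim (fun t => p^`().[t]) b - prim (fun t => p^`().[t]) a).
  apply: etrans (prim_sub_oo fi a0 ab bL) _.
  apply: etrans _ (esym (prim_sub_oo (horner_int1 b _) a0 ab (lexx b))).
  by apply: eq_Rintegral => x; rewrite inE /= in_itv; exact: fp.
by apply: etrans E _; ring.
Qed.

Variables (L : R) (s : seq R).
Hypotheses (L0 : 0 < L) (sP : itv_partition 0 L s).

Lemma node0 : node s 0 = 0. Proof. by []. Qed.

Lemma node_size : node s (size s) = L.
Proof.
case: sP => _ /eqP <-; rewrite /node.
by rewrite -[size s]/((size (0 :: s)).-1) nth_last.
Qed.

Lemma size_gt0 : (0 < size s)%N.
Proof.
rewrite lt0n; apply/negP => /eqP s0; have := node_size; rewrite s0 node0 => L'.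
by move: L0; rewrite -L' ltxx.
Qed.

Lemma node_ltS j : (j < size s)%N -> node s j < node s j.+1.
Proof. by case: sP => /(pathP 0) h _; exact: h. Qed.

Lemma node_le j k : (j <= k)%N -> (k <= size s)%N -> node s j <= node s k.
Proof.
elim: k => [|k IH]; first by rewrite leqn0 => /eqP ->.
rewrite leq_eqVlt => /predU1P[->//|]; rewrite ltnS => jk ks.
exact: le_trans (IH jk (ltnW ks)) (ltW (node_ltS ks)).
Qed.

Lemma node_ge0 j : (j <= size s)%N -> 0 <= node s j.
Proof. by move=> js; rewrite -node0 node_le. Qed.

Lemma node_leL j : (j <= size s)%N -> node s j <= L.
Proof. by move=> js; rewrite -node_size node_le. Qed.

Lemma node_itv j : (j <= size s)%N -> 0 <= node s j <= L.
Proof. by move=> js; rewrite node_ge0// node_leL. Qed.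

Lemma mesh_ge j : (j < size s)%N -> node s j.+1 - node s j <= mesh s.
Proof.
move=> js; apply: le_trans (ler_norm _) _.
exact: (le_bigmax _ (fun j : 'I_(size s) => `|node s j.+1 - node s j|) (Ordinal js)).
Qed.

Lemma mesh_ge0 : 0 <= mesh s.
Proof. exact: bigmax_ge_id. Qed.

Lemma locate x : 0 <= x <= L ->
  exists j, (j < size s)%N /\ node s j <= x <= node s j.+1.
Proof.
move=> /andP[x0 xL].
suff H k : (k <= size s)%N -> x <= node s k -> (0 < k)%N ->
    exists j, (j < size s)%N /\ node s j <= x <= node s j.+1.
  by apply: (H (size s)); rewrite ?node_size// size_gt0.
elim: k => // k IH ks xk _; have [kx|xk'] := leP (node s k) x.
  by exists k; rewrite kx xk.
apply: IH; [exact: ltnW|exact: ltW|].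
by rewrite lt0n; apply/negP => /eqP k0; move: xk'; rewrite k0 node0 ltNge x0.
Qed.

(* Neighbouring pieces agree at their common node, so either may be used there. *)
Lemma piecewise_function (P : nat -> R -> R) (val : R -> R) :
  (forall j, (j < size s)%N -> P j (node s j) = val (node s j)) ->
  (forall j, (j < size s)%N -> P j (node s j.+1) = val (node s j.+1)) ->
  exists F : R -> R, forall j, (j < size s)%N ->
    forall x, node s j <= x <= node s j.+1 -> F x = P j x.
Proof.
move=> Pl Pr.
suff /choice[F HF] : forall x, exists y, forall j, (j < size s)%N ->
    node s j <= x <= node s j.+1 -> y = P j x.
  by exists F => j js x; exact: HF.
move=> x; have [[j [js jx]]|nj] := pselect (exists j, (j < size s)%N /\
    node s j <= x <= node s j.+1); last first.
  by exists 0 => j js jx; exfalso; apply: nj; exists j.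
exists (P j x) => k ks kx.
have cons i m : (i < m)%N -> (m < size s)%N -> node s i <= x <= node s i.+1 ->
    node s m <= x <= node s m.+1 -> P i x = P m x.
  move=> im ms /andP[_ xi] /andP[mx _].
  have h := node_le im (ltnW ms).
  have e1 : x = node s i.+1 by apply/eqP; rewrite eq_le xi (le_trans h).
  have e2 : x = node s m by apply/eqP; rewrite eq_le mx (le_trans xi).
  by rewrite {1}e1 Pr ?(ltn_trans im)// -e1 {1 2}e2 Pl.
have [jk|kj|<-//] := ltngtP j k; first exact: cons.
by apply/esym; exact: cons.
Qed.

(** The fundamental theorem on each element telescopes, because the formula for [F] holds up to both
    ends of the element. The values of [k] at the nodes are left free: they affect neither the
    integrals nor the boundedness. *)
Lemma piecewise_primitive (F k : R -> R) (P : nat -> {poly R}) :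
  (forall j, (j < size s)%N -> forall x, node s j <= x <= node s j.+1 ->
     F x = (P j).[x]) ->
  (forall j, (j < size s)%N -> forall x, node s j < x < node s j.+1 ->
     k x = (P j)^`().[x]) ->
  sqint L k /\ forall x, 0 <= x <= L -> F x = F 0 + prim k x.
Proof.
move=> FP kP.
have mb j : (j <= size s)%N -> measurable_fun `[0, node s j] k /\
    exists M : R, forall x, 0 <= x <= node s j -> `|k x| <= M.
  elim: j => [_|j IH js].
    rewrite node0 set_itv1; split; first exact: measurable_fun_set1.
    by exists `|k 0| => x; rewrite -eq_le => /eqP <-.
  have [mk [M HM]] := IH (ltnW js).
  have jj := node_ltS js; have j0 := node_ge0 (ltnW js).
  split.
    rewrite (_ : `[0, node s j.+1]%classic = `[0, node s j] `|` `[node s j, node s j.+1]).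
      apply/measurable_funU => //; split => //.
      apply: (@measurable_fun_itv_cc _ _ _ false true).
      apply: (@eq_measurable_fun _ _ _ _ _ (fun x => (P j)^`().[x])).
        by move=> x; rewrite inE /= in_itv /= => /(kP j js).
      apply: measurable_funTS; apply: continuous_measurable_fun; exact: horner_cts.
    apply/seteqP; split=> x /=; rewrite !in_itv /=.
      by move=> /andP[-> xj]; have [?|/ltW ?] := leP x (node s j); [left|right; apply/andP].
    move=> [/andP[-> xj]|/andP[jx ->]]; first by rewrite (le_trans xj)// ltW.
    by rewrite (le_trans j0 jx).
  have [M' HM'] := cts_bounded (cts_within (L := node s j.+1) (@horner_cts (P j)^`())).
  exists (Num.max M (Num.max M' `|k (node s j.+1)|)) => x /andP[x0 xj].
  rewrite !le_max; have [xj'|jx] := leP x (node s j); first by rewrite HM ?x0.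
  move: xj; rewrite le_eqVlt => /predU1P[->|xj]; first by rewrite lexx !orbT.
  by rewrite (kP j js) ?jx ?xj// HM' ?orbT// x0 ltW.
have [mk [M HM]] := mb _ (leqnn _); rewrite node_size in mk HM.
have ks : sqint L k.
  by apply: (@sqint_bounded _ _ M) => // x /=; rewrite in_itv; exact: HM.
have ki := sqint_int1 ks; split => //.
have step j : (j <= size s)%N -> F (node s j) = F 0 + prim k (node s j).
  elim: j => [_|j IH js]; first by rewrite node0 prim0 addr0.
  have := prim_sub_horner ki (node_ge0 (ltnW js)) (ltW (node_ltS js)) (node_leL js) (kP j js).
  rewrite -!(FP j js) ?lexx ?(ltW (node_ltS js))// (IH (ltnW js)); lra.
move=> x /locate[j [js /andP[jx xj]]].
have xL := le_trans xj (node_leL js).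
have hx t : node s j < t < x -> k t = (P j)^`().[t].
  by move=> /andP[jt tx]; apply: kP => //; rewrite jt (lt_le_trans tx).
have := prim_sub_horner ki (node_ge0 (ltnW js)) jx xL hx.
rewrite -!(FP j js) ?lexx ?jx ?xj ?(ltW (node_ltS js))// (step j (ltnW js)); lra.
Qed.

Lemma eq_on_closure (f : R -> R) p a b : {within `[0, L], continuous f} ->
  0 <= a -> a < b -> b <= L -> (forall x, a < x < b -> f x = p.[x]) ->
  forall x, a <= x <= b -> f x = p.[x].
Proof.
move=> cf a0 ab bL fp x /andP[ax xb]; apply/eqP; rewrite -subr_eq0 -normr_eq0.
rewrite eq_le normr_ge0 andbT; apply/ler_addgt0Pl => e e0; rewrite addr0.
have ch : {within `[0, L], continuous (fun t => f t - p.[t] : R)}.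
  by move=> t; apply: cvgB; [exact: cf|exact: (@cts_within _ L _ (@horner_cts p) t)].
have x01 : 0 <= x <= L by rewrite (le_trans a0)//= (le_trans xb).
have [d [d0 Hd]] := (cts_epsP L _).1 ch x x01 e e0.
(* Moving [x] towards the midpoint lands strictly inside the interval even from an endpoint, at a
   distance below [d]. *)
pose th := Num.min 2^-1 (d / (b - a)); pose y := x + th * ((a + b) / 2 - x).
have ba : 0 < b - a by rewrite subr_gt0.
have th0 : 0 < th by rewrite lt_min invr_gt0 ltr0n divr_gt0.
have th1 : th <= 2^-1 by rewrite ge_min lexx.
have thd : th * (b - a) <= d by rewrite -ler_pdivlMr// ge_min lexx orbT.
have ay : a < y by rewrite /y; nra.
have yb : y < b by rewrite /y; nra.
have y01 : 0 <= y <= L by rewrite (le_trans a0 (ltW ay)) (le_trans (ltW yb)).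
have yx : `|y - x| < d by rewrite /y ltr_norml; apply/andP; split; nra.
have := Hd y y01 yx; rewrite fp ?ay// subrr sub0r normrN; exact: ltW.
Qed.

End Partition.

Section FiniteElementsH2.
Context {R : realType} (n : nat) (L : R) (s : seq R).
Hypotheses (L0 : 0 < L) (sP : itv_partition 0 L s).
Implicit Types (v w : R -> 'rV[R]_n).

Lemma is_derive_coord v w x i : is_derive x (1 : R) v (w x) ->
  is_derive x (1 : R) (fun t => v t 0 i) (w x 0 i).
Proof.
move=> [dv <-]; apply: DeriveDef; first exact: (derivable_mxP _ _ _).1.
by rewrite derive_mx// mxE.
Qed.

(** The continuous derivative [g] agrees with the derivatives of the pieces inside the elements and
    then, by continuity, at the nodes. So [g] is again a continuous piecewise polynomial, with
    square integrable elementwise derivative. *)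
Lemma FE_H2 v : FE_space L s v ->
  exists w k, [/\ L2 L k, primitive_of L v w & primitive_of L w k].
Proof.
move=> [[cv [g [cg dg]]] vP].
have [P HP] : exists P : 'I_n -> nat -> {poly R}, forall i j, (j < size s)%N ->
    forall x, node s j <= x <= node s j.+1 -> v x 0 i = (P i j).[x].
  have h i j : exists p : {poly R}, (j < size s)%N ->
      forall x, node s j <= x <= node s j.+1 -> v x 0 i = p.[x].
    have [js|js] := boolP (j < size s)%N; last by exists 0.
    by have [p [_ hp]] := vP j js i; exists p.
  have h' i : exists p : nat -> {poly R}, forall j, (j < size s)%N ->
      forall x, node s j <= x <= node s j.+1 -> v x 0 i = (p j).[x].
    by have [p Hp] := choice (h i); exists p.
  by have [P HP] := choice h'; exists P.
have gP i j : (j < size s)%N -> forall x, node s j < x < node s j.+1 ->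
    g x 0 i = (P i j)^`().[x].
  move=> js x /andP[jx xj].
  have j0 := node_ge0 sP (ltnW js); have jL := node_leL sP js.
  have x01 : 0 < x < L by rewrite (le_lt_trans j0 jx) (lt_le_trans xj jL).
  have [dv gx] := is_derive_coord i (dg x x01).
  rewrite -gx derivE derive1E; apply: near_eq_derive; near=> y.
  by apply: HP => //; apply/andP; split; apply: ltW; near: y; [exact: lt_nbhsr|exact: lt_nbhsl].
have gPc i j : (j < size s)%N -> forall x, node s j <= x <= node s j.+1 ->
    g x 0 i = (P i j)^`().[x].
  move=> js; apply: (@eq_on_closure _ L) => //.
  - by move/cts_rowP : cg; exact.
  - by have := node_ge0 sP (ltnW js).
  - by have := node_ltS sP js.
  - by have := node_leL sP js.
  - exact: gP.
(* At the nodes [g] may have a kink and this value is arbitrary; [piecewise_primitive] asks only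
   about the open elements. *)
pose k x : 'rV[R]_n := \row_i 'D_1 (fun t => g t 0 i) x.
have kP i j : (j < size s)%N -> forall x, node s j < x < node s j.+1 ->
    k x 0 i = (P i j)^`()^`().[x].
  move=> js x /andP[jx xj]; rewrite mxE derivE derive1E; apply: near_eq_derive; near=> y.
  by apply: gPc => //; apply/andP; split; apply: ltW; near: y; [exact: lt_nbhsr|exact: lt_nbhsl].
exists g, k; split.
- apply/L2P => i.
  by have [] := piecewise_primitive L0 sP (gPc i) (kP i).
- move=> i x Dx.
  by have [_ ->] := piecewise_primitive L0 sP (HP i) (gP i).
- move=> i x Dx.
  by have [_ ->] := piecewise_primitive L0 sP (gPc i) (kP i).
Unshelve. all: by end_near. Qed.

End FiniteElementsH2.

(** * Cubic Hermite interpolation and best approximation on elements *)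

Section Hermite.
Context {R : realType}.
Implicit Types (x y z t a b : R) (p q r : {poly R}).

Lemma size_horner_step r z a k : (size r <= k)%N ->
  (size (r * ('X - z%:P) + a%:P)%R <= k.+1)%N.
Proof.
move=> rk; rewrite (leq_trans (size_polyD _ _))// geq_max; apply/andP; split.
  by rewrite (leq_trans (size_polyMleq _ _))// size_XsubC addn2 /= ltnS.
by rewrite (leq_trans (size_polyC_leq1 _)).
Qed.

Lemma hermite_cubic z z' a a' b b' : z < z' -> exists p, [/\ (size p <= 4)%N,
  p.[z] = a, p.[z'] = a', p^`().[z] = b & p^`().[z'] = b'].
Proof.
move=> zz'; have h0 : z' - z != 0 by rewrite subr_eq0 gt_eqF.
(* In powers of [X - z] the first two coefficients are [a] and [b]; [c] and [d] solve the two linear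
   equations given by value and slope at [z']. *)
pose d := (b + b') / (z' - z) ^+ 2 - 2 * (a' - a) / (z' - z) ^+ 3.
pose c := 3 * (a' - a) / (z' - z) ^+ 2 - (2 * b + b') / (z' - z).
pose hE := (hornerD, hornerN, hornerM, hornerC, hornerX).
exists (((d%:P * ('X - z%:P) + c%:P) * ('X - z%:P) + b%:P) * ('X - z%:P) + a%:P).
split.
- by do 3 apply: size_horner_step; exact: size_polyC_leq1.
- by rewrite !hE; ring.
- by rewrite !hE /c /d; field.
- by rewrite !(derivD, derivN, derivM, derivX, derivC) !hE; ring.
- by rewrite !(derivD, derivN, derivM, derivX, derivC) !hE /c /d; field.
Qed.

Lemma size_deriv_leq p k : (size p <= k.+1)%N -> (size p^`() <= k)%N.
Proof.
have [->|p0 pk] := eqVneq p 0; first by rewrite deriv0 size_poly0.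
by rewrite -ltnS (leq_trans (lt_size_deriv p0)).
Qed.

Lemma second_deriv_affine p : (size p <= 4)%N ->
  exists a b, forall x, p^`()^`().[x] = a + b * x.
Proof.
move=> p4; have p2 : (size p^`()^`() <= 2)%N by do 2 apply: size_deriv_leq.
exists p^`()^`()`_0, p^`()^`()`_1 => x; rewrite (horner_coef_wide _ p2).
by rewrite big_ord_recr big_ord1 /= expr0 mulr1 expr1.
Qed.

Variables (n : nat) (L : R) (s : seq R).
Hypotheses (L0 : 0 < L) (sP : itv_partition 0 L s).
Implicit Types (u v w k : R -> 'rV[R]_n).

Lemma primitive_is_derive v w x : {within `[0, L], continuous w} ->
  primitive_of L v w -> 0 < x < L -> is_derive x (1 : R) v (w x).
Proof.
move=> /cts_rowP cw vw /andP[x0 xL].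
have dv i : is_derive x (1 : R) (fun t => v t 0 i) (w x 0 i).
  have /(continuous_within_itvP _ L0)[cwx _ _] := cw i.
  have xin : x \in `]0, L[ by rewrite in_itv /= x0.
  have [d1' d2'] := continuous_FTC1_closed xL (cts_int1 (cw i)) x0 (cwx x xin).
  have dp : is_derive x (1 : R) (prim (fun t => w t 0 i)) (w x 0 i).
    by apply: DeriveDef; [exact: d1'|rewrite -derive1E; exact: d2'].
  have dc : is_derive x (1 : R) (cst (v 0 0 i) : R -> R) 0 by exact: is_derive_cst.
  have := is_deriveD dc dp; rewrite add0r; apply: near_eq_is_derive; near=> y.
  have y01 : 0 <= y <= L.
    by apply/andP; split; apply: ltW; near: y; [exact: lt_nbhsr|exact: lt_nbhsl].
  exact: esym (vw i y y01).
have ddv : derivable v x (1 : R).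
  by apply/derivable_mxP => i j; rewrite ord1; case: (dv j).
apply: DeriveDef => //; rewrite derive_mx//; apply/rowP => i.
by rewrite mxE; case: (dv i).
Unshelve. all: by end_near. Qed.

Lemma hermite_interpolant u : exists v w k, [/\ FE_space L s v,
  L2 L k /\ (primitive_of L v w /\ primitive_of L w k),
  forall j, (j <= size s)%N -> v (node s j) = u (node s j),
  forall j, (j <= size s)%N -> w (node s j) = wd1 L u (node s j) &
  forall i j, (j < size s)%N -> exists a b, forall x,
    node s j < x < node s j.+1 -> k x 0 i = a + b * x].
Proof.
pose u' := wd1 L u.
have [P HP] : exists P : 'I_n -> nat -> {poly R}, forall i j, (j < size s)%N ->
    [/\ (size (P i j) <= 4)%N, (P i j).[node s j] = u (node s j) 0 i,
      (P i j).[node s j.+1] = u (node s j.+1) 0 i,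
      (P i j)^`().[node s j] = u' (node s j) 0 i &
      (P i j)^`().[node s j.+1] = u' (node s j.+1) 0 i].
  have h i j : exists p : {poly R}, (j < size s)%N ->
      [/\ (size p <= 4)%N, p.[node s j] = u (node s j) 0 i,
      p.[node s j.+1] = u (node s j.+1) 0 i,
      p^`().[node s j] = u' (node s j) 0 i &
      p^`().[node s j.+1] = u' (node s j.+1) 0 i].
    have [js|js] := boolP (j < size s)%N; last by exists 0.
    have [p hp] := hermite_cubic (u (node s j) 0 i) (u (node s j.+1) 0 i)
      (u' (node s j) 0 i) (u' (node s j.+1) 0 i) (node_ltS sP js).
    by exists p.
  have h' i : {p : nat -> {poly R} & _} := choice (h i).
  by exists (fun i => projT1 (h' i)) => i j; exact: (projT2 (h' i)).
have exF i : exists F : R -> R, forall j, (j < size s)%N ->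
    forall x, node s j <= x <= node s j.+1 -> F x = (P i j).[x].
  apply: (@piecewise_function _ L s sP (fun j x => (P i j).[x]) (fun x => u x 0 i)).
    by move=> j /(HP i)[].
  by move=> j /(HP i)[].
have exW i : exists F : R -> R, forall j, (j < size s)%N ->
    forall x, node s j <= x <= node s j.+1 -> F x = (P i j)^`().[x].
  apply: (@piecewise_function _ L s sP (fun j x => (P i j)^`().[x]) (fun x => u' x 0 i)).
    by move=> j /(HP i)[].
  by move=> j /(HP i)[].
have [F HF] := choice exF; have [W HW] := choice exW.
pose v x : 'rV[R]_n := \row_i F i x; pose w x : 'rV[R]_n := \row_i W i x.
pose k x : 'rV[R]_n := \row_i 'D_1 (W i) x.
have vP i j : (j < size s)%N -> forall x, node s j <= x <= node s j.+1 ->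
    v x 0 i = (P i j).[x] by move=> js x jx; rewrite mxE (HF i j).
have wP i j : (j < size s)%N -> forall x, node s j <= x <= node s j.+1 ->
    w x 0 i = (P i j)^`().[x] by move=> js x jx; rewrite mxE (HW i j).
have wP' i j : (j < size s)%N -> forall x, node s j < x < node s j.+1 ->
    w x 0 i = (P i j)^`().[x].
  by move=> js x /andP[jx xj]; apply: wP => //; rewrite !ltW.
have kP i j : (j < size s)%N -> forall x, node s j < x < node s j.+1 ->
    k x 0 i = (P i j)^`()^`().[x].
  move=> js x /andP[jx xj]; rewrite mxE derivE derive1E; apply: near_eq_derive; near=> y.
  by apply: (HW i j js); apply/andP; split; apply: ltW; near: y; [exact: lt_nbhsr|exact: lt_nbhsl].
have k2 : L2 L k.
  by apply/L2P => i; have [] := piecewise_primitive L0 sP (wP i) (kP i).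
have vw : primitive_of L v w.
  by move=> i x Dx; have [_ ->] := piecewise_primitive L0 sP (vP i) (wP' i).
have wk : primitive_of L w k.
  by move=> i x Dx; have [_ ->] := piecewise_primitive L0 sP (wP i) (kP i).
have ki i : int1 L (fun t => k t 0 i) by exact: L2_int1.
have cw := primitive_cts ki wk.
have wi i : int1 L (fun t => w t 0 i) by apply: L2_int1; exact: cts_L2.
have cv := primitive_cts wi vw.
(* Every node but the last is the left end of an element; the last one is only a right end. *)
have last_le j : (j <= size s)%N -> exists j', (j' < size s)%N /\
    (j = j' \/ j = j'.+1).
  rewrite leq_eqVlt => /predU1P[->|js]; last by exists j; split => //; left.
  exists (size s).-1; have := size_gt0 L0 sP; case: (size s) => // m _.
  by split => //; right.
exists v, w, k; split => //.
- split.
    split => //; exists w; split => // x Dx.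
    exact: primitive_is_derive.
  move=> j js i; exists (P i j); split; first by case: (HP i j js).
  exact: vP.
- move=> j js; apply/rowP => i; have [j' [js' jj]] := last_le j js.
  have lt := ltW (node_ltS sP js'); have [_ p1 p2 _ _] := HP i j' js'.
  by case: jj => ->; rewrite (vP i j' js') ?lexx ?lt.
- move=> j js; apply/rowP => i; have [j' [js' jj]] := last_le j js.
  have lt := ltW (node_ltS sP js'); have [_ _ _ p1 p2] := HP i j' js'.
  by case: jj => ->; rewrite (wP i j' js') ?lexx ?lt.
- move=> i j js; have [p4 _ _ _ _] := HP i j js.
  have [a [b ab]] := second_deriv_affine p4.
  by exists a, b => x jx; rewrite (kP i j js).
Unshelve. all: by end_near. Qed.

(* [q] is orthogonal to the functions which are affine on each element, hence
   its norm on an element is at most that of any [f] such that [f - q] is affine there. *)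
Lemma elementwise_best_approximation (q f kappa m : R -> R) :
  sqint L q -> sqint L f -> sqint L m -> {within `[0, L], continuous kappa} ->
  (forall x, 0 <= x <= L -> kappa x = kappa 0 + prim m x) ->
  (forall j, (j <= size s)%N -> prim q (node s j) = 0) ->
  (forall j, (j <= size s)%N -> prim (prim q) (node s j) = 0) ->
  (forall j, (j < size s)%N -> exists a b, forall x,
     node s j < x < node s j.+1 -> f x - q x = a + b * x) ->
  prim (fun t => q t ^+ 2) L <= 2 * prim (fun t => (f t - kappa t) ^+ 2) L +
    2 * (mesh s * prim (fun t => m t ^+ 2) L) * L.
Proof.
move=> qs fs ms ck kE q0 qq0 aff.
have qi := sqint_int1 qs.
have qpi : int1 L (prim q) by apply: cts_int1; exact: prim_cts.
have idc : {within `[0, L], continuous (fun t : R => t)}.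
  by apply: cts_within => t; exact: cvg_id.
have ids : sqint L (fun t => t) by exact: cts_sqint.
have qti : int1 L (fun t => q t * t) by exact: sqint_int1M.
(* Integrating by parts against [t = prim 1], the first moment up to a node [z] is
   [z * prim q z - prim (prim q) z], and both terms vanish. *)
have orth j : (j <= size s)%N -> prim (fun t => q t * t) (node s j) = 0.
  move=> js; have z0 := node_ge0 sP js; have zL := node_leL sP js.
  have := integration_by_parts_prim z0 (int1_sub zL qi) (int1_cst (node s j) 1).
  rewrite (@eq_prim _ _ (fun x => q x * prim (fun=> 1) x) (fun t => q t * t)).
    move=> ->; rewrite (q0 _ js) mul0r (@eq_prim _ _ _ (prim q)) ?qq0 ?subr0//.
    by move=> t _; rewrite mul1r.
  by move=> t /andP[t0 _]; rewrite prim_cst// mul1r.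
pose M := prim (fun t => m t ^+ 2) L.
have M0 : 0 <= M by apply: prim_ge0 => t _; exact: sqr_ge0.
have fks : sqint L (fun t => f t - kappa t).
  by apply: sqintB => //; exact: cts_sqint.
have main j : (j <= size s)%N -> prim (fun t => q t ^+ 2) (node s j) <=
    2 * prim (fun t => (f t - kappa t) ^+ 2) (node s j) + 2 * (mesh s * M) * node s j.
  elim: j => [|j IH js]; first by rewrite !prim0 !mulr0 addr0.
  have {}IH := IH (ltnW js).
  set a := node s j in IH *; set b := node s j.+1.
  have a0 : 0 <= a by have := node_ge0 sP (ltnW js).
  have ab : a < b by have := node_ltS sP js.
  have bL : b <= L by have := node_leL sP js.
  have b0 := le_trans a0 (ltW ab); have aL := le_trans (ltW ab) bL.
  have [al [be fq]] := aff j js.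
  pose c := kappa a.
  have i1 := qs.2; have i2 := int1Z (2 * (al - c)) qi; have i3 := int1Z (2 * be) qti.
  have i12 := int1D (int1D i1 i2) i3.
  have i4 := int1D (int1Z 2 fks.2) (int1_cst L (2 * (mesh s * M))).
  (* Adding [2 (al - c) q + 2 be q t] to [q ^ 2] does not change its integral between nodes. Since
     [f - q = al + be t], the sum is [(f - c) ^ 2 - (al - c + be t) ^ 2], hence at most
     [2 (f - kappa) ^ 2 + 2 (kappa - c) ^ 2]; as [c = kappa a], the last square is bounded by
     [prim_incr_sq]. *)
  have E z : 0 <= z -> z <= L -> prim q z = 0 -> prim (fun t => q t * t) z = 0 ->
      prim (fun t => q t ^+ 2 + 2 * (al - c) * q t + 2 * be * (q t * t)) z =
      prim (fun t => q t ^+ 2) z.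
    move=> z0 zL e1 e2; rewrite (primD (int1_sub zL (int1D i1 i2)) (int1_sub zL i3)).
    rewrite (primD (int1_sub zL i1) (int1_sub zL i2)).
    rewrite (primZ _ (int1_sub zL qi)) (primZ _ (int1_sub zL qti)) e1 e2.
    by rewrite !mulr0 !addr0.
  have E' z : 0 <= z -> z <= L ->
      prim (fun t => 2 * (f t - kappa t) ^+ 2 + 2 * (mesh s * M)) z =
      2 * prim (fun t => (f t - kappa t) ^+ 2) z + 2 * (mesh s * M) * z.
    move=> z0 zL; rewrite (primD (int1_sub zL (int1Z 2 fks.2)) (int1_cst z _)).
    by rewrite (primZ _ (int1_sub zL fks.2)) prim_cst.
  have := le_prim_sub_oo i12 i4 a0 (ltW ab) bL.
  rewrite !E ?E' ?q0 ?orth//; try exact: ltnW.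
  move=> H; suff : prim (fun t => q t ^+ 2) b - prim (fun t => q t ^+ 2) a <=
      2 * prim (fun t => (f t - kappa t) ^+ 2) b + 2 * (mesh s * M) * b -
      (2 * prim (fun t => (f t - kappa t) ^+ 2) a + 2 * (mesh s * M) * a).
    by move: IH; lra.
  apply: H => t /andP[at_ tb].
  have t01 : 0 <= t <= L by rewrite (le_trans a0 (ltW at_)) (le_trans (ltW tb)).
  have a01 : 0 <= a <= L by rewrite a0.
  have fqt := fq t; rewrite at_ tb in fqt; have {}fqt := fqt isT.
  have kap : (kappa t - c) ^+ 2 <= mesh s * M.
    rewrite /c (kE t t01) (kE a a01) opprD addrACA subrr add0r.
    apply: le_trans (prim_incr_sq ms a0 (ltW at_) (le_trans (ltW tb) bL)) _.
    rewrite ler_wpM2r//; apply: le_trans (mesh_ge js).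
    by rewrite lerD2r ltW.
  have -> : q t = f t - (al + be * t) by rewrite -fqt; ring.
  have := sqr_ge0 (al - c + be * t); have := sqr_ge0 ((f t - kappa t) - (kappa t - c)).
  move: (f t) (kappa t) kap => y k' kap; nra.
by have := main _ (leqnn _); rewrite (node_size sP).
Qed.

End Hermite.

(** * The energy *)

Section Normal.
Context {R : realType} (n : nat).
Implicit Types (a b c : 'rV[R]_n) (x y : 'rV[R]_n).

Lemma dotC a b : dot a b = dot b a.
Proof. by apply: eq_bigr => i _; rewrite mulrC. Qed.

Lemma dot_linl (r : R) a b c : dot (r *: a + b) c = r * dot a c + dot b c.
Proof.
by rewrite /dot mulr_sumr -big_split /=; apply: eq_bigr => i _; rewrite !mxE; ring.
Qed.

Lemma dot_linr (r : R) a b c : dot c (r *: a + b) = r * dot c a + dot c b.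
Proof. by rewrite !(dotC c) dot_linl. Qed.

Lemma dot_ge0 a : 0 <= dot a a.
Proof. by apply: sumr_ge0 => i _; rewrite -expr2 sqr_ge0. Qed.

Lemma dot_cauchy_schwarz a b : dot a b ^+ 2 <= dot a a * dot b b.
Proof.
apply: discriminant_le => t; have := dot_ge0 (t *: a + b).
rewrite dot_linl !dot_linr (dotC b a); lra.
Qed.

Lemma dot_coord a i : a 0 i ^+ 2 <= dot a a.
Proof.
rewrite /dot (bigD1 i)//= -expr2 lerDl sumr_ge0// => j _.
by rewrite -expr2 sqr_ge0.
Qed.

Lemma enorm_sq a : enorm a ^+ 2 = dot a a.
Proof. by rewrite sqr_sqrtr// dot_ge0. Qed.

Lemma enorm_gt0 a : a != 0 -> 0 < enorm a.
Proof.
move=> a0; rewrite sqrtr_gt0 lt_neqAle dot_ge0 andbT eq_sym.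
apply: contra a0 => /eqP d0; apply/eqP/rowP => i; rewrite mxE.
apply/eqP; rewrite -sqrf_eq0 eq_le sqr_ge0 andbT -d0; exact: dot_coord.
Qed.

Variable Phi : 'rV[R]_n -> R.

(** An inequality, because [normal] is 0 where the gradient vanishes; this is the only size
    information available off the surface. *)
Lemma normal_le1 x : dot (normal Phi x) (normal Phi x) <= 1.
Proof.
rewrite /normal; set g := grad Phi x.
rewrite -[X in dot X _]addr0 -[X in dot _ X]addr0 dot_linl !dot_linr.
have z0 (w : 'rV[R]_n) : dot 0 w = 0 by rewrite /dot big1// => i _; rewrite mxE mul0r.
rewrite (dotC g 0) !z0 ?mulr0 !addr0 -enorm_sq.
have [->|e0] := eqVneq (enorm g) 0; first by rewrite expr0n /= !mulr0.
suff -> : (enorm g)^-1 * ((enorm g)^-1 * enorm g ^+ 2) = 1 by [].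
by field.
Qed.

Hypothesis PhiC1 : C1_field Phi.

Lemma dot_cvg (T : Type) (F : set_system T) (FF : Filter F)
    (f g : T -> 'rV[R]_n) (a b : 'rV[R]_n) :
  f @ F --> a -> g @ F --> b -> (fun t => dot (f t) (g t)) @ F --> dot a b.
Proof.
move=> fa gb; apply: (@cvg_big R _ +%R 0 xpredT (@add_continuous R^o)) => i _.
by apply: cvgM; apply: cvg_coord.
Qed.

(** The gradient has to be nonzero at the limit point only, so the approximating points may lie off
    the surface. *)
Lemma normal_cvg (T : Type) (F : set_system T) (FF : Filter F)
    (f : T -> 'rV[R]_n) (a : 'rV[R]_n) : grad Phi a != 0 -> f @ F --> a ->
  (fun t => normal Phi (f t)) @ F --> normal Phi a.
Proof.
move=> ga fa; have cg : (fun t => grad Phi (f t)) @ F --> grad Phi a.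
  by apply: (cvg_comp _ _ fa); exact: (PhiC1.2 a).
apply: cvgZ => //; apply: cvgV; first by rewrite gt_eqF// enorm_gt0.
have := dot_cvg FF cg cg => h.
by apply: (cvg_comp _ _ h); exact: sqrt_continuous.
Qed.

(** Along [u] the gradient may vanish, and the normal may then be discontinuous. Measurability goes
    through the power [-1], which agrees with the inverse on all nonnegative reals, including 0. *)
Lemma normal_measurable L (u : R -> 'rV[R]_n) i : {within `[0, L], continuous u} ->
  measurable_fun `[0, L] (fun t => normal Phi (u t) 0 i).
Proof.
move=> /subspace_continuousP cu.
have cg : {within `[0, L], continuous (fun t => grad Phi (u t))}.
  apply/subspace_continuousP => t Dt.
  by apply: (cvg_comp _ _ (cu t Dt)); exact: (PhiC1.2 (u t)).
have /cts_rowP/(_ i) cgi := cg.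
have cd : {within `[0, L], continuous (fun t => dot (grad Phi (u t)) (grad Phi (u t)))}.
  move/subspace_continuousP : cg => cg.
  by apply/subspace_continuousP => t Dt; apply: dot_cvg; exact: cg.
rewrite (_ : (fun t => _) = fun t =>
  (Num.sqrt (dot (grad Phi (u t)) (grad Phi (u t)))) `^ (-1) * grad Phi (u t) 0 i).
  apply: measurable_funM; last exact: cts_meas.
  have m0 : measurable_fun [set: R] (@Num.sqrt R).
    by apply: continuous_measurable_fun; exact: sqrt_continuous.
  exact: (measurableT_comp (@measurable_powR R (-1)) (measurableT_comp m0 (cts_meas cd))).
by apply/funext => t; rewrite powR_inv1 ?sqrtr_ge0// mxE.
Qed.

End Normal.

(** * The polarized energy density and its limits *)

Section Energy.
Context {R : realType} (n : nat) (L : R).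
Hypothesis L0 : 0 < L.
Variables (gamma : R) (Phi : 'rV[R]_n -> R).
Hypotheses (gamma_ge0 : 0 <= gamma) (gamma_lt1 : gamma < 1).
Hypotheses (PhiC1 : C1_field Phi) (Sreg : regular_level_set Phi).
Implicit Types (t : R) (u v f g w : R -> 'rV[R]_n).

Let N u t := normal Phi (u t).

Lemma sqint_sum (m : nat) (f : 'I_m -> R -> R) : (forall i, sqint L (f i)) ->
  sqint L (fun t => \sum_i f i t).
Proof.
elim: m f => [|m IH] f fs.
  by apply: eq_sqint (sqint_cst L 0) => t _; rewrite big_ord0.
have := sqintD (fs ord0) (IH (fun i => f (lift ord0 i)) (fun i => fs _)).
by apply: eq_sqint => t _; rewrite big_ord_recl.
Qed.

Lemma sqintM_bounded (f h : R -> R) : measurable_fun `[0, L] h ->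
  (forall t, `|h t| <= 1) -> sqint L f -> sqint L (fun t => f t * h t).
Proof.
move=> mh h1 [mf f2]; split; first exact: measurable_funM.
apply: (@int1_le _ _ _ (fun t => f t ^+ 2)) f2 _.
  by apply: measurable_funX; exact: measurable_funM.
move=> t _; rewrite ger0_norm ?sqr_ge0// exprMn ler_piMr ?sqr_ge0//.
by rewrite -real_normK ?num_real// expr_le1.
Qed.

Lemma N_le1 u t i : `|N u t 0 i| <= 1.
Proof.
rewrite -(@ler_pXn2r _ 2)// ?nnegrE// expr1n real_normK ?num_real//.
exact: le_trans (dot_coord _ _) (normal_le1 _ _).
Qed.

Lemma dot_N_sq u f t : dot (f t) (N u t) ^+ 2 <= dot (f t) (f t).
Proof.
apply: le_trans (dot_cauchy_schwarz _ _) _.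
by rewrite ler_piMr ?dot_ge0//; exact: normal_le1.
Qed.

Lemma dot_N_sqint u f : {within `[0, L], continuous u} -> L2 L f ->
  sqint L (fun t => dot (f t) (N u t)).
Proof.
move=> cu /L2P f2; apply: sqint_sum => i; apply: sqintM_bounded => //.
- exact: normal_measurable.
- by move=> t; exact: N_le1.
Qed.

(** Coordinate [i] of [(I - gamma n n^T) f], with [n] the normal at [u]. Written as [psi u f . g],
    the form [qf u f g] becomes an L^2 pairing with [g], to which weak convergence applies. *)
Definition psi u f i t := f t 0 i - gamma * (dot (f t) (N u t) * N u t 0 i).

(** The normal is taken at [u] independently of [f] and [g], so that the form is bilinear in the
    second derivatives and can be expanded around the limit. *)
Definition qf u f g t := dot (f t) (g t) - gamma * (dot (f t) (N u t) * dot (g t) (N u t)).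

Lemma psi_sqint u f i : {within `[0, L], continuous u} -> L2 L f ->
  sqint L (psi u f i).
Proof.
move=> cu f2; have /L2P/(_ i) fi := f2; apply: sqintB => //.
apply: sqintZ; apply: sqintM_bounded; [exact: normal_measurable|
  by move=> t; exact: N_le1|exact: dot_N_sqint].
Qed.

Lemma qf_psi u f g t : qf u f g t = \sum_i psi u f i t * g t 0 i.
Proof.
rewrite /qf [dot (g t) _]/dot !mulr_sumr -sumrB.
by apply: eq_bigr => i _; rewrite /psi; ring.
Qed.

Lemma qf_int1 u f g : {within `[0, L], continuous u} -> L2 L f -> L2 L g ->
  int1 L (qf u f g).
Proof.
move=> cu f2 /L2P g2; have : int1 L (fun t => \sum_i psi u f i t * g t 0 i).
  by apply: int1_sum => i; apply: sqint_int1M => //; exact: psi_sqint.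
by apply: eq_int1 => t _; rewrite qf_psi.
Qed.

Lemma prim_qf u f g : {within `[0, L], continuous u} -> L2 L f -> L2 L g ->
  prim (qf u f g) L = \sum_i prim (fun t => psi u f i t * g t 0 i) L.
Proof.
move=> cu f2 /L2P g2; rewrite -prim_sum => [|i]; first by apply: eq_prim => t _; exact: qf_psi.
by apply: sqint_int1M => //; exact: psi_sqint.
Qed.

Lemma qf_ge u f t : (1 - gamma) * dot (f t) (f t) <= qf u f f t.
Proof.
rewrite /qf -expr2; have := ler_wpM2l gamma_ge0 (dot_N_sq u f t); lra.
Qed.

Lemma qf_ge0 u f t : 0 <= qf u f f t.
Proof.
apply: le_trans (qf_ge u f t); rewrite mulr_ge0 ?dot_ge0// subr_ge0 ltW//.
Qed.

Lemma qf_le u f t : qf u f f t <= dot (f t) (f t).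
Proof. by rewrite /qf -expr2 gerBl mulr_ge0// sqr_ge0. Qed.

Lemma dot_int1 f : L2 L f -> int1 L (fun t => dot (f t) (f t)).
Proof.
by move=> /L2P f2; apply: int1_sum => i; exact: sqint_int1M.
Qed.

Lemma prim_dot f : L2 L f ->
  prim (fun t => dot (f t) (f t)) L = \sum_i prim (fun t => f t 0 i ^+ 2) L.
Proof.
move=> /L2P f2; rewrite -prim_sum => [|i]; last by case: (f2 i).
by apply: eq_prim => t _; apply: eq_bigr => i _; rewrite expr2.
Qed.

(** Supplies the dominating function in [psi_cvg]: as [|N| <= 1], the two correction terms are each
    at most [|f|]. *)
Lemma psi_diff_sq u v f i t :
  (psi u f i t - psi v f i t) ^+ 2 <= 4 * dot (f t) (f t).
Proof.
rewrite /psi; set a := dot (f t) (N u t) * _; set b := dot (f t) (N v t) * _.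
have h w : (dot (f t) (N w t) * N w t 0 i) ^+ 2 <= dot (f t) (f t).
  rewrite exprMn; apply: le_trans (dot_N_sq w f t).
  by rewrite ler_piMr ?sqr_ge0// -real_normK ?num_real// expr_le1//; exact: N_le1.
have ha := h u; have hb := h v; rewrite -/a -/b in ha hb.
have -> : f t 0 i - gamma * a - (f t 0 i - gamma * b) = gamma * (b - a) by ring.
rewrite exprMn; apply: le_trans (_ : (b - a) ^+ 2 <= _).
  by rewrite ler_piMl ?sqr_ge0// expr_le1// ltW.
by apply: le_trans (sq_add_le b (- a)) _; rewrite sqrrN; lra.
Qed.

Section Limit.
Variables (u_ : nat -> R -> 'rV[R]_n) (u : R -> 'rV[R]_n).
Hypotheses (cu_ : forall k, {within `[0, L], continuous (u_ k)})
  (cu : {within `[0, L], continuous u})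
  (u_u : forall x, 0 <= x <= L -> (fun k => u_ k x) @ \oo --> u x)
  (uS : forall x, 0 <= x <= L -> Phi (u x) = 0).

Lemma N_cvg x : 0 <= x <= L -> (fun k => N (u_ k) x) @ \oo --> N u x.
Proof. by move=> Dx; apply: normal_cvg => //; [exact/Sreg/uS|exact: u_u]. Qed.

Lemma dotN_cvg f x : 0 <= x <= L ->
  (fun k => dot (f x) (N (u_ k) x)) @ \oo --> dot (f x) (N u x).
Proof. by move=> Dx; apply: dot_cvg; [exact: cvg_cst|exact: N_cvg]. Qed.

Lemma qf_cvg f : L2 L f ->
  (fun k => prim (qf (u_ k) f f) L) @ \oo --> prim (qf u f f) L.
Proof.
move=> f2; have [] := @dct _ L (fun k => qf (u_ k) f f) (qf u f f) (fun t => dot (f t) (f t)) => //.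
- by move=> k; apply: int1_meas; exact: qf_int1.
- move=> x Dx; apply: cvgB; first exact: cvg_cst.
  by apply: cvgM; [exact: cvg_cst|apply: cvgM; exact: dotN_cvg].
- exact: dot_int1.
- by move=> k x _; rewrite ger0_norm ?qf_ge0// qf_le.
Qed.

Lemma psi_cvg f i : L2 L f ->
  (fun k => prim (fun t => (psi (u_ k) f i t - psi u f i t) ^+ 2) L) @ \oo --> (0 : R).
Proof.
move=> f2; have [] := @dct _ L (fun k t => (psi (u_ k) f i t - psi u f i t) ^+ 2)
    (fun=> 0) (fun t => 4 * dot (f t) (f t)).
- move=> k; apply: measurable_funX; apply: measurable_funB.
    by case: (psi_sqint i (@cu_ k) f2).
  by case: (psi_sqint i cu f2).
- move=> x Dx.
  have c : (fun k => psi (u_ k) f i x) @ \oo --> psi u f i x.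
    apply: cvgB; first exact: cvg_cst.
    apply: cvgM; [exact: cvg_cst|apply: cvgM; first exact: dotN_cvg].
    by apply: cvg_coord; exact: N_cvg.
  have c' : (fun k => psi (u_ k) f i x - psi u f i x) @ \oo --> (0 : R).
    by rewrite -(subrr (psi u f i x)); apply: cvgB c _; exact: cvg_cst.
  under eq_fun do rewrite expr2.
  by rewrite -(mulr0 (0 : R)); exact: (cvgM c' c').
- by apply: int1Z; exact: dot_int1.
- by move=> k x _; rewrite ger0_norm ?sqr_ge0// psi_diff_sq.
by move=> _; rewrite prim_cst ?mul0r// ltW.
Qed.

Lemma cvg_sum0 (m : nat) (a : 'I_m -> nat -> R) : (forall i, a i @ \oo --> (0 : R)) ->
  (fun k => \sum_i a i k) @ \oo --> (0 : R).
Proof.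
move=> a0; have : (fun k => \sum_i a i k) @ \oo --> (\sum_(i < m) 0 : R).
  by apply: (@cvg_big R _ +%R 0 xpredT (@add_continuous R^o)) => i _; exact: a0.
by rewrite big1.
Qed.

Lemma cvg0_sq (a b : nat -> R) M : (forall k, a k ^+ 2 <= b k * M) ->
  b @ \oo --> (0 : R) -> a @ \oo --> (0 : R).
Proof.
move=> ab b0; have c : (fun k => b k * M) @ \oo --> (0 : R).
  by rewrite -(mul0r M); apply: cvgM b0 _; exact: cvg_cst.
apply/cvgrPdist_le => e e0; move/cvgrPdist_le : c => /(_ (e ^+ 2)).
move=> /(_ (exprn_gt0 2 e0))[K _ HK]; exists K => // k Kk.
have := HK k Kk; rewrite !sub0r !normrN => h.
rewrite -ler_sqr ?nnegrE ?(ltW e0)// real_normK ?num_real//.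
exact: le_trans (ab k) (le_trans (ler_norm _) h).
Qed.

Variables (g_ : nat -> R -> 'rV[R]_n) (g : R -> 'rV[R]_n) (M : R).
Hypotheses (g2_ : forall k, L2 L (g_ k)) (g2 : L2 L g)
  (g_M : forall k i, prim (fun t => (g_ k t 0 i - g t 0 i) ^+ 2) L <= M)
  (g_g : forall i (h : R -> R), sqint L h ->
     (fun k => prim (fun t => h t * (g_ k t 0 i - g t 0 i)) L) @ \oo --> (0 : R)).

Let e_ k t := g_ k t - g t.

Lemma e_L2 k : L2 L (e_ k).
Proof.
apply/L2P => i; move/L2P : g2 => /(_ i) gi; move/L2P : (@g2_ k) => /(_ i) gki.
by apply: eq_sqint (sqintB gki gi) => t _; rewrite !mxE.
Qed.

(** A strongly convergent factor times a weakly null one: [psi (u_ k) g] is split into its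
    difference from [psi u g], small in L^2 while the [e_ k] stay bounded, and the fixed function
    [psi u g], which tests the weak convergence. *)
Lemma qf_cross_cvg : (fun k => prim (qf (u_ k) g (e_ k)) L) @ \oo --> (0 : R).
Proof.
have ei i : sqint L (fun t => g t 0 i) by move/L2P : g2; exact.
have E k : prim (qf (u_ k) g (e_ k)) L =
    \sum_i (prim (fun t => (psi (u_ k) g i t - psi u g i t) * (g_ k t 0 i - g t 0 i)) L
     + prim (fun t => psi u g i t * (g_ k t 0 i - g t 0 i)) L).
  rewrite (prim_qf (@cu_ k) g2 (e_L2 k)); apply: eq_bigr => i _.
  have pk := psi_sqint i (@cu_ k) g2; have p := psi_sqint i cu g2.
  have gki : sqint L (fun t => g_ k t 0 i - g t 0 i).
    by move/L2P : (@g2_ k) => /(_ i) gki; exact: sqintB.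
  rewrite -(primD (sqint_int1M (sqintB pk p) gki) (sqint_int1M p gki)).
  by apply: eq_prim => t _; rewrite /e_ !mxE; ring.
rewrite (_ : (fun k => _) = fun k => \sum_i
   (prim (fun t => (psi (u_ k) g i t - psi u g i t) * (g_ k t 0 i - g t 0 i)) L
     + prim (fun t => psi u g i t * (g_ k t 0 i - g t 0 i)) L)); last exact/funext.
apply: cvg_sum0 => i; rewrite -(addr0 (0 : R)).
apply: cvgD; last by apply: g_g; exact: psi_sqint.
apply: (@cvg0_sq _ (fun k => prim (fun t => (psi (u_ k) g i t - psi u g i t) ^+ 2) L) M).
  move=> k; have pk := psi_sqint i (@cu_ k) g2; have p := psi_sqint i cu g2.
  have gki : sqint L (fun t => g_ k t 0 i - g t 0 i).
    by move/L2P : (@g2_ k) => /(_ i) gki; exact: sqintB.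
  apply: le_trans (cauchy_schwarz_prim (sqintB pk p) gki) _.
  by rewrite ler_wpM2l// prim_ge0// => t _; exact: sqr_ge0.
exact: psi_cvg.
Qed.

Lemma qf_expand k : prim (qf (u_ k) (g_ k) (g_ k)) L =
  prim (qf (u_ k) g g) L + 2 * prim (qf (u_ k) g (e_ k)) L +
  prim (qf (u_ k) (e_ k) (e_ k)) L.
Proof.
have i1 := qf_int1 (@cu_ k) g2 g2; have i2 := qf_int1 (@cu_ k) g2 (e_L2 k).
have i3 := qf_int1 (@cu_ k) (e_L2 k) (e_L2 k).
rewrite -(primZ 2 i2) -(primD i1 (int1Z 2 i2)) -(primD (int1D i1 (int1Z 2 i2)) i3).
apply: eq_prim => t _; rewrite /qf /e_.
have -> : g_ k t - g t = -1 *: g t + g_ k t by rewrite scaleN1r addrC.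
rewrite !dot_linl !dot_linr (dotC (g_ k t) (g t)); ring.
Qed.

Lemma qf_weak_limit : (fun k => prim (qf (u_ k) (g_ k) (g_ k)) L -
  prim (qf (u_ k) (e_ k) (e_ k)) L) @ \oo --> prim (qf u g g) L.
Proof.
have -> : (fun k => prim (qf (u_ k) (g_ k) (g_ k)) L -
  prim (qf (u_ k) (e_ k) (e_ k)) L) =
  (fun k => prim (qf (u_ k) g g) L + 2 * prim (qf (u_ k) g (e_ k)) L).
  by apply/funext => k; rewrite qf_expand addrK.
rewrite -[X in _ --> X]addr0 -[X in _ --> _ + X](mulr0 2).
apply: cvgD; first exact: qf_cvg.
by apply: cvgM; [exact: cvg_cst|exact: qf_cross_cvg].
Qed.

End Limit.
End Energy.

Lemma cvg_sub0 {R : realType} (a b : nat -> R) (l : R) :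
  (fun k => a k - b k) @ \oo --> l -> b @ \oo --> (0 : R) -> a @ \oo --> l.
Proof.
move=> c b0; have c' := cvgD c b0; rewrite addr0 in c'.
have e : a = (fun k => a k - b k) + b by apply/funext => k; exact: (esym (subrK (b k) (a k))).
by rewrite e; exact: c'.
Qed.

(** * What convergence of functionals on H^2 says about values and second derivatives *)

Section WeakLimits.
Context {R : realType} (n : nat) (L : R).
Hypothesis L0 : 0 < L.
Implicit Types (x t : R) (u v : R -> 'rV[R]_n) (F : (R -> 'rV[R]_n) -> R).

Definition H2_linear F := forall (a : R) u v, H2 L u -> H2 L v ->
  F (a *: u + v) = a * F u + F v.

(* What weak and strong convergence in H^2 have in common. *)
Definition functional_cvg (u_ : nat -> R -> 'rV[R]_n) u := forall F C, H2_linear F ->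
  (forall v, H2 L v -> F v ^+ 2 <= C * ip L v v) -> (fun k => F (u_ k)) @ \oo --> F u.

Lemma weak_cvg_functional (u_ : nat -> R -> 'rV[R]_n) u : weak_cvg L u_ u -> functional_cvg u_ u.
Proof.
by move=> w F C Flin FC; apply: w; exact: (bounded_linear_of_ip L0 Flin FC).
Qed.

Lemma strong_cvg_functional (u_ : nat -> R -> 'rV[R]_n) u :
  (forall k, H2 L (u_ k)) -> H2 L u ->
  (fun k => ip L (u_ k - u) (u_ k - u)) @ \oo --> (0 : R) -> functional_cvg u_ u.
Proof.
move=> Hu_ Hu c F C Flin FC; apply/subr_cvg0.
apply: (@cvg0_sq _ _ (fun k => ip L (u_ k - u) (u_ k - u)) C) => // k.
have [H _ _] := H2_sub L0 (Hu_ k) Hu.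
rewrite mulrC; apply: le_trans (FC _ H).
by rewrite (subr_scale (u_ k) u) (Flin (-1) _ _ Hu (Hu_ k)) mulN1r addrC.
Qed.

Lemma H2_linear_eval i x : H2_linear (fun u => u x 0 i).
Proof. by move=> a u v _ _; rewrite !mxE. Qed.

Lemma H2_linear_eval_wd1 i x : 0 <= x <= L -> H2_linear (fun u => wd1 L u x 0 i).
Proof.
move=> Dx a u v Hu Hv; have [_ e _] := H2_wd_lin L0 a Hu Hv.
by rewrite (e x Dx) mxE mxE.
Qed.

Lemma H2_linear_test i (h : R -> R) : sqint L h ->
  H2_linear (fun u => prim (fun t => h t * wd2 L u t 0 i) L).
Proof.
move=> hs a u v Hu Hv; have [H _ e] := H2_wd_lin L0 a Hu Hv.
have hu := sqint_int1M hs (d2_sqint L0 i Hu); have hv := sqint_int1M hs (d2_sqint L0 i Hv).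
rewrite -(primZ a hu) -(primD (int1Z a hu) hv); apply: ae_prim.
- by apply: sqint_int1M => //; exact: d2_sqint.
- by apply: int1D => //; exact: int1Z.
- by apply: ae_imp (e i) => t h' Dt; rewrite h'//; ring.
Qed.

Lemma test_bound i (h : R -> R) v : sqint L h -> H2 L v ->
  prim (fun t => h t * wd2 L v t 0 i) L ^+ 2 <= prim (fun t => h t ^+ 2) L * ip L v v.
Proof.
move=> hs Hv; apply: le_trans (cauchy_schwarz_prim hs (d2_sqint L0 i Hv)) _.
rewrite ler_wpM2l//; first by apply: prim_ge0 => t _; exact: sqr_ge0.
apply: le_trans (ip_part L v i); rewrite -[leLHS]add0r lerD2r.
by rewrite addr_ge0// sqr_ge0.
Qed.

Variables (u_ : nat -> R -> 'rV[R]_n) (u : R -> 'rV[R]_n).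
Hypotheses (Hu_ : forall k, H2 L (u_ k)) (Hu : H2 L u) (uc : functional_cvg u_ u).

Lemma fcvg_eval x : 0 <= x <= L -> (fun k => u_ k x) @ \oo --> u x.
Proof.
move=> Dx; apply: cvg_row => i.
by apply: uc (H2_linear_eval i x) _ => v Hv; exact: ip_eval.
Qed.

Lemma fcvg_eval_wd1 x : 0 <= x <= L -> (fun k => wd1 L (u_ k) x) @ \oo --> wd1 L u x.
Proof.
move=> Dx; apply: cvg_row => i.
by apply: uc (H2_linear_eval_wd1 i Dx) _ => v Hv; exact: ip_eval_d1.
Qed.

Lemma fcvg_test i (h : R -> R) : sqint L h ->
  (fun k => prim (fun t => h t * (wd2 L (u_ k) t 0 i - wd2 L u t 0 i)) L) @ \oo --> (0 : R).
Proof.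
move=> hs; have c := uc (H2_linear_test i hs) (fun v Hv => test_bound i hs Hv).
rewrite (_ : (fun k => _) = (fun k => prim (fun t => h t * wd2 L (u_ k) t 0 i) L -
  prim (fun t => h t * wd2 L u t 0 i) L)); first by apply/subr_cvg0; exact: c.
apply/funext => k.
have hk := sqint_int1M hs (d2_sqint L0 i (Hu_ k)); have h0 := sqint_int1M hs (d2_sqint L0 i Hu).
rewrite -(primB hk h0); apply: eq_prim => t _; exact: mulrBr.
Qed.

End WeakLimits.

Section EnergyLimits.
Context {R : realType} (L gamma : R) (Phi : 'rV[R]_3 -> R).
Hypotheses (L0 : 0 < L) (gamma_ge0 : 0 <= gamma) (gamma_lt1 : gamma < 1).
Hypotheses (PhiC1 : C1_field Phi) (Sreg : regular_level_set Phi).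
Implicit Types (u v : R -> 'rV[R]_3).

Lemma H2_cts u : H2 L u -> {within `[0, L], continuous u}.
Proof. by case. Qed.

Lemma wd2_L2 u : H2 L u -> L2 L (wd2 L u).
Proof. by move=> /(H2_wd L0)[]. Qed.

Lemma energy_qf u : energy L gamma Phi u =
  2^-1 * prim (qf gamma Phi u (wd2 L u) (wd2 L u)) L.
Proof.
rewrite /energy wd2E; congr (_ * _); apply: eq_prim => t _.
by rewrite enorm_sq real_normK ?num_real// expr2.
Qed.

Lemma energy_ge0 u : 0 <= energy L gamma Phi u.
Proof.
rewrite energy_qf mulr_ge0 ?invr_ge0//; apply: prim_ge0 => t _; exact: qf_ge0.
Qed.

Lemma energy_coercive u : H2 L u ->
  (1 - gamma) * \sum_i prim (fun t => wd2 L u t 0 i ^+ 2) L <= 2 * energy L gamma Phi u.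
Proof.
move=> Hu; have u2 := wd2_L2 Hu.
rewrite energy_qf mulrA mulfV ?pnatr_eq0// mul1r -(prim_dot u2).
rewrite -(primZ (1 - gamma) (dot_int1 u2)); apply: le_prim.
- by apply: int1Z; exact: dot_int1.
- by apply: qf_int1 => //; exact: H2_cts.
- by move=> t _; exact: qf_ge.
Qed.

Variables (u_ : nat -> R -> 'rV[R]_3) (u : R -> 'rV[R]_3) (M : R).
Hypotheses (Hu_ : forall k, H2 L (u_ k)) (Hu : H2 L u) (uc : functional_cvg L u_ u).
Hypothesis uS : forall x, 0 <= x <= L -> Phi (u x) = 0.
Hypothesis u_M : forall k i,
  prim (fun t => (wd2 L (u_ k) t 0 i - wd2 L u t 0 i) ^+ 2) L <= M.

Let ee k t := wd2 L (u_ k) t - wd2 L u t.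

Lemma energy_limit : (fun k => energy L gamma Phi (u_ k) -
  2^-1 * prim (qf gamma Phi (u_ k) (ee k) (ee k)) L) @ \oo --> energy L gamma Phi u.
Proof.
have c := @qf_weak_limit R 3 L L0 gamma Phi gamma_ge0 gamma_lt1 PhiC1 Sreg u_ u
  (fun k => H2_cts (Hu_ k)) (H2_cts Hu) (fcvg_eval L0 uc) uS
  (fun k => wd2 L (u_ k)) (wd2 L u) M (fun k => wd2_L2 (Hu_ k)) (wd2_L2 Hu) u_M
  (fun i h hs => fcvg_test L0 Hu_ Hu uc i hs).
rewrite energy_qf; under eq_fun do rewrite energy_qf -mulrBr.
by apply: cvgM; [exact: cvg_cst|exact: c].
Qed.

(** Stated against a convergent sequence of upper bounds to serve twice: with the lower limit plus a
    vanishing error, and with the energies of a recovery sequence plus [eps]. *)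
Lemma energy_lsc (c : nat -> R) l : (forall k, energy L gamma Phi (u_ k) <= c k) ->
  c @ \oo --> l -> energy L gamma Phi u <= l.
Proof.
move=> uk cl; apply: (ler_cvg_to energy_limit cl); apply: nearW => k.
apply: le_trans (uk k); rewrite gerBl mulr_ge0 ?invr_ge0//.
by apply: prim_ge0 => t _; exact: qf_ge0.
Qed.

Lemma energy_cvg : (fun k => ip L (u_ k - u) (u_ k - u)) @ \oo --> (0 : R) ->
  (fun k => energy L gamma Phi (u_ k)) @ \oo --> energy L gamma Phi u.
Proof.
move=> c; have e0 : (fun k => 2^-1 * prim (qf gamma Phi (u_ k) (ee k) (ee k)) L) @ \oo
    --> (0 : R).
  apply: (@squeeze_cvgr _ _ _ _ (fun=> 0) (fun k => ip L (u_ k - u) (u_ k - u))) => //;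
    last exact: cvg_cst.
  apply: nearW => k; have q0 : 0 <= prim (qf gamma Phi (u_ k) (ee k) (ee k)) L.
    by apply: prim_ge0 => t _; exact: qf_ge0.
  rewrite mulr_ge0 ?invr_ge0//=.
  have e2 : L2 L (ee k).
    apply/L2P => i; apply: eq_sqint (sqintB (d2_sqint L0 i (Hu_ k)) (d2_sqint L0 i Hu)).
    by move=> t _; rewrite !mxE.
  apply: (@le_trans _ _ (prim (qf gamma Phi (u_ k) (ee k) (ee k)) L)).
    by rewrite ler_piMl// invf_le1// ler1n.
  apply: (@le_trans _ _ (prim (fun t => dot (ee k t) (ee k t)) L)).
    apply: le_prim; [apply: qf_int1 => //; exact: H2_cts (Hu_ k)|exact: dot_int1|].
    by move=> t _; exact: qf_le.
  rewrite (prim_dot e2) (ip_sub L0 (Hu_ k) Hu); apply: ler_sum => i _.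
  rewrite (@eq_prim _ _ (fun t => ee k t 0 i ^+ 2)
    (fun t => (wd2 L (u_ k) t 0 i - wd2 L u t 0 i) ^+ 2)); last first.
    by move=> t _; rewrite !mxE.
  by rewrite lerDr addr_ge0// sqr_ge0.
exact: cvg_sub0 energy_limit e0.
Qed.

End EnergyLimits.

(** * Error of the Hermite interpolant *)

Section Recovery.
Context {R : realType} (n : nat) (L : R).
Hypothesis L0 : 0 < L.
Implicit Types (u v kappa m : R -> 'rV[R]_n).

(** The chain of weak derivatives in [Hm 3] is a priori unrelated to the chosen [wd2]; continuous
    representatives of its first two members link it to the primitives that determine [wd2]. *)
Lemma H3_wd2_cts v : H3 L v -> exists kappa m, [/\ L2 L m, primitive_of L kappa m &
  forall i, aeq L (fun t => wd2 L v t 0 i) (fun t => kappa t 0 i)].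
Proof.
move=> [Hv [v2 [g1 [vg1 [g1L [g2 [g12 [g2L [g3 [g23 g3L]]]]]]]]]].
have [kappa [_ kp e2]] := weak_deriv_L2_cts L0 g2L g3L g23.
have [w [cw wp e1]] := weak_deriv_L2_cts L0 g1L g2L g12.
have w2 : forall i, int1 L (fun t => w t 0 i) by move=> i; exact: L2_int1 (cts_L2 cw).
have vw : primitive_of L v w.
  apply: (sweak_primitive L0 Hv.1 w2); apply/weak_derivP => i.
  exact: sweak_aer (L2_int1 i g1L) (w2 i) (e1 i) ((weak_derivP _ _ _).1 vg1 i).
have [_ _ e3] := wd_H2 L0 g2L vw wp.
by exists kappa, g3; split=> // i; exact: aeq_trans (e3 i) (e2 i).
Qed.

Lemma H3_approx u v : H2 L u -> H3 L v -> exists kappa m, [/\ L2 L m, primitive_of L kappa m &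
  \sum_i prim (fun t => (wd2 L u t 0 i - kappa t 0 i) ^+ 2) L <= ip L (v - u) (v - u)].
Proof.
move=> Hu H3v; have Hv := H3v.1; have [kappa [m [m2 km e]]] := H3_wd2_cts H3v.
exists kappa, m; split=> //; rewrite (ip_sub L0 Hv Hu); apply: ler_sum => i _.
have k2 : sqint L (fun t => kappa t 0 i).
  by apply: (L2P _ _).1; exact: cts_L2 (primitive_cts (fun i => L2_int1 i m2) km).
rewrite (ae_prim (sqintB (d2_sqint L0 i Hu) k2).2 (sqintB (d2_sqint L0 i Hv) (d2_sqint L0 i Hu)).2).
  by rewrite lerDr addr_ge0// sqr_ge0.
by apply: ae_imp (e i) => t h Dt; rewrite (h Dt) -sqrrN opprB.
Qed.

(** [kappa] and [m] are quantified after the interpolant, so one interpolant per partition can be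
    compared with ever better regular approximations of u''. *)
Lemma interpolation_error s u : itv_partition 0 L s -> H2 L u -> exists v,
  [/\ FE_space L s v, H2 L v,
      forall j, (j <= size s)%N -> v (node s j) = u (node s j),
      forall j, (j <= size s)%N -> wd1 L v (node s j) = wd1 L u (node s j) &
      forall kappa m, L2 L m -> primitive_of L kappa m ->
        ip L (v - u) (v - u) <=
        2 * (\sum_i prim (fun t => (wd2 L u t 0 i - kappa t 0 i) ^+ 2) L) +
        2 * (mesh s * (\sum_i prim (fun t => m t 0 i ^+ 2) L)) * L].
Proof.
move=> sP Hu; have [v [w [k [FE [k2 [vw wk]] vu wu ka]]]] := hermite_interpolant L0 sP u.
have [Hv wv ev] := wd_H2 L0 k2 vw wk.
have [cu1 u2 up1 up2] := H2_wd L0 Hu.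
have wvu j : (j <= size s)%N -> wd1 L v (node s j) = wd1 L u (node s j).
  by move=> js; rewrite (wv _ (node_itv sP js)) wu.
exists v; split=> // kappa m m2 km.
rewrite (ip_sub L0 Hv Hu) !mulr_sumr mulr_suml -big_split/=; apply: ler_sum => i _.
have v0 : v 0 = u 0 := vu 0%N isT.
have d0 : wd1 L v 0 = wd1 L u 0 := wvu 0%N isT.
have w0 : w 0 = wd1 L u 0 := wu 0%N isT.
rewrite v0 d0 !subrr !expr0n/= !add0r.
have us := d2_sqint L0 i Hu; have ks : sqint L (fun t => k t 0 i) by exact: (L2P _ _).1.
have qs := sqintB us ks.
have ck := primitive_cts (fun i => L2_int1 i m2) km.
have cw := primitive_cts (fun i => L2_int1 i k2) wk.
(* The primitive of the error u'' - k is u' - w, and the primitive of that is u - v. Both vanish at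
   the nodes by interpolation, which is the orthogonality required of the error. *)
have Q x : 0 <= x <= L ->
    prim (fun t => wd2 L u t 0 i - k t 0 i) x = wd1 L u x 0 i - w x 0 i.
  move=> Dx; have /andP[_ xL] := Dx.
  rewrite (primB (int1_sub xL (L2_int1 i u2)) (int1_sub xL (L2_int1 i k2))).
  by rewrite (up2 i x Dx) (wk i x Dx) w0 opprD addrACA subrr add0r.
rewrite (ae_prim (sqintB (d2_sqint L0 i Hv) us).2 qs.2); last first.
  by apply: ae_imp (ev i) => t h Dt; rewrite (h Dt) -sqrrN opprB.
have ms : sqint L (fun t => m t 0 i) by exact: (L2P _ _).1.
have cki := (cts_rowP _ _).1 ck i.
apply: (elementwise_best_approximation sP qs us ms cki (km i)).
- by move=> j js; rewrite (Q _ (node_itv sP js)) wu// subrr.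
- move=> j js; have Dj := node_itv sP js; have /andP[j0 jL] := Dj.
  rewrite (@eq_prim _ _ _ (fun x => wd1 L u x 0 i - w x 0 i)); last first.
    by move=> t /andP[t0 tj]; apply: Q; rewrite t0 (le_trans tj).
  rewrite (primB (int1_sub jL (L2_int1 i (cts_L2 cu1))) (int1_sub jL (L2_int1 i (cts_L2 cw)))).
  have a1 := up1 i _ Dj; have a2 := vw i _ Dj; rewrite vu// v0 in a2.
  by apply/eqP; rewrite subr_eq0; apply/eqP; apply: (@addrI _ (u 0 0 i)); rewrite -a1 -a2.
- move=> j js; have [a [b ab]] := ka i j js; exists a, b => x Dx.
  by rewrite -(ab x Dx) opprB addrC subrK.
Qed.

Lemma interpolants_cvg (s : nat -> seq R) u (v_ : nat -> R -> 'rV[R]_n) :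
  (fun k => mesh (s k)) @ \oo --> (0 : R) ->
  (forall e : R, 0 < e -> exists kappa m, [/\ L2 L m, primitive_of L kappa m &
     \sum_i prim (fun t => (wd2 L u t 0 i - kappa t 0 i) ^+ 2) L <= e]) ->
  (forall k kappa m, L2 L m -> primitive_of L kappa m ->
        ip L (v_ k - u) (v_ k - u) <=
        2 * (\sum_i prim (fun t => (wd2 L u t 0 i - kappa t 0 i) ^+ 2) L) +
        2 * (mesh (s k) * (\sum_i prim (fun t => m t 0 i ^+ 2) L)) * L) ->
  (fun k => ip L (v_ k - u) (v_ k - u)) @ \oo --> (0 : R).
Proof.
move=> s0 dens err; apply/cvgrPdist_le => e e0.
(* Order of choices: [kappa] with error [e / 4] is fixed first, and with it [B]; then a fine mesh
   makes the second term at most [e / 2]. *)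
have arith (h A B : R) : A <= e / 4 -> 0 <= h -> h * (4 * (B * L + 1)) <= e ->
  2 * A + 2 * (h * B) * L <= e by lra.
have e4 : 0 < e / 4 by rewrite divr_gt0.
have [kappa [m [m2 km]]] := dens _ e4.
set B := \sum_i prim (fun t => m t 0 i ^+ 2) L; set A := \sum_i _ => Ae.
have B0 : 0 <= B by apply: sumr_ge0 => i _; apply: prim_ge0 => t _; exact: sqr_ge0.
have d0 : 0 < e / (4 * (B * L + 1)).
  by rewrite divr_gt0// mulr_gt0// ltr_wpDl// mulr_ge0// ltW.
have /cvgrPdist_le/(_ _ d0) s1 := s0.
near=> k; rewrite sub0r normrN ger0_norm ?ip_ge0//; apply: le_trans (err k kappa m m2 km) _.
rewrite -/A -/B; have : `|0 - mesh (s k)| <= e / (4 * (B * L + 1)).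
  by near: k.
have BL : 0 <= B * L by rewrite mulr_ge0// ltW.
rewrite sub0r normrN => /(le_trans (ler_norm _)); rewrite ler_pdivlMr; last first.
  by rewrite mulr_gt0// ltr_wpDl.
exact: arith Ae (mesh_ge0 _).
Unshelve. all: by end_near.
Qed.

End Recovery.

(** * Closure, coercivity and recovery *)

Lemma FE_space_H2 {R : realType} (n : nat) (L : R) (s : seq R) (v : R -> 'rV[R]_n) :
  0 < L -> itv_partition 0 L s -> FE_space L s v -> H2 L v.
Proof.
move=> L0 sP /(FE_H2 L0 sP)[w [k [k2 vw wk]]].
by have [] := wd_H2 L0 k2 vw wk.
Qed.

Lemma coord_le_enorm {R : realType} (n : nat) (a : 'rV[R]_n) i : `|a 0 i| <= enorm a.
Proof. by rewrite -sqrtr_sqr ler_wsqrtr// dot_coord. Qed.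

Section BoundaryConditions.
Context {R : realType} (n l : nat) (L : R) (Lbc : (R -> 'rV[R]_n) -> 'rV[R]_l).
Hypothesis Lbc_bl : bounded_linear L (@enorm R l) Lbc.
Implicit Types (u v : R -> 'rV[R]_n).

Lemma bounded_linear_coord j :
  bounded_linear L (fun y : R^o => `|y|) (fun u => Lbc u 0 j : R^o).
Proof.
have [lin [C bd]] := Lbc_bl; split=> [a u v Hu Hv|]; first by rewrite lin// !mxE.
by exists C => u Hu; apply: le_trans (bd u Hu); exact: coord_le_enorm.
Qed.

(** Weak convergence tests real functionals, so the vector condition passes to the limit coordinate
    by coordinate. *)
Lemma bc_closed lbc (u_ : nat -> R -> 'rV[R]_n) u : weak_cvg L u_ u ->
  (forall k, Lbc (u_ k) = lbc) -> Lbc u = lbc.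
Proof.
move=> w ul; apply/rowP => j; have c := w _ (bounded_linear_coord j).
rewrite (_ : (fun k => _) = (fun=> lbc 0 j)) in c; last by apply/funext => k; rewrite ul.
exact: (cvg_unique (@Rhausdorff R) c (cvg_cst (lbc 0 j))).
Qed.

End BoundaryConditions.

(** The discrete constraints hold at nodes, which move with the mesh. The bound [G] on the
    derivatives gives a Hoelder estimate independent of [k], so nodal values near [x] have the same
    limit as the values at [x]. *)
Lemma nearby_cvg {R : realType} (n : nat) (L G x : R) (u_ w_ : nat -> R -> 'rV[R]_n)
    (z h : nat -> R) (a : 'rV[R]_n) :
  (forall k, L2 L (w_ k)) -> (forall k, primitive_of L (u_ k) (w_ k)) ->
  (forall k i, prim (fun t => w_ k t 0 i ^+ 2) L <= G) -> 0 <= x <= L ->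
  (forall k, 0 <= z k <= L) -> (forall k, `|z k - x| <= h k) -> h @ \oo --> (0 : R) ->
  (fun k => u_ k x) @ \oo --> a -> (fun k => u_ k (z k)) @ \oo --> a.
Proof.
move=> w2 uw wG Dx Dz zx h0 ua; apply: cvg_row => i.
have inc k : (u_ k (z k) 0 i - u_ k x 0 i) ^+ 2 <= h k * G.
  have hk0 : 0 <= h k by exact: le_trans (zx k).
  have [x0 xL] := andP Dx; have [z0 zL] := andP (Dz k).
  have P0 : 0 <= prim (fun t => w_ k t 0 i ^+ 2) L by apply: prim_ge0 => t _; exact: sqr_ge0.
  apply: (@le_trans _ _ (`|z k - x| * prim (fun t => w_ k t 0 i ^+ 2) L)).
    have [zx'|xz] := leP (z k) x.
      by rewrite -sqrrN opprB distrC ger0_norm ?subr_ge0//; exact: (primitive_evalB i (w2 k) (uw k)).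
    rewrite ger0_norm; last by rewrite subr_ge0 ltW.
    exact: (primitive_evalB i (w2 k) (uw k) x0 (ltW xz) zL).
  exact: ler_pM.
have d0 := cvg0_sq inc h0; have ci : (fun k => u_ k x 0 i) @ \oo --> a 0 i by exact: cvg_coord.
have e : (fun k => u_ k (z k) 0 i) =
    (fun k => u_ k (z k) 0 i - u_ k x 0 i) + (fun k => u_ k x 0 i).
  by apply/funext => k; exact: esym (subrK _ _).
by rewrite e -[a 0 i]add0r; exact: cvgD.
Qed.

Lemma nearest_node {R : realType} (L : R) (s : seq R) x : 0 < L -> itv_partition 0 L s ->
  0 <= x <= L -> exists j, (j <= size s)%N /\ `|node s j - x| <= mesh s.
Proof.
move=> L0 sP Dx; have [j [js /andP[jx xj]]] := locate L0 sP Dx.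
exists j; split; first exact: ltnW.
rewrite distrC ger0_norm ?subr_ge0//; apply: le_trans (mesh_ge js).
by rewrite lerD2r.
Qed.

Section Closure.
Context {R : realType} (L gamma : R) (Phi : 'rV[R]_3 -> R) (l : nat)
    (Lbc : (R -> 'rV[R]_3) -> 'rV[R]_l) (lbc : 'rV[R]_l).
Hypotheses (L0 : 0 < L) (gamma_ge0 : 0 <= gamma) (gamma_lt1 : gamma < 1).
Hypotheses (PhiC1 : C1_field Phi) (Sreg : regular_level_set Phi).
Hypothesis Lbc_bl : bounded_linear L (@enorm R l) Lbc.
Variables (s : nat -> seq R) (u_ : nat -> R -> 'rV[R]_3).
Hypotheses (sP : forall k, itv_partition 0 L (s k))
  (s0 : (fun k => mesh (s k)) @ \oo --> (0 : R))
  (uA : forall k, admissible_h L Phi Lbc lbc (s k) (u_ k)).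

Lemma admissible_h_H2 k : H2 L (u_ k).
Proof. by have [FE _ _ _] := uA k; exact: FE_space_H2 (sP k) FE. Qed.

Lemma admissible_h_unit k : dot (wd1 L (u_ k) 0) (wd1 L (u_ k) 0) = 1.
Proof.
have [_ e _ _] := uA k; have := e 0%N isT.
by rewrite node0 -enorm_sq wd1E => ->; rewrite expr1n.
Qed.

Variable C : R.
Hypothesis uC : forall k, energy L gamma Phi (u_ k) <= C.

Lemma wd2_bound k :
  \sum_i prim (fun t => wd2 L (u_ k) t 0 i ^+ 2) L <= 2 * C / (1 - gamma).
Proof.
rewrite ler_pdivlMr ?subr_gt0// mulrC.
apply: le_trans (energy_coercive L0 gamma_ge0 PhiC1 (admissible_h_H2 k)) _.
by rewrite ler_wpM2l.
Qed.

Lemma wd2_bound_coord k i :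
  prim (fun t => wd2 L (u_ k) t 0 i ^+ 2) L <= 2 * C / (1 - gamma).
Proof.
apply: le_trans (wd2_bound k); rewrite (bigD1 i)//= lerDl sumr_ge0// => j _.
by apply: prim_ge0 => t _; exact: sqr_ge0.
Qed.

(** The derivative has length exactly 1 at the node 0, and its increments are controlled by the
    second derivative. *)
Lemma wd1_bound_coord k i : prim (fun t => wd1 L (u_ k) t 0 i ^+ 2) L <=
  (2 + 2 * (L * (2 * C / (1 - gamma)))) * L.
Proof.
have [cu1 u2 up1 up2] := H2_wd L0 (admissible_h_H2 k).
rewrite -(prim_cst _ (ltW L0)); apply: le_prim; first exact: ((L2P _ _).1 (cts_L2 cu1) i).2.
  exact: int1_cst.
move=> t Dt; apply: le_trans (primitive_sq_bound i u2 up2 Dt) _.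
rewrite lerD//.
  rewrite -[leRHS]mulr1 ler_wpM2l// -(admissible_h_unit k); exact: dot_coord.
by rewrite ler_wpM2l// ler_wpM2l ?(ltW L0)//; exact: wd2_bound_coord.
Qed.

Variable u : R -> 'rV[R]_3.
Hypotheses (Hu : H2 L u) (uw : weak_cvg L u_ u).

Let fc := weak_cvg_functional L0 uw.

Lemma admissible_closed : admissible L Phi Lbc lbc u.
Proof.
have HW k := H2_wd L0 (admissible_h_H2 k).
have near x : 0 <= x <= L -> exists j : nat -> nat,
    forall k, (j k <= size (s k))%N /\ `|node (s k) (j k) - x| <= mesh (s k).
  by move=> Dx; have [j jP] := choice (fun k => nearest_node L0 (sP k) Dx); exists j.
split=> //.
- move=> x Dx; rewrite wd1E enorm_sq; have [j jP] := near x Dx.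
  have Dz k : 0 <= node (s k) (j k) <= L by exact: (node_itv (sP k) (jP k).1).
  have c : (fun k => wd1 L (u_ k) (node (s k) (j k))) @ \oo --> wd1 L u x.
    have h1 k : L2 L (wd2 L (u_ k)) by case: (HW k).
    have h2 k : primitive_of L (wd1 L (u_ k)) (wd2 L (u_ k)) by case: (HW k).
    exact: (nearby_cvg h1 h2 wd2_bound_coord Dx Dz (fun k => (jP k).2) s0
      (fcvg_eval_wd1 L0 fc Dx)).
  pose a k := wd1 L (u_ k) (node (s k) (j k)).
  have d : (fun k => dot (a k) (a k)) @ \oo --> dot (wd1 L u x) (wd1 L u x) by exact: dot_cvg.
  rewrite (_ : (fun k => _) = fun=> 1) in d; last first.
    apply/funext => k; have [_ e _ _] := uA k; have := e _ (jP k).1.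
    by rewrite /a -enorm_sq wd1E => ->; rewrite expr1n.
  by apply: (cvg_unique (@Rhausdorff R) d); exact: cvg_cst.
- move=> x Dx; have [j jP] := near x Dx.
  have Dz k : 0 <= node (s k) (j k) <= L by exact: (node_itv (sP k) (jP k).1).
  have c : (fun k => u_ k (node (s k) (j k))) @ \oo --> u x.
    have h1 k : L2 L (wd1 L (u_ k)) by case: (HW k) => c1 *; exact: cts_L2.
    have h2 k : primitive_of L (u_ k) (wd1 L (u_ k)) by case: (HW k).
    exact: (nearby_cvg h1 h2 wd1_bound_coord Dx Dz (fun k => (jP k).2) s0
      (fcvg_eval L0 fc Dx)).
  have cPhi : {for u x, continuous Phi} by exact: differentiable_continuous (PhiC1.1 _).
  have d := cvg_comp _ _ c cPhi.
  rewrite (_ : Phi \o _ = fun=> 0) in d; last first.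
    by apply/funext => k; have [_ _ e _] := uA k; exact: e _ (jP k).1.
  by apply: (cvg_unique (@Rhausdorff R) d); exact: cvg_cst.
- by apply: (bc_closed Lbc_bl uw) => k; case: (uA k).
Qed.

Lemma energy_liminf (c : nat -> R) (m : R) : (forall k, energy L gamma Phi (u_ k) <= c k) ->
  c @ \oo --> m -> energy L gamma Phi u <= m.
Proof.
have [_ _ uS _] := admissible_closed.
(* [M] comes from [(a - b)^2 <= 2 a^2 + 2 b^2] and the uniform bound on the second derivatives. *)
apply: (energy_lsc L0 gamma_ge0 gamma_lt1 PhiC1 Sreg admissible_h_H2 Hu fc uS
  (M := 2 * (2 * C / (1 - gamma)) + 2 * \sum_i prim (fun t => wd2 L u t 0 i ^+ 2) L)).
move=> k i; have a := d2_sqint L0 i (admissible_h_H2 k); have b := d2_sqint L0 i Hu.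
apply: (@le_trans _ _ (2 * prim (fun t => wd2 L (u_ k) t 0 i ^+ 2) L +
    2 * prim (fun t => wd2 L u t 0 i ^+ 2) L)).
  rewrite -(primZ 2 a.2) -(primZ 2 b.2) -(primD (int1Z 2 a.2) (int1Z 2 b.2)).
  apply: le_prim; first exact: (sqintB a b).2.
    exact: int1D (int1Z 2 a.2) (int1Z 2 b.2).
  move=> t _; rewrite -[X in _ + 2 * X]sqrrN; exact: sq_add_le.
rewrite lerD// ler_wpM2l//; first exact: wd2_bound_coord.
rewrite [leRHS](bigD1 i)//= lerDl sumr_ge0// => j _.
by apply: prim_ge0 => t _; exact: sqr_ge0.
Qed.

End Closure.

(** * Boundary conditions of constant fields and coercivity *)

Section ConstantFields.
Context {R : realType} (n l : nat) (L : R) (Lbc : (R -> 'rV[R]_n) -> 'rV[R]_l).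
Hypotheses (L0 : 0 < L) (Lbc_bl : bounded_linear L (@enorm R l) Lbc).
Implicit Types (a b : 'rV[R]_n) (u v : R -> 'rV[R]_n).

Lemma wd_const a : [/\ H2 L (fun=> a), wd1 L (fun=> a) 0 = 0 &
  forall i, aeq L (fun t => wd2 L (fun=> a) t 0 i) (fun=> 0)].
Proof.
have z (b : 'rV[R]_n) : primitive_of L (fun=> b) (fun=> 0).
  move=> i x /andP[x0 _]; rewrite (@eq_prim _ _ _ (fun=> 0)); last by move=> t _; rewrite mxE.
  by rewrite prim_cst// mul0r addr0.
have z2 : L2 L (fun=> 0 : 'rV[R]_n) by apply: cts_L2; move=> x; exact: cvg_cst.
have [H e1 e2] := wd_H2 L0 z2 (z a) (z 0); split=> //.
  by rewrite e1// lexx ltW.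
by move=> i; apply: aeq_trans (e2 i) _; apply: aeq_eq => t _; rewrite mxE.
Qed.

Lemma bc_const_lin (c : R) a b :
  Lbc (fun=> c *: a + b) = c *: Lbc (fun=> a) + Lbc (fun=> b).
Proof. by have [Ha _ _] := wd_const a; have [Hb _ _] := wd_const b; exact: Lbc_bl.1. Qed.

Definition bc_mx : 'M[R]_(n, l) := \matrix_(i, j) Lbc (fun=> delta_mx 0 i) 0 j.

Lemma bc_const a : Lbc (fun=> a) = a *m bc_mx.
Proof.
have z : Lbc (fun=> 0) = 0.
  by have := bc_const_lin (-1) 0 0; rewrite scaler0 addr0 scaleN1r addNr.
have sum (r : seq 'I_n) : Lbc (fun=> \sum_(i <- r) a 0 i *: delta_mx 0 i) =
    \sum_(i <- r) a 0 i *: Lbc (fun=> delta_mx 0 i).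
  elim: r => [|i r IH]; first by rewrite !big_nil.
  by rewrite !big_cons bc_const_lin IH.
rewrite {1}(row_sum_delta a) sum; apply/rowP => j; rewrite summxE mxE.
by apply: eq_bigr => i _; rewrite !mxE.
Qed.

Hypothesis definiteness : forall v, H2 L v -> Lbc v = 0 ->
  L2norm L (d2 L v) = 0 -> forall x : R, 0 <= x <= L -> v x = 0.

Lemma bc_const_inj a : Lbc (fun=> a) = 0 -> a = 0.
Proof.
move=> a0; have [H _ e] := wd_const a.
apply: (definiteness H a0 _ (x := 0)); last by rewrite lexx ltW.
have [_ h2 _ _] := H2_wd L0 H.
apply/eqP; rewrite wd2E -sqrf_eq0 (L2norm_sq h2) big1// => i _.
rewrite (@ae_prim _ _ _ (fun=> 0) ((L2P _ _).1 h2 i).2 (int1_cst L 0)).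
  by rewrite prim_cst ?ltW// mul0r.
by apply: ae_imp (e i) => t h Dt; rewrite h// expr0n.
Qed.

(** On constants [Lbc] is an injective matrix, hence has a right inverse [P] (vectors are rows).
    Cauchy-Schwarz in each coordinate gives for [K] the squared Frobenius norm of [P]. *)
Lemma bc_const_bound : exists K, 0 <= K /\
  forall a, dot a a <= K * dot (Lbc (fun=> a)) (Lbc (fun=> a)).
Proof.
have fr : row_free bc_mx.
  by apply: inj_row_free => a; rewrite -bc_const; exact: bc_const_inj.
pose P := pinvmx bc_mx.
exists (\sum_i dot (row i P^T) (row i P^T)); split.
  by apply: sumr_ge0 => i _; exact: dot_ge0.
move=> a; rewrite mulr_suml /dot; apply: ler_sum => i _; rewrite -expr2 mulrC.
suff -> : a 0 i = dot (Lbc (fun=> a)) (row i P^T) by exact: dot_cauchy_schwarz.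
have e : a = Lbc (fun=> a) *m P by rewrite bc_const -mulmxA mulmxVp// mulmx1.
by rewrite {1}e mxE; apply: eq_bigr => j _; rewrite !mxE.
Qed.

Lemma dot_sub_le (m : nat) (b c : 'rV[R]_m) : dot (b - c) (b - c) <= 2 * dot b b + 2 * dot c c.
Proof.
have := dot_ge0 (1 *: b + c); rewrite (subr_scale b c).
rewrite !dot_linl !dot_linr (dotC c b); lra.
Qed.

(** With [w] the constant [v 0], the remainder [v - w] has [ip] equal to the last bracket [E]. The
    constant is recovered from [Lbc w = Lbc v - Lbc (v - w)], whose second term is bounded by [E]
    through the continuity of [Lbc]. *)
Lemma bc_coercive : exists K1 K2, 0 <= K2 /\ forall v, H2 L v -> ip L v v <=
  K1 * dot (Lbc v) (Lbc v) + K2 * (dot (wd1 L v 0) (wd1 L v 0) +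
    \sum_i prim (fun t => wd2 L v t 0 i ^+ 2) L).
Proof.
have [K [K0 KP]] := bc_const_bound.
have [lin [C bd]] := Lbc_bl; have [C1 [C10 C1P]] := H2norm_le_ip n L0.
exists (2 * K), (2 * K * (C ^+ 2 * C1) + 1); split.
  by have := mulr_ge0 K0 (mulr_ge0 (sqr_ge0 C) (ltW C10)); lra.
move=> v Hv; have [Hw w1 w2] := wd_const (v 0).
set w := (fun=> v 0) in Hw w1 w2.
have [Hr _ _] := H2_sub L0 Hv Hw.
set E := dot (wd1 L v 0) _ + _.
have ipr : ip L (v - w) (v - w) = E.
  rewrite (ip_sub L0 Hv Hw) /E /dot -big_split/=; apply: eq_bigr => i _.
  rewrite w1 subrr expr0n add0r mxE subr0 -expr2; congr (_ + _).
  apply: ae_prim; [|exact: (d2_sqint L0 i Hv).2|].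
    exact: (sqintB (d2_sqint L0 i Hv) (d2_sqint L0 i Hw)).2.
  by apply: ae_imp (w2 i) => t h Dt; rewrite h// subr0.
have ipv : ip L v v = dot (v 0) (v 0) + E.
  rewrite /E /dot -!big_split/= /ip; apply: eq_bigr => i _; rewrite -addrA; congr (_ + (_ + _)).
have lw : Lbc w = Lbc v - Lbc (v - w).
  have := lin (-1) w v Hw Hv; rewrite scaleN1r => h.
  rewrite (subr_scale v w : v - w = (fun x => -1 *: w x + v x)) h.
  by rewrite opprD opprK addrC subrK.
have r2 : dot (Lbc (v - w)) (Lbc (v - w)) <= C ^+ 2 * C1 * E.
  rewrite -enorm_sq -ipr -mulrA.
  have b := bd _ Hr; have e0 : 0 <= enorm (Lbc (v - w)) by exact: sqrtr_ge0.
  apply: le_trans (_ : (C * H2norm L (v - w)) ^+ 2 <= _).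
    by rewrite lerXn2r// nnegrE// (le_trans e0).
  by rewrite exprMn ler_wpM2l ?sqr_ge0//; exact: C1P.
rewrite ipv; apply: le_trans (lerD (KP _) (lexx E)) _; rewrite -/w lw.
have := ler_wpM2l K0 (dot_sub_le (Lbc v) (Lbc (v - w))).
have := ler_wpM2l K0 r2.
move: (dot _ _) (dot _ _) (dot _ _) => x y z; lra.
Qed.

End ConstantFields.

Lemma cvg_ubound {R : realType} (a : nat -> R) (l : R) : a @ \oo --> l ->
  exists M, forall k, a k <= M.
Proof.
move=> c; have /cvg_seq_bounded[M [_ MP]] : cvgn a by apply/cvg_ex; exists l.
by exists (M + 1) => k; apply: le_trans (ler_norm _) _; apply: MP => //; rewrite ltrDl.
Qed.

Section RecoverySequence.
Context {R : realType} (L gamma : R) (Phi : 'rV[R]_3 -> R) (l : nat)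
    (Lbc : (R -> 'rV[R]_3) -> 'rV[R]_l) (lbc : 'rV[R]_l).
Hypotheses (L0 : 0 < L) (gamma_ge0 : 0 <= gamma) (gamma_lt1 : gamma < 1).
Hypotheses (PhiC1 : C1_field Phi) (Sreg : regular_level_set Phi).
Hypothesis Lbc_bdry : depends_only_on_bdry L Lbc.
Hypothesis density : forall u, admissible L Phi Lbc lbc u ->
  forall eps : R, 0 < eps -> exists v, [/\ admissible L Phi Lbc lbc v, H3 L v &
    H2norm L (fun x => v x - u x) < eps].
Variables (s : nat -> seq R).
Hypotheses (sP : forall k, itv_partition 0 L (s k))
  (s0 : (fun k => mesh (s k)) @ \oo --> (0 : R)).

Lemma recovery u : admissible L Phi Lbc lbc u -> exists v_ : nat -> R -> 'rV[R]_3,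
  [/\ forall k, admissible_h L Phi Lbc lbc (s k) (v_ k), forall k, H2 L (v_ k),
      strong_cvg L v_ u &
      (fun k => energy L gamma Phi (v_ k)) @ \oo --> energy L gamma Phi u].
Proof.
move=> uA; have [Hu u1 uS ul] := uA.
have [v_ vP] := choice (fun k => interpolation_error L0 (sP k) Hu).
have Hv k : H2 L (v_ k) by case: (vP k).
have dens (e : R) : 0 < e -> exists kappa m, [/\ L2 L m, primitive_of L kappa m &
    \sum_i prim (fun t => (wd2 L u t 0 i - kappa t 0 i) ^+ 2) L <= e].
  move=> e0; have [C [C0 CP]] := ip_le_H2norm 3 L0.
  (* As [ip <= C * H2norm ^ 2], an H^2 distance below this radius makes [ip] at most [e]. *)
  have d0 : 0 < Num.sqrt (e / C) by rewrite sqrtr_gt0 divr_gt0.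
  have [v [_ H3v vu]] := density uA d0.
  have [kappa [m [m2 km le]]] := H3_approx L0 Hu H3v.
  exists kappa, m; split=> //; apply: le_trans le _.
  have [Hr _ _] := H2_sub L0 H3v.1 Hu; apply: le_trans (CP _ Hr) _.
  have h0 : 0 <= H2norm L (v - u) by exact: sqrtr_ge0.
  have h2 : H2norm L (v - u) ^+ 2 <= Num.sqrt (e / C) ^+ 2.
    by rewrite lerXn2r// ?nnegrE ?sqrtr_ge0//; exact: ltW.
  rewrite sqr_sqrtr in h2; last by rewrite divr_ge0// ltW.
  by have := ler_wpM2l (ltW C0) h2; rewrite [C * (e / C)]mulrC divfK ?gt_eqF.
have c0 : (fun k => ip L (v_ k - u) (v_ k - u)) @ \oo --> (0 : R).
  by apply: (interpolants_cvg L0 s0 dens) => k; case: (vP k).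
exists v_; split=> //.
- move=> k; have [FE _ vu wu _] := vP k; split=> //.
  + move=> j js; rewrite wd1E wu// -wd1E; apply/eqP.
    rewrite -(@eqrXn2 _ 2)// ?sqrtr_ge0// expr1n; apply/eqP; apply: u1.
    exact: node_itv.
  + by move=> j js; rewrite vu//; apply: uS; exact: node_itv.
  (* Both ends of the interval are nodes, so the interpolant has the boundary values of u and u'. *)
  + rewrite -ul; apply: Lbc_bdry => //; rewrite ?wd1E.
    * exact: vu 0%N isT.
    * by have := vu _ (leqnn _); rewrite (node_size (sP k)).
    * exact: wu 0%N isT.
    * by have := wu _ (leqnn _); rewrite (node_size (sP k)).
- have [C [C0 CP]] := H2norm_le_ip 3 L0.
  apply: (cvg0_sq (M := C) _ c0) => k; rewrite mulrC.
  by have [Hr _ _] := H2_sub L0 (Hv k) Hu; exact: CP.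
have [M MP] := cvg_ubound c0.
apply: (energy_cvg L0 gamma_ge0 gamma_lt1 PhiC1 Sreg Hv Hu _ uS (M := M) _ c0).
  exact: strong_cvg_functional.
move=> k i; apply: le_trans (MP k); rewrite (ip_sub L0 (Hv k) Hu) (bigD1 i)//=.
rewrite -[leLHS]add0r -addrA -addrA lerD ?sqr_ge0// -[leLHS]add0r lerD ?sqr_ge0//.
rewrite lerDl sumr_ge0// => j _; rewrite !addr_ge0 ?sqr_ge0//.
by apply: prim_ge0 => t _; exact: sqr_ge0.
Qed.

End RecoverySequence.

Lemma cvg_EFin_seq {R : realType} (a : nat -> R) (l : R) : a @ \oo --> l ->
  (fun k => (a k)%:E) @ \oo --> l%:E.
Proof. by move=> c; apply: cvg_EFin; [exact: nearW|exact: c]. Qed.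

(** The bounds [0] and [c] make the lower limit finite. Each tail infimum lies below
    [m + harmonic k], which gives the next index; this upper bound is all that lower semicontinuity
    uses. *)
Lemma liminf_extraction {R : realType} (a : nat -> R) (c : R) :
  (forall k, 0 <= a k) -> (forall k, a k <= c) -> exists m tau,
  [/\ limn_einf (fun k => (a k)%:E) = m%:E, {homo tau : i j / (i < j)%N} &
      forall k, a (tau k) <= m + harmonic k].
Proof.
move=> a0 ac; pose f k := (a k)%:E; pose S := ereal_sup (range (einfs f)).
have SE : limn_einf f = S by rewrite limn_einf_lim; apply/cvg_lim => //; exact: cvg_einfs_sup.
have S0 : (0 <= S)%E.
  apply: (@le_trans _ _ (einfs f 0)); last by apply: ereal_sup_ubound; exists 0%N.
  by apply: le_ereal_inf_tmp => _ [p _ <-]; rewrite lee_fin.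
have Sc : (S <= c%:E)%E.
  apply: ge_ereal_sup => _ [k _ <-]; apply: (@le_trans _ _ (f k)); last by rewrite lee_fin.
  by apply: ereal_inf_lbound; exists k => //=.
have Sm : S = (fine S)%:E.
  by rewrite fineK// ge0_fin_numE// (le_lt_trans Sc)// ltry.
have [k n|tau [ht tP]] := @extraction (fun k p => a p <= fine S + harmonic k) _.
  have : (einfs f n < (fine S + harmonic k)%:E)%E.
    apply: (@le_lt_trans _ _ S); first by apply: ereal_sup_ubound; exists n.
    by rewrite {1}Sm lte_fin ltrDl harmonic_gt0.
  move=> /ereal_inf_lt[_ [p /= np <-]]; rewrite lte_fin => h.
  by exists p; split=> //; exact: ltW.
by exists (fine S), tau; split=> //; rewrite -Sm.
Qed.

(** * Gamma-convergence *)

Section GammaConvergence.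
Context {R : realType} (L gamma : R) (Phi : 'rV[R]_3 -> R) (l : nat)
    (Lbc : (R -> 'rV[R]_3) -> 'rV[R]_l) (lbc : 'rV[R]_l).
Hypotheses (L0 : 0 < L) (gamma_ge0 : 0 <= gamma) (gamma_lt1 : gamma < 1).
Hypotheses (PhiC1 : C1_field Phi) (Sreg : regular_level_set Phi).
Hypothesis Lbc_bl : bounded_linear L (@enorm R l) Lbc.
Implicit Types u v : R -> 'rV[R]_3.
Notation A := (admissible L Phi Lbc lbc).
Notation Ah := (admissible_h L Phi Lbc lbc).
Notation E := (energy L gamma Phi).

Lemma I_E u : A u -> I_ L gamma Phi Lbc lbc u = (E u)%:E.
Proof. by rewrite /I_ => /asboolT ->. Qed.

Lemma I_hE s u : Ah s u -> I_h L gamma Phi Lbc lbc s u = (E u)%:E.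
Proof. by rewrite /I_h => /asboolT ->. Qed.

Lemma I_h_fin s u (c : R) : (I_h L gamma Phi Lbc lbc s u <= c%:E)%E ->
  Ah s u /\ E u <= c.
Proof.
have [h|h] := pselect (Ah s u); first by rewrite I_hE// lee_fin.
by rewrite /I_h (asboolF h) leye_eq.
Qed.

Variable s : nat -> seq R.
Hypotheses (sP : forall k, itv_partition 0 L (s k))
  (s0 : (fun k => mesh (s k)) @ \oo --> (0 : R)).

Lemma subseq_closure (u_ : nat -> R -> 'rV[R]_3) u sigma (C m : R) (c : nat -> R) :
  (forall k, Ah (s k) (u_ k)) -> (forall k, E (u_ k) <= C) ->
  {homo sigma : i j / (i < j)%N} -> H2 L u -> weak_cvg L (fun k => u_ (sigma k)) u ->
  (forall k, E (u_ (sigma k)) <= c k) -> c @ \oo --> m -> A u /\ E u <= m.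
Proof.
move=> uA uC hs Hu uw uc cm; have uA' k := uA (sigma k); have uC' k := uC (sigma k).
have sP' k := sP (sigma k).
have s0' : (fun k => mesh (s (sigma k))) @ \oo --> (0 : R).
  exact: (cvg_comp _ _ (homo_cvg hs) s0).
split; first exact: (admissible_closed L0 gamma_ge0 gamma_lt1 PhiC1 Lbc_bl sP' s0' uA' uC' Hu uw).
exact: (energy_liminf L0 gamma_ge0 gamma_lt1 PhiC1 Sreg Lbc_bl sP' s0' uA' uC' Hu uw uc cm).
Qed.

(** The subsequence [tau] realizing the lower limit is taken before compactness extracts [rho]; so
    the limit along [tau \o rho] is compared with the lower limit of the whole sequence. *)
Lemma gamma_liminf (u_ : nat -> R -> 'rV[R]_3) (c : R) :
  (forall v, H2 L v -> Lbc v = 0 ->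
     L2norm L (d2 L v) = 0 -> forall x : R, 0 <= x <= L -> v x = 0) ->
  (forall k, Ah (s k) (u_ k)) -> (forall k, E (u_ k) <= c) -> exists u sigma,
  [/\ A u, {homo sigma : i j / (i < j)%N}, weak_cvg L (fun k => u_ (sigma k)) u &
      ((E u)%:E <= limn_einf (fun k => (E (u_ k))%:E))%E].
Proof.
move=> dfn uA uc.
have E0 k : 0 <= E (u_ k) by exact: energy_ge0.
have [m [tau [me ht taum]]] := liminf_extraction E0 uc.
have Hu k := admissible_h_H2 L0 sP uA k.
have [K1 [K2 [K20 KP]]] := bc_coercive L0 Lbc_bl dfn.
have bd k : ip L (u_ (tau k)) (u_ (tau k)) <=
    K1 * dot lbc lbc + K2 * (1 + 2 * c / (1 - gamma)).
  apply: le_trans (KP _ (Hu _)) _; have [_ _ _ ->] := uA (tau k).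
  rewrite lerD2l ler_wpM2l// (admissible_h_unit uA) lerD2l.
  exact: (wd2_bound L0 gamma_ge0 gamma_lt1 PhiC1 sP uA uc).
have [u [rho [H2u hr uw]]] := H2_weak_compactness L0 (fun k => Hu (tau k)) bd.
have hs : {homo tau \o rho : i j / (i < j)%N} by move=> i j ij; exact/ht/hr.
have cm : (fun k => m + harmonic (rho k)) @ \oo --> m.
  rewrite -[m in X in _ --> X]addr0; apply: cvgD; first exact: cvg_cst.
  exact: (cvg_comp _ _ (homo_cvg hr) cvg_harmonic).
have [uAd um] := subseq_closure uA uc hs H2u uw (fun k => taum (rho k)) cm.
by exists u, (tau \o rho); split=> //; rewrite me lee_fin.
Qed.

(** The recovery sequence [v_] is a competitor in each discrete problem: it bounds the energy of
    [u_ k] by [E (v_ k) + eps k], which also forces [u_ k] to be admissible. *)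
Lemma quasiminimizer_limit (u_ v_ : nat -> R -> 'rV[R]_3) (eps : nat -> R) u v sigma :
  eps @ \oo --> (0 : R) ->
  (forall k, quasiminimizer L gamma Phi Lbc lbc (s k) (eps k) (u_ k)) ->
  H2 L u -> {homo sigma : i j / (i < j)%N} -> weak_cvg L (fun k => u_ (sigma k)) u ->
  (forall k, Ah (s k) (v_ k)) -> (fun k => E (v_ k)) @ \oo --> E v -> A u /\ E u <= E v.
Proof.
move=> e0 uq Hu hs uw vA vE.
have ek k : Ah (s k) (u_ k) /\ E (u_ k) <= E (v_ k) + eps k.
  apply: I_h_fin; have [_ h] := uq k; apply: le_trans h _.
  rewrite EFinD leeD2r// -(I_hE (vA k)); apply: ereal_inf_lbound.
  by exists (v_ k) => //=; exact: (admissible_h_H2 L0 sP vA).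
have c : (fun k => E (v_ k) + eps k) @ \oo --> E v.
  by rewrite -[E v]addr0; exact: cvgD.
have [C CP] := cvg_ubound c.
apply: (subseq_closure (fun k => (ek k).1) (fun k => le_trans (ek k).2 (CP k)) hs Hu uw
  (fun k => (ek (sigma k)).2)).
exact: (cvg_comp _ _ (homo_cvg hs) c).
Qed.

End GammaConvergence.

Theorem proposition2p3 (R : realType) (L gamma : R)
    (Phi : 'rV[R]_3 -> R) (l : nat)
    (Lbc : (R -> 'rV[R]_3) -> 'rV[R]_l) (lbc : 'rV[R]_l)
    (s : nat -> seq R)
    (L_gt0 : 0 < L)
    (gamma_ge0 : 0 <= gamma) (gamma_lt1 : gamma < 1)
    (Phi_C1 : C1_field Phi) (S_regular : regular_level_set Phi)
    (Lbc_bounded_linear : bounded_linear L (@enorm R l) Lbc)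
    (Lbc_bdry : depends_only_on_bdry L Lbc)
    (A_nonempty : exists v, admissible L Phi Lbc lbc v)
    (definiteness : forall v, H2 L v -> Lbc v = 0 ->
       L2norm L (d2 L v) = 0 -> forall x : R, 0 <= x <= L -> v x = 0)
    (density : forall u, admissible L Phi Lbc lbc u ->
       forall eps : R, 0 < eps ->
       exists v, [/\ admissible L Phi Lbc lbc v, H3 L v &
                     H2norm L (fun x => v x - u x) < eps])
    (s_partition : forall k, itv_partition 0 L (s k))
    (mesh_to0 : (fun k => mesh (s k)) @ \oo --> (0 : R)) :
  [/\ 
      forall (u_ : nat -> R -> 'rV[R]_3) (c : R),
        (forall k, admissible_h L Phi Lbc lbc (s k) (u_ k)) ->
        (forall k, (I_h L gamma Phi Lbc lbc (s k) (u_ k) <= c%:E)%E) ->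
        exists u, exists sigma : nat -> nat,
          [/\ admissible L Phi Lbc lbc u,
              {homo sigma : i j / (i < j)%N},
              weak_cvg L (fun k => u_ (sigma k)) u &
              (I_ L gamma Phi Lbc lbc u <=
               limn_einf (fun k => I_h L gamma Phi Lbc lbc (s k) (u_ k)))%E],
      forall u, admissible L Phi Lbc lbc u ->
        exists u_ : nat -> R -> 'rV[R]_3,
          [/\ forall k, H2 L (u_ k),
              strong_cvg L u_ u &
              (fun k => I_h L gamma Phi Lbc lbc (s k) (u_ k)) @ \oo -->
                I_ L gamma Phi Lbc lbc u] &
      forall (u_ : nat -> R -> 'rV[R]_3) (eps : nat -> R)
             (u : R -> 'rV[R]_3) (sigma : nat -> nat),
        (forall k, 0 <= eps k) -> eps @ \oo --> (0 : R) ->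
        (forall k,
           quasiminimizer L gamma Phi Lbc lbc (s k) (eps k) (u_ k)) ->
        H2 L u -> {homo sigma : i j / (i < j)%N} ->
        weak_cvg L (fun k => u_ (sigma k)) u ->
        minimizer L gamma Phi Lbc lbc u].
Proof.
split.
- move=> u_ c uA uc.
  have uE k := I_hE gamma (uA k).
  have [u [sigma [uAd hs uw ul]]] := gamma_liminf L_gt0 gamma_ge0 gamma_lt1 Phi_C1 S_regular
    Lbc_bounded_linear s_partition mesh_to0 definiteness uA (fun k => (I_h_fin (uc k)).2).
  exists u, sigma; split=> //; rewrite (I_E gamma uAd).
  by rewrite (_ : (fun k => I_h _ _ _ _ _ _ _) = fun k => (energy L gamma Phi (u_ k))%:E)//; exact/funext.
- move=> u uA.
  have [v_ [vA vH vu vE]] := recovery L_gt0 gamma_ge0 gamma_lt1 Phi_C1 S_regular Lbc_bdry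
    density s_partition mesh_to0 uA.
  exists v_; split=> //; rewrite (I_E gamma uA).
  rewrite (_ : (fun k => I_h _ _ _ _ _ _ _) = fun k => (energy L gamma Phi (v_ k))%:E); last first.
    by apply/funext => k; exact: I_hE.
  exact: cvg_EFin_seq.
- move=> u_ eps u sigma _ eps0 uq Hu hs uw.
  have better v : admissible L Phi Lbc lbc v ->
      admissible L Phi Lbc lbc u /\ energy L gamma Phi u <= energy L gamma Phi v.
    move=> vA; have [v_ [vA_ _ _ vE]] := recovery L_gt0 gamma_ge0 gamma_lt1 Phi_C1 S_regular
      Lbc_bdry density s_partition mesh_to0 vA.
    exact: (quasiminimizer_limit L_gt0 gamma_ge0 gamma_lt1 Phi_C1 S_regular Lbc_bounded_linear
      s_partition mesh_to0 eps0 uq Hu hs uw vA_ vE).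
  (* A first competitor makes the discrete infima finite, and this yields the admissibility of
     [u]. *)
  have [v0 /better[uA _]] := A_nonempty.
  split; first exact: Hu.
  move=> v _; have uE := I_E gamma uA.
  have [vA|vA] := pselect (admissible L Phi Lbc lbc v); last first.
    by rewrite [leRHS]/I_ (asboolF vA) leey.
  by have vE := I_E gamma vA; rewrite uE vE lee_fin; case: (better v vA).
Qed.
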